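(* Let $L\in C^\infty(T^nM)$. If $\mu$ is a holonomic measure on $T^nM$ that is critical for $A_L$, then there exists a sequence $\{\omega^i\}_i\subset\Omega^{n-1}(M)$ such that $$\nabla_vL|_{\operatorname{supp}\mu}=\lim_{i\to\infty}\nabla_v\,d\omega^i,$$ where the limit is taken in the Hilbert space $\mathcal{H}$.
   Context: $M$ is a compact oriented $C^\infty$ manifold without boundary, of dimension $d\ge1$, with a fixed Riemannian metric $g$; $1\le n\le d$. $T^nM=TM\oplus\cdots\oplus TM$ ($n$ copies), with elements $(x,v)=(x,v_1,\dots,v_n)$, $x\in M$, $v_i\in T_xM$; $T^n_xM$ is the fiber over $x$. $\Omega^k(M)$ is the space of smooth differential $k$-forms on $M$; $n$-forms are regarded as functions on $T^nM$. $C^\infty_c(T^nM)$ is the space of compactly supported smooth real functions on $T^nM$. For $\omega\in\Omega^n(M)$ put $\|\omega\|=\sup\{\omega_x(v_1,\dots,v_n): (x,v_1,\dots,v_n)\in T^nM,\ |v_i|\le1\}$, where $|v_i|=\sqrt{g(v_i,v_i)}$, and put $\operatorname{vol}_n(v_1,\dots,v_n)=\sup_{\omega\in\Omega^n(M),\,\|\omega\|\le1}\omega_x(v_1,\dots,v_n)$. A positive Borel measure $\mu$ on $T^nM$ is mild if $\int_{T^nM}\operatorname{vol}_n\,d\mu<\infty$. A mild measure $\mu$ is holonomic if it is a probability measure and $\int_{T^nM}d\omega\,d\mu=0$ for all $\omega\in\Omega^{n-1}(M)$. A distribution $\eta$ on $T^nM$ is mild if, for a partition of unity $\{\psi_i\}_i\subset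 C_c^\infty(T^nM)$, the series $\langle\eta,\omega\rangle=\sum_i\langle\eta,\psi_i\omega\rangle$ converges absolutely for all $\omega\in\Omega^n(M)$. A variation of a holonomic measure $\mu$ is a family $(\mu_t)_{t\ge0}$ of holonomic measures with $\mu_0=\mu$ that is differentiable at $0$, that is, there is a mild distribution $\eta$ with $\frac{d}{dt}\big|_{t=0+}\int f\,d\mu_t=\langle\eta,f\rangle$ for all $f\in C^\infty_c(T^nM)$. The action of $L$ is $A_L(\mu)=\int_{T^nM}L\,d\mu$. The measure $\mu$ is critical for $A_L$ if for every variation $\mu_t$ of $\mu$ the one-sided derivative satisfies $\frac{d}{dt}\big|_{t=0+}A_L(\mu_t)\ge0$. For $u=(u_1,\dots,u_n)$, $u'=(u'_1,\dots,u'_n)\in T^n_xM$ let $g(u,u')=\sum_{i}g(u_i,u'_i)$. The gradient $\nabla_{v_i}f$ of a function $f$ on $T^nM$ is defined by $g(u_i,\nabla_{v_i}f)=\lim_{t\to0}\frac{f(x,v_1,\dots,v_i+tu_i,\dots,v_n)-f(x,v_1,\dots,v_n)}{t}$ for all vector fields $u_i$ on $M$, and $\nabla_vf$ is defined by $g((u_1,\dots,u_n),\nabla_vf)=\sum_ig(u_i,\nabla_{v_i}f)$. $\mathcal{H}$ is the Hilbert space of all functions $u:\operatorname{supp}\mu\subseteq T^nM\to T^nM$ such that $u(x,v)\in T^n_xM$ for all $(x,v)$ and $\int g(u,u)\,d\mu<\infty$, with inner product $(u,u')=\int g(u,u')\,d\mu$. The set of gradients $\nabla_v\,d\omega$ of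 exact $n$-forms, $\omega\in\Omega^{n-1}(M)$ (with $d\omega$ viewed as a function on $T^nM$), is a subspace of $\mathcal{H}$.
   Formalization: The context's assertion that all gradients of exact n-forms lie in H is assumed of μ: for n≥2 it can fail for holonomic μ (it holds for n=1 or compact support), and then the claim can fail. Criticality is tested only on variations with finite action near 0 and an existing derivative. *)

(* Defs.v *)
From HB Require Import structures.
From mathcomp Require Import all_boot all_order all_algebra.
From mathcomp Require Import all_classical all_reals all_analysis.

Set Implicit Arguments.
Unset Strict Implicit.
Unset Printing Implicit Defensive.

Import Order.TTheory GRing.Theory Num.Theory.
Import numFieldNormedType.Exports.

Local Open Scope classical_set_scope.
Local Open Scope ring_scope.

Section smooth.
Context {R : realType} {V W : normedModType R}.

(* Meant for open [U]. *)
Fixpoint Ck_on (k : nat) (U : set V) (f : V -> W) : Prop :=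
  if k is k'.+1 then
    (forall x, U x -> differentiable f x) /\
    (forall v, Ck_on k' U ('D_v f))
  else forall x, U x -> {for x, continuous f}.

Definition smooth_on (U : set V) (f : V -> W) := forall k, Ck_on k U f.

Definition iter_derive (vs : seq V) (f : V -> W) : V -> W :=
  foldr (fun v h => 'D_v h) f vs.

End smooth.

(* A C^oo atlas on [M] modelled on R^d, together with a preferred chart       *)
(* [chart_at x] around each point [x]; [par i] inverts [chart i] on its image *)
(* and is unconstrained elsewhere.  The atlas need not be maximal.            *)
Record smooth_atlas (R : realType) (d : nat) (M : ptopologicalType) := SmoothAtlas {
  idx : Type ;
  dom : idx -> set M ;
  chart : idx -> M -> 'rV[R]_d ;
  par : idx -> 'rV[R]_d -> M ;
  chart_at : M -> idx ;
  dom_open : forall i, open (dom i) ;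
  cod_open : forall i, open (chart i @` dom i) ;
  chartK : forall i x, dom i x -> par i (chart i x) = x ;
  chart_continuous : forall i, {within dom i, continuous (chart i)} ;
  par_continuous : forall i, {within chart i @` dom i, continuous (par i)} ;
  dom_chart_at : forall x, dom (chart_at x) x ;
  transition_smooth : forall i j,
    smooth_on (chart i @` (dom i `&` dom j)) (chart j \o par i)
}.

(* T_xM is the space 'rV[R]_d of coordinates in the chart [chart_at x]; an    *)
(* element of T^n_xM is the matrix whose rows are v_1, ..., v_n.  Coordinates *)
(* are row vectors, so Jacobians act on the right.                            *)
Record tangent (R : realType) (d : nat) (M : ptopologicalType)
    (A : smooth_atlas R d M) (n : nat) :=
  Tangent { base : M ; vec : 'M[R]_(n, d) }.

Section tangent.
Context {R : realType} {d : nat} {M : ptopologicalType}.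
Variable A : smooth_atlas R d M.

Definition cod (i : idx A) : set 'rV[R]_d := chart i @` dom i.

Definition to_chart (i : idx A) (x : M) : 'M[R]_d :=
  'J (chart i \o par (chart_at A x)) (chart (chart_at A x) x).

Definition of_chart (i : idx A) (x : M) : 'M[R]_d :=
  'J (chart (chart_at A x) \o par i) (chart i x).

Definition oriented := forall (i j : idx A) x, dom i x -> dom j x ->
  0 < \det ('J (chart j \o par i) (chart i x) : 'M[R]_d).

(* The parametrization of T^nM over the i-th chart of M. *)
Definition tpar n (i : idx A) (z : 'rV[R]_d * 'M[R]_(n, d)) : tangent A n :=
  let x := par i z.1 in Tangent A x (z.2 *m of_chart i x).

Definition tcod n (i : idx A) : set ('rV[R]_d * 'M[R]_(n, d)) :=
  [set z | cod i z.1].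

HB.instance Definition _ n := gen_eqMixin (tangent A n).
HB.instance Definition _ n := gen_choiceMixin (tangent A n).
HB.instance Definition _ n := isPointed.Build (tangent A n) (Tangent A point 0).

Definition tangent_open n : set_system (tangent A n) :=
  [set O | forall i, open (@tcod n i `&` @tpar n i @^-1` O)].

Lemma tcod_open n i : open (@tcod n i).
Proof.
have -> : @tcod n i = fst @^-1` cod i by [].
apply: open_comp; last exact: cod_open.
by move=> z _; exact: cvg_fst.
Qed.

Lemma tangent_openT n : @tangent_open n setT.
Proof. by move=> i; rewrite preimage_setT setIT; exact: tcod_open. Qed.

Lemma tangent_openI n : setI_closed (@tangent_open n).
Proof.
by move=> O P oO oP i; rewrite preimage_setI setIIr; exact: openI.
Qed.

Lemma tangent_open_bigU n (I : Type) (f : I -> set (tangent A n)) :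
  (forall i, tangent_open (f i)) -> tangent_open (\bigcup_i f i).
Proof.
move=> of_ i; rewrite preimage_bigcup setI_bigcupr.
by apply: bigcup_open => j _; exact: of_.
Qed.

HB.instance Definition _ n := isOpenTopological.Build (tangent A n)
  (@tangent_openT n) (@tangent_openI n) (@tangent_open_bigU n).

Definition borel n := g_sigma_algebraType (@open (tangent A n)).

Definition smooth_fun n (f : tangent A n -> R) :=
  forall i, smooth_on (@tcod n i) (f \o @tpar n i).

(* [p] with its j-th vector replaced by [u]. *)
Definition set_vec n (p : tangent A n) (j : 'I_n) (u : 'rV[R]_d) : tangent A n :=
  Tangent A (base p) (\matrix_(k, l) if k == j then u 0 l else vec p k l).

(* Omega^k(M), k-forms being functions on T^kM; in the last clause a constant *)
(* [W] ranges over tuples of coordinate vectors, i.e. the coefficients of the *)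
(* form in each chart are smooth.                                             *)
Definition Omega k : set (tangent A k -> R) := [set w |
  [/\ (forall p j (a : R) u u', w (set_vec p j (a *: u + u')) =
                          a * w (set_vec p j u) + w (set_vec p j u')),
      (forall p j j', j != j' -> row j (vec p) = row j' (vec p) -> w p = 0) &
      (forall i W, smooth_on (cod i) (fun y => w (tpar i (y, W))))]].

(* In the coordinates y of the preferred chart at x, with constant v_j:       *)
(* dw(v_0, ..., v_k) = sum_j (-1)^j d/dv_j w_y(v_0, .., ^v_j, .., v_k).       *)
Definition extd n (w : tangent A n.-1 -> R) (p : tangent A n) : R :=
  let c := chart_at A (base p) in
  \sum_(j < n) (-1) ^+ j *
    'D_(row j (vec p)) (fun y => w (tpar c (y, row' j (vec p))))
      (chart c (base p)).

Record riemannian := Riemannian {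
  metric :> M -> 'rV[R]_d -> 'rV[R]_d -> R ;
  metric_linear : forall x (a : R) u u' v,
    metric x (a *: u + u') v = a * metric x u v + metric x u' v ;
  metric_sym : forall x u v, metric x u v = metric x v u ;
  metric_pos : forall x u, u != 0 -> 0 < metric x u u ;
  metric_smooth : forall i u v, smooth_on (cod i)
    (fun y => metric (par i y) (u *m of_chart i (par i y))
                               (v *m of_chart i (par i y)))
}.

End tangent.

Arguments borel {R d M} A n.
Arguments Omega {R d M} A k.

Section measures.
Context {R : realType} {d : nat} {M : ptopologicalType}.
Context {A : smooth_atlas R d M}.
Variables (g : riemannian A) (n : nat).

Local Notation T := (tangent A n).
Local Notation measureT := {measure set (borel A n) -> \bar R}.

Definition comass (w : T -> R) : \bar R :=
  ereal_sup [set (w p)%:E | p in [set p : T |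
    forall j, Num.sqrt (g (base p) (row j (vec p)) (row j (vec p))) <= 1]].

Definition voln (p : T) : \bar R :=
  ereal_sup [set (w p)%:E | w in [set w | Omega A n w /\ (comass w <= 1)%E]].

Definition mild (mu : measureT) := (\int[mu]_p voln p < +oo)%E.

Definition holonomic (mu : measureT) :=
  [/\ mild mu, mu setT = 1%E &
      forall w, Omega A n.-1 w -> (\int[mu]_p (extd w p)%:E)%E = 0%E].

Definition test_fun (f : T -> R) := smooth_fun f /\
  exists2 K : set T, compact K & forall p, ~ K p -> f p = 0.

(* Sequential convergence to 0 in C^oo_c(T^nM). *)
Definition test_cvg0 (f : nat -> T -> R) :=
  (exists2 K : set T, compact K & forall k p, ~ K p -> f k p = 0) /\
  forall (i : idx A) (C : set ('rV[R]_d * 'M[R]_(n, d))), compact C ->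
    C `<=` @tcod _ _ _ A n i -> forall vs (e : R), 0 < e ->
    \forall k \near \oo, forall z, C z ->
      `|iter_derive vs (f k \o @tpar _ _ _ A n i : _ -> R^o) z| <= e.

(* Values of [eta] outside of C^oo_c(T^nM) are irrelevant.  For linear        *)
(* functionals on this LF-space sequential continuity is continuity.          *)
Definition distribution_on (eta : (T -> R) -> R) :=
  (forall (a : R) f h, test_fun f -> test_fun h ->
     eta (fun p => a * f p + h p) = a * eta f + eta h) /\
  (forall f : nat -> T -> R, (forall k, test_fun (f k)) -> test_cvg0 f ->
     eta (f k) @[k --> \oo] --> (0 : R)).

(* Countable since T^nM is sigma-compact; finite ones are padded with 0. *)
Definition partition_of_unity (psi : nat -> T -> R) :=
  [/\ forall k, test_fun (psi k),
      forall k p, 0 <= psi k p,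
      forall p : T, exists m, \forall q \near p, forall k, (m <= k)%N -> psi k q = 0 &
      forall p, \sum_(0 <= k < m) psi k p @[m --> \oo] --> (1 : R)].

Definition mild_distribution (eta : (T -> R) -> R) :=
  distribution_on eta /\
  exists2 psi, partition_of_unity psi &
    forall w, Omega A n w ->
      cvgn (series (fun k => `|eta (fun p => psi k p * w p)|)).

Definition right_derivative0 (F : R -> R) (l : R) :=
  (F t - F 0) / t @[t --> 0^'+] --> l.

(* Measures are compared on Borel sets, the only ones where the underlying    *)
(* set function is meaningful.                                                *)
Definition variation (mu : measureT) (mu_ : R -> measureT) :=
  [/\ forall t, 0 <= t -> holonomic (mu_ t),
      forall B : set (borel A n), measurable B -> mu_ 0 B = mu B &
      exists2 eta, mild_distribution eta &
        forall f, test_fun f ->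
          right_derivative0 (fun t => \int[mu_ t]_p f p) (eta f)].

Definition action (L : T -> R) (mu : measureT) : R := \int[mu]_p L p.

Definition has_action (L : T -> R) (mu : measureT) :=
  mu.-integrable setT (EFin \o L).

(* [L] is an arbitrary smooth function, so its integral along a variation     *)
(* may be infinite or undefined, and even when finite need not be             *)
(* differentiable at 0: A_L(mu) has to be a number, and the inequality is     *)
(* required of the variations along which the derivative exists.              *)
Definition critical (L : T -> R) (mu : measureT) :=
  has_action L mu /\
  forall mu_, variation mu mu_ ->
    (\forall t \near 0^'+, has_action L (mu_ t)) ->
    forall l, right_derivative0 (fun t => action L (mu_ t)) l -> 0 <= l.

Definition is_vgrad (f : T -> R) (p : T) (U : 'M[R]_(n, d)) :=
  forall (j : 'I_n) (u : 'rV[R]_d), g (base p) u (row j U) =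
    derive1 (fun t : R => f (set_vec p j (row j (vec p) + t *: u))) 0.

Definition vgrad (f : T -> R) (p : T) : 'M[R]_(n, d) :=
  xget 0 [set U | is_vgrad f p U].

Definition supp (mu : measureT) : set (borel A n) :=
  [set p | forall O : set T, open O -> O p -> (0 < mu O)%E].

Definition gdot (x : M) (U U' : 'M[R]_(n, d)) : R :=
  \sum_(j < n) g x (row j U) (row j U').

(* A function u on supp mu with u(x,v) in T^n_xM is given by the matrix of    *)
(* coordinates of u(x,v); it is measurable as a map to T^nM.                  *)
Definition in_H (mu : measureT) (u : T -> 'M[R]_(n, d)) :=
  measurable_fun (supp mu)
    (fun p : borel A n => Tangent A (base p) (u p) : borel A n) /\
  (\int[mu]_(p in supp mu) (gdot (base p) (u p) (u p))%:E < +oo)%E.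

Definition Hdot (mu : measureT) (u u' : T -> 'M[R]_(n, d)) : R :=
  \int[mu]_(p in supp mu) gdot (base p) (u p) (u' p).

Definition Hnorm (mu : measureT) (u : T -> 'M[R]_(n, d)) : R :=
  Num.sqrt (Hdot mu u u).

Definition H_cvg (mu : measureT) (u_ : nat -> T -> 'M[R]_(n, d))
    (u : T -> 'M[R]_(n, d)) :=
  [/\ in_H mu u, forall i, in_H mu (u_ i) &
      Hnorm mu (fun p => u_ i p - u p) @[i --> \oo] --> (0 : R)].

(* Not a consequence of mildness when n >= 2: the gradients grow like         *)
(* |v|^(n-1).  It holds if n = 1 or if supp mu is compact.                    *)
Definition exact_gradients_in_H (mu : measureT) :=
  forall w, Omega A n.-1 w -> in_H mu (vgrad (extd w)).

End measures.

(* Main.v *)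
Require Import Defs.
From HB Require Import structures.
From mathcomp Require Import all_boot all_order all_algebra.
From mathcomp Require Import all_classical all_reals all_analysis.
From mathcomp Require Import measurable_realfun fingroup perm ring lra.
Set Implicit Arguments.
Unset Strict Implicit.
Unset Printing Implicit Defensive.
Import Order.TTheory GRing.Theory Num.Theory.
Import numFieldNormedType.Exports.
Local Open Scope classical_set_scope.
Local Open Scope ring_scope.

(** To first order, a perturbation of a critical measure along the fibres does not
    change the action if exact forms do not detect it. So every field orthogonal to
    the gradients of exact forms is orthogonal to the gradient of [L], which
    therefore lies in the closure of these gradients.

    Work with the fibre derivative [DL = fdiff C L], the coordinates of the
    differential of [L] along the fibre in charts taken from a finite cover by
    cubes. By compactness the metric is uniformly comparable to the Euclidean one
    of these coordinates ([gdot_fdiff_le]), so it is enough to approximate [DL] in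
    the L^2 space of [mu] by fibre derivatives of exact n-forms.

    Let [u1] be a bounded measurable field on the fibres with bounded support, and
    [u2] another field such that, for every exact form, the integrals of its
    derivatives along [u1] and along [u2] add up to 0. Displace [mu] along [u1],
    one vector of the tuple at a time, and average over the vectors: since an
    exact form is linear in each vector, its integral changes by exactly [t] times
    the integral of its derivative along [u1]. An alternating form is a
    combination, with minors as coefficients, of its values on coordinate frames;
    so positive masses on oriented frames at the same base points, proportional to
    [t], reproduce the derivative along [u2], and restore the vanishing of the
    integrals of exact forms. Dividing by the total mass gives, for every [t], a
    holonomic measure ([variation_exists]). The mass added at rate [cost u2] sits
    on bounded frames, where [L] is bounded; criticality then yields
    [critical_inequality]: - int DL.u1 <= B int cost u2, where [B] does not depend
    on the fields.

    The minors in [cost u2] are themselves derivatives along [u2] of exact forms,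
    because every coordinate n-form is exact on a cube ([coord_form]). The
    gradients of exact forms being square integrable, [cost u2] is at most
    e N |u2|^2 + Q / e with [Q] integrable, for all [e > 0] ([cost_le]).

    - With [u1] minus a truncation of [DL] and [u2 = - u1], the inequality bounds
      the integral of |DL|^2 over the truncation by half of itself plus a constant
      ([derivative_sq]). Hence [DL] is square integrable.

    - Let [u] be the component of [DL] orthogonal to the exact fields, obtained
      from a minimizing sequence ([sq_projection]). With [u1] minus the truncation
      of [u] and [u2] minus the rest of [u], the cost of [u2] tends to 0 as the
      truncation is lifted, so that int u.DL <= 0 ([residual_le]). This integral
      is the squared norm of [u], whence [u = 0]. *)

(** * Alternating multilinear functions of the rows of a matrix *)

Section Alternating.
Variables (R : numFieldType) (d : nat).

Definition setrow m (W : 'M[R]_(m, d)) (j : 'I_m) (u : 'rV[R]_d) : 'M[R]_(m, d) :=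
  \matrix_(k, l) if k == j then u 0 l else W k l.

Definition row_linear m (f : 'M[R]_(m, d) -> R) := forall W j (a : R) u u',
  f (setrow W j (a *: u + u')) = a * f (setrow W j u) + f (setrow W j u').

Definition row_alternating m (f : 'M[R]_(m, d) -> R) := forall W j j',
  j != j' -> row j W = row j' W -> f W = 0.

Definition frame m (I : {ffun 'I_m -> 'I_d}) : 'M[R]_(m, d) :=
  \matrix_(k, l) (l == I k)%:R.

Lemma setrow_id m (W : 'M[R]_(m, d)) j : setrow W j (row j W) = W.
Proof. by apply/matrixP => k l; rewrite !mxE; case: eqP => // ->. Qed.

Lemma setrowC m (W : 'M[R]_(m, d)) j j' u v : j != j' ->
  setrow (setrow W j u) j' v = setrow (setrow W j' v) j u.
Proof.
move=> jj'; apply/matrixP => k l; rewrite !mxE.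
by case: (eqVneq k j') => // ->; rewrite eq_sym (negPf jj').
Qed.

Lemma row_setrow m (W : 'M[R]_(m, d)) j u : row j (setrow W j u) = u.
Proof. by apply/rowP => l; rewrite !mxE eqxx. Qed.

Lemma row_setrow_neq m (W : 'M[R]_(m, d)) j j' u : j' != j ->
  row j' (setrow W j u) = row j' W.
Proof. by move=> jj; apply/rowP => l; rewrite !mxE (negPf jj). Qed.

Section linear.
Variables (m : nat) (f : 'M[R]_(m, d) -> R).
Hypothesis fL : row_linear f.

Lemma row_linear0 W j : f (setrow W j 0) = 0.
Proof.
have := fL W j 1 0 0; rewrite scaler0 addr0 mul1r => /eqP.
by rewrite -subr_eq subrr eq_sym => /eqP.
Qed.

Lemma row_linearZ W j a u : f (setrow W j (a *: u)) = a * f (setrow W j u).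
Proof. by have := fL W j a u 0; rewrite row_linear0 !addr0. Qed.

Lemma row_linearD W j u v :
  f (setrow W j (u + v)) = f (setrow W j u) + f (setrow W j v).
Proof. by have := fL W j 1 u v; rewrite scale1r mul1r. Qed.

Lemma row_linear_sum (T : finType) W j (u : T -> 'rV_d) :
  f (setrow W j (\sum_i u i)) = \sum_i f (setrow W j (u i)).
Proof.
elim/big_rec2: _ => [|i x y _ <-]; first exact: row_linear0.
exact: row_linearD.
Qed.

Lemma row_linear_coord W j (u : 'rV_d) :
  f (setrow W j u) = \sum_l u 0 l * f (setrow W j (delta_mx 0 l)).
Proof.
rewrite {1}(row_sum_delta u) row_linear_sum.
by apply: eq_bigr => l _; rewrite row_linearZ.
Qed.

Lemma row_linear_shift (W : 'M[R]_(m, d)) j t u :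
  f (setrow W j (row j W + t *: u)) = f W + t * f (setrow W j u).
Proof. by rewrite row_linearD row_linearZ setrow_id. Qed.

End linear.

Lemma multilinear_expand m (f : 'M[R]_(m, d) -> R) : row_linear f ->
  forall W, f W = \sum_(I : {ffun 'I_m -> 'I_d}) (\prod_k W k (I k)) * f (frame I).
Proof.
elim: m f => [|m IH] f fL W.
  pose I0 : {ffun 'I_0 -> 'I_d} := ffun0 (card_ord 0).
  rewrite (bigD1 I0) //= [X in _ + X]big1; last first.
    by move=> I /eqP[]; apply/ffunP => -[].
  rewrite addr0 big_ord0 mul1r; congr f; apply/matrixP => -[] //.
pose cons (r : 'rV[R]_d) (X : 'M[R]_(m, d)) : 'M[R]_(m.+1, d) :=
  \matrix_(k, c) if unlift ord0 k is Some k' then X k' c else r 0 c.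
have consE r X : cons r X = setrow (cons 0 X) ord0 r.
  apply/matrixP => k c; rewrite !mxE; case: unliftP => [k' ->|->]; last by rewrite eqxx.
  by rewrite eq_sym (negPf (neq_lift _ _)).
have WE : W = cons (row ord0 W) (\matrix_(k, c) W (lift ord0 k) c).
  by apply/matrixP => k c; rewrite !mxE; case: unliftP => [k' ->|->]; rewrite ?mxE.
have fl l : row_linear (fun X => f (cons (delta_mx 0 l) X)).
  move=> X j a u u'; have E v : cons (delta_mx 0 l) (setrow X j v) =
      setrow (cons (delta_mx 0 l) X) (lift ord0 j) v.
    apply/matrixP => k c; rewrite !mxE; case: unliftP => [k' ->|->].
      by rewrite !mxE (inj_eq lift_inj).
    by rewrite (negPf (neq_lift _ _)).
  by rewrite !E fL.
pose h (q : 'I_d * {ffun 'I_m -> 'I_d}) : {ffun 'I_m.+1 -> 'I_d} :=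
  [ffun k => if unlift ord0 k is Some k' then q.2 k' else q.1].
pose h' (I : {ffun 'I_m.+1 -> 'I_d}) := (I ord0, [ffun k => I (lift ord0 k)]).
have hK : cancel h h'.
  move=> [l I]; rewrite /h' ffunE unlift_none; congr (_, _).
  by apply/ffunP => k; rewrite !ffunE liftK.
have h'K : cancel h' h.
  by move=> I; apply/ffunP => k; rewrite ffunE; case: unliftP => [k' ->|->] //=; rewrite ffunE.
rewrite (reindex h) /=; last by exists h' => I _; [exact: hK|exact: h'K].
rewrite {1}WE consE (row_linear_coord fL).
rewrite -(pair_bigA _ (fun l I => (\prod_k W k (h (l, I) k)) * f (frame (h (l, I))))) /=.
apply: eq_bigr => l _; rewrite -consE (IH _ (fl l)) big_distrr /=.
apply: eq_bigr => I _; rewrite big_ord_recl !mxE mulrA; congr (_ * _ * f _).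
- by rewrite ffunE unlift_none.
- by apply: eq_bigr => k _; rewrite ffunE liftK mxE.
apply/matrixP => k c; rewrite !mxE !ffunE; case: unliftP => [k' _|_]; rewrite ?mxE //=.
Qed.

(** Both rows are replaced by their sum, which makes [f] vanish, and the result is
    expanded. *)
Lemma row_alternating_tperm m (f : 'M[R]_(m, d) -> R) :
  row_linear f -> row_alternating f -> forall W j j', j != j' ->
  f (row_perm (tperm j j') W) = - f W.
Proof.
move=> fL fA W j j' jj'.
set a := row j W; set b := row j' W.
pose G u v := f (setrow (setrow W j u) j' v).
have G0 u : G u u = 0.
  apply: (fA _ j j' jj'); rewrite row_setrow row_setrow_neq // row_setrow //.
have GDr u v v' : G u (v + v') = G u v + G u v' by rewrite /G row_linearD.
have GDl u u' v : G (u + u') v = G u v + G u' v.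
  by rewrite /G !(setrowC _ _ _ jj') row_linearD.
have : G (a + b) (a + b) = 0 by [].
rewrite GDl !GDr !G0 add0r addr0 => /eqP; rewrite addrC addr_eq0 => /eqP.
have -> : G a b = f W.
  by rewrite /G setrow_id -{2}(setrow_id W j').
move=> <-; congr f; apply/matrixP => k l; rewrite !mxE.
case: (eqVneq k j') => [->|kj']; first by rewrite tpermR.
case: (eqVneq k j) => [->|kj]; first by rewrite tpermL.
by rewrite tpermD // eq_sym.
Qed.

Lemma row_alternating_perm m (f : 'M[R]_(m, d) -> R) :
  row_linear f -> row_alternating f -> forall (s : 'S_m) W,
  f (row_perm s W) = (-1) ^+ s * f W.
Proof.
move=> fL fA s; case: (prod_tpermP s) => ts -> {s} dts.
rewrite (odd_perm_prod dts).
elim: ts dts => [|[a b] ts IH] /= dts W.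
  by rewrite big_nil row_perm1 mul1r.
case/andP: dts => ab dts.
rewrite big_cons row_permM (row_alternating_tperm fL fA) // IH //.
by rewrite signrN mulNr.
Qed.

(** Averaging the multilinear expansion over the permutations of the indices
    turns the monomials into minors. *)
Lemma alternating_expand m (f : 'M[R]_(m, d) -> R) :
  row_linear f -> row_alternating f -> forall W,
  f W = m`!%:R^-1 *
    \sum_(I : {ffun 'I_m -> 'I_d}) f (frame I) * \det (colsub I W).
Proof.
move=> fL fA W.
have fact_neq0 : m`!%:R != 0 :> R by rewrite pnatr_eq0 -lt0n fact_gt0.
apply: (mulfI fact_neq0); rewrite mulrA divff // mul1r.
have E (s : 'S_m) : f W = \sum_(I : {ffun 'I_m -> 'I_d})
    f (frame I) * ((-1) ^+ s * \prod_k (colsub I W) k (s k)).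
  rewrite (multilinear_expand fL).
  rewrite (reindex (fun I : {ffun 'I_m -> 'I_d} => [ffun k => I (s k)])) /=; last first.
    exists (fun I : {ffun 'I_m -> 'I_d} => [ffun k => I ((s^-1)%g k)]) => I _;
      by apply/ffunP => k; rewrite !ffunE ?permK ?permKV.
  apply: eq_bigr => I _.
  have -> : frame [ffun k => I (s k)] = row_perm s (frame I).
    by apply/matrixP => k l; rewrite !mxE ffunE.
  rewrite row_alternating_perm //.
  rewrite mulrC -mulrA mulrCA; congr (_ * (_ * _)).
  by apply: eq_bigr => k _; rewrite !mxE ffunE.
transitivity (\sum_(s : 'S_m) f W).
  by rewrite sumr_const card_Sn mulr_natl.
rewrite (eq_bigr _ (fun s _ => E s)) exchange_big /=.
by apply: eq_bigr => I _; rewrite -big_distrr /=.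
Qed.

End Alternating.

Lemma mulmx_setrow (R : numFieldType) m d e (W : 'M[R]_(m, d)) j u (Q : 'M[R]_(d, e)) :
  setrow W j u *m Q = setrow (W *m Q) j (u *m Q).
Proof.
apply/matrixP => k l; rewrite !mxE; case: eqP => kj.
  by apply: eq_bigr => a _; rewrite mxE kj eqxx.
by apply: eq_bigr => a _; rewrite mxE; case: eqP.
Qed.

Section Minors.
Variable (R : comNzRingType).

(** Bordering [X] by a column supported at [a] and [b] gives a determinant with two
    equal rows; its expansion along the new column is the left-hand side. *)
Lemma minor_swap k (X : 'M[R]_(k.+1, k)) (a b : 'I_k.+1) : a != b ->
  row a X = row b X ->
  (-1) ^+ a * \det (row' a X) + (-1) ^+ b * \det (row' b X) = 0.
Proof.
move=> ab Xab.
pose B : 'M[R]_k.+1 := \matrix_(i, j)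
  if unlift ord0 j is Some j' then X i j' else ((i == a) || (i == b))%:R.
have rB i : row' i (col' ord0 B) = row' i X.
  by apply/matrixP => p q; rewrite !mxE liftK.
have dB : \det B = 0.
  apply: (determinant_alternate ab) => j; rewrite !mxE !eqxx orbT.
  case: unlift => // j'; by have /rowP/(_ j') := Xab; rewrite !mxE.
rewrite -dB (expand_det_col B ord0) (bigD1 a) //= (bigD1 b) 1?eq_sym //=.
rewrite big1 ?addr0; last first.
  by move=> i /andP[ia ib]; rewrite mxE unlift_none (negPf ia) (negPf ib) mul0r.
by rewrite !mxE !unlift_none !eqxx orbT !mul1r /cofactor !addn0 !rB.
Qed.

Lemma sum_lift k (F : 'I_k.+1 -> R) (j : 'I_k.+1) :
  \sum_(a < k) F (lift j a) = \sum_(b | b != j) F b.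
Proof.
have := bigD1 (op := +%R) (x := 0) (F := F) j (P := predT) isT.
by rewrite (bigD1_ord j) //= => /addrI.
Qed.

End Minors.

(** * Calculus of [C^k] functions *)

(** ** Operations on [C^k] functions *)
Section Ck_general.
Context {R : realType} {V W : normedModType R}.
Implicit Types (f g : V -> W) (U : set V).

Lemma near_eq_differentiable f g a : (\near a, f a = g a) ->
  differentiable f a -> differentiable g a.
Proof.
move=> fg df.
have fga : f a = g a by exact: nbhs_singleton fg.
have E : g \o shift a = cst (g a) + 'd f a +o_0 id.
  apply/eqaddoP => e e0; have /eqaddoP/(_ e e0) := diff_locally df.
  have : \forall h \near 0, f (h + a) = g (h + a).
    by move: fg; rewrite (near_shift 0) /= => fg; near=> h; rewrite -[a in h + a]subr0; near: h.
  move=> fgh; apply: filterS2 fgh => h /= fgh.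
  by rewrite !fctE /= fgh fga.
have dgE := diff_unique (diff_continuous df) E.
by apply/diff_locallyP; rewrite dgE; split => //; exact: diff_continuous.
Unshelve. all: by end_near. Qed.

Lemma Ck_eq k U f g : open U -> (forall x, U x -> f x = g x) ->
  Ck_on k U f -> Ck_on k U g.
Proof.
move=> oU; elim: k f g => [|k IH] f g fg /=.
  move=> cf x Ux; have := cf x Ux; rewrite /prop_for /continuous_at (fg x Ux).
  apply: cvg_trans; apply: near_eq_cvg.
  by near=> z; apply: fg; near: z; exact: open_nbhs_nbhs.
case=> df cf; have fgx x : U x -> \near x, f x = g x.
  by move=> Ux; near=> z; apply: fg; near: z; exact: open_nbhs_nbhs.
split=> [x Ux|v]; first exact: near_eq_differentiable (fgx x Ux) (df x Ux).
apply: IH (cf v) => x Ux; exact: near_eq_derive (fgx x Ux).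
Unshelve. all: by end_near. Qed.

Lemma Ck_local k U f :
  (forall x, U x -> exists2 O : set V, O x & Ck_on k O f) -> Ck_on k U f.
Proof.
elim: k f => [|k IH] f /= fU; first by move=> x /fU [B Bx cB]; exact: cB.
split=> [x /fU [B Bx [df _]]|v]; first exact: df.
by apply: IH => x /fU [B Bx [_ cf]]; exists B.
Qed.

Lemma CkS k U f : Ck_on k.+1 U f -> Ck_on k U f.
Proof.
elim: k f => [|k IH] f /=.
  by case=> df _ x /df; exact: differentiable_continuous.
by case=> df cf; split=> // v; apply: IH; exact: cf.
Qed.

Lemma Ck_cst k U (c : W) : Ck_on k U (cst c : V -> W).
Proof.
elim: k c => [|k IH] c /=; first by move=> x _; exact: cvg_cst.
split=> [x _|v]; first exact: differentiable_cst.
have -> : 'D_v (cst c : V -> W) = cst 0 by apply/funext => x; rewrite derive_cst.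
exact: IH.
Qed.

Lemma Ck_D k U f g : Ck_on k U f -> Ck_on k U g -> open U ->
  Ck_on k U (fun x => f x + g x).
Proof.
move=> + + oU; elim: k f g => [|k IH] f g /=.
  by move=> cf cg x Ux; apply: cvgD; [exact: cf|exact: cg].
case=> df cf [dg cg]; split=> [x Ux|v].
  by apply: differentiableD; [exact: df|exact: dg].
apply: (Ck_eq oU) (IH _ _ (cf v) (cg v)) => x Ux.
by rewrite deriveD //; apply: diff_derivable; [exact: df|exact: dg].
Qed.

Lemma smooth_derive U f v : smooth_on U f -> smooth_on U ('D_v f).
Proof. by move=> sf k; have [_] := sf k.+1; exact. Qed.

Lemma smooth_differentiable U f x : smooth_on U f -> U x -> differentiable f x.
Proof. by move=> /(_ 1%N) [+ _] => /[apply]. Qed.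

Lemma smooth_continuous U f x : smooth_on U f -> U x -> {for x, continuous f}.
Proof. by move=> /(_ 0%N); exact. Qed.

End Ck_general.

Section Ck_scalar.
Context {R : realType} {V : normedModType R}.
Implicit Types (f g : V -> R) (U : set V).

Lemma Ck_M k U f g : Ck_on k U f -> Ck_on k U g -> open U ->
  Ck_on k U (fun x => f x * g x).
Proof.
move=> + + oU; elim: k f g => [|k IH] f g.
  by move=> cf cg x Ux; apply: cvgM; [exact: cf|exact: cg].
move=> /[dup] /CkS f0 /= [df cf] /[dup] /CkS g0 /= [dg cg]; split=> [x Ux|v].
  by apply: differentiableM; [exact: df|exact: dg].
apply: (Ck_eq oU) (Ck_D (IH _ _ f0 (cg v)) (IH _ _ g0 (cf v)) oU) => x Ux.
by rewrite deriveM //; apply: diff_derivable; [exact: df|exact: dg].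
Qed.

Lemma Ck_sum k U (I : Type) (r : seq I) (P : pred I) (F : I -> V -> R) : open U ->
  (forall i, P i -> Ck_on k U (F i)) -> Ck_on k U (fun x => \sum_(i <- r | P i) F i x).
Proof.
move=> oU cF; elim: r => [|i r IH].
  by apply: (Ck_eq oU _ (Ck_cst k U 0)) => x _; rewrite big_nil.
case Pi : (P i).
  by apply: (Ck_eq oU _ (Ck_D (cF i Pi) IH oU)) => x _; rewrite big_cons Pi.
by apply: (Ck_eq oU _ IH) => x _; rewrite big_cons Pi.
Qed.

Lemma Ck_prod k U (I : Type) (r : seq I) (P : pred I) (F : I -> V -> R) : open U ->
  (forall i, P i -> Ck_on k U (F i)) -> Ck_on k U (fun x => \prod_(i <- r | P i) F i x).
Proof.
move=> oU cF; elim: r => [|i r IH].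
  by apply: (Ck_eq oU _ (Ck_cst k U (1 : R))) => x _; rewrite big_nil.
case Pi : (P i).
  by apply: (Ck_eq oU _ (Ck_M (cF i Pi) IH oU)) => x _; rewrite big_cons Pi.
by apply: (Ck_eq oU _ IH) => x _; rewrite big_cons Pi.
Qed.

Lemma Ck_det k U m (F : 'I_m -> 'I_m -> V -> R) : open U ->
  (forall i j, Ck_on k U (F i j)) -> Ck_on k U (fun x => \det (\matrix_(i, j) F i j x)).
Proof.
move=> oU cF.
have H (s : 'S_m) : Ck_on k U (fun x => (-1) ^+ s * \prod_i F i (s i) x).
  apply: (@Ck_M _ _ (cst _)) => //; first exact: Ck_cst.
  by apply: Ck_prod => // i _; exact: cF.
have := @Ck_sum k U _ (index_enum _) predT _ oU (fun s _ => H s).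
apply: (Ck_eq oU) => x _; apply: eq_bigr => s _; congr (_ * _).
by apply: eq_bigr => i _; rewrite mxE.
Qed.

Lemma Ck_lin k U (f : {linear V -> R}) : continuous f -> Ck_on k U f.
Proof.
move=> cf; case: k => [|k] /=; first by move=> x _; exact: cf.
split=> [x _|v]; first exact: linear_differentiable.
have -> : 'D_v f = cst (f v).
  by apply/funext => x; rewrite deriveE ?diff_lin //; exact: linear_differentiable.
exact: Ck_cst.
Qed.

Lemma Ck_V k U f : open U -> (forall x, U x -> f x != 0) -> Ck_on k U f ->
  Ck_on k U (fun x => (f x)^-1).
Proof.
move=> oU f0; elim: k => [|k IH].
  by move=> cf x Ux; apply: cvgV; [exact: f0|exact: cf].
move=> /[dup] /CkS cf /= [df cdf]; split=> [x Ux|v].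
  by apply: differentiableV; [exact: df|exact: f0].
have := Ck_M (Ck_M (Ck_cst k U (-1 : R)) (Ck_M (IH cf) (IH cf) oU) oU) (cdf v) oU.
apply: (Ck_eq oU) => x Ux; rewrite deriveV ?f0 //; last exact/diff_derivable/df.
by rewrite /cst mulN1r -[RHS]/(_ * _) expr2 invfM.
Qed.

Lemma diff_scalar (chi : R -> R) y (h : R) : differentiable chi y ->
  'd chi y h = h * 'D_1 chi y.
Proof. by move=> dc; rewrite deriveE // -{1}[h]mulr1 linearZ. Qed.

Lemma derive_comp_scalar (chi : R -> R) f x v :
  differentiable chi (f x) -> differentiable f x ->
  'D_v (fun y => chi (f y)) x = 'D_v f x * 'D_1 chi (f x).
Proof.
move=> dc df; rewrite deriveE; last exact: differentiable_comp.
have -> : (fun y => chi (f y)) = chi \o f by [].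
rewrite diff_comp // -[LHS]/('d chi (f x) ('d f x v)) diff_scalar //.
by congr (_ * _); rewrite deriveE.
Qed.

(** The chain rule of one variable suffices: the induction is on [k], for all outer
    functions at once. *)
Lemma Ck_comp_scalar k U (chi : R -> R) f : open U -> smooth_on setT chi ->
  Ck_on k U f -> Ck_on k U (fun x => chi (f x)).
Proof.
move=> oU; elim: k chi => [|k IH] chi sc.
  move=> cf x Ux; apply: (cvg_comp _ _ (cf x Ux)).
  exact: (smooth_continuous (x := f x) sc).
move=> /[dup] /CkS f0 /= [df cf]; split=> [x Ux|v].
  apply: differentiable_comp; first exact: df.
  exact: (smooth_differentiable sc).
have := Ck_M (cf v) (IH _ (smooth_derive (1 : R) sc) f0) oU.
apply: (Ck_eq oU) => x Ux.
by rewrite derive_comp_scalar //; [exact: smooth_differentiable sc _|exact: df].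
Qed.

Lemma Ck_fst (V' : normedModType R) k U f : Ck_on k U f ->
  Ck_on k [set z : V * V' | U z.1] (fun z => f z.1).
Proof.
elim: k f => [|k IH] f.
  by move=> cf z Uz; apply: (cvg_comp _ _ cvg_fst); exact: cf.
case=> df cf; split=> [z Uz|v]; last exact: (IH _ (cf v.1)).
apply: (@differentiable_comp _ _ _ _ fst f); last exact: df.
by apply: linear_differentiable => ?; exact: cvg_fst.
Qed.

Lemma Ck_coord d k U (f : V -> 'rV[R]_d) l : open U -> Ck_on k U f ->
  Ck_on k U (fun x => f x 0 l).
Proof.
move=> oU; elim: k f => [|k IH] f.
  move=> cf x Ux; apply: (@continuous_comp _ _ _ f (fun N : 'rV[R]_d => N 0 l)).
    exact: cf.
  exact: coord_continuous.
case=> df cf; split=> [x Ux|v].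
  apply: (@differentiable_comp _ _ _ _ f (fun N => N 0 l)); first exact: df.
  exact: differentiable_coord.
apply: (Ck_eq oU) (IH _ (cf v)) => x Ux.
by rewrite derive_mx ?mxE //; exact/diff_derivable/df.
Qed.

Lemma is_derive_line (f : V -> R) x u t : derivable f (x + t *: u) u ->
  is_derive t 1 (fun s : R => f (x + s *: u)) ('D_u f (x + t *: u)).
Proof.
have E : (fun h : R => h^-1 *: (((fun s : R => f (x + s *: u)) \o shift t) (h *: 1) - f (x + t *: u))) =
  (fun h : R => h^-1 *: ((f \o shift (x + t *: u)) (h *: u) - f (x + t *: u))).
  apply/funext => h /=; congr (_ *: (f _ - _)).
  by rewrite scalerDl addrCA [h%:A]mulr1.
by move=> df; split; rewrite /derivable /derive E.
Qed.

Lemma line_MVT f x u (s : R) : 0 <= s ->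
  (forall t, 0 <= t <= s -> differentiable f (x + t *: u)) ->
  exists2 c, 0 <= c <= s & f (x + s *: u) - f x = s * 'D_u f (x + c *: u).
Proof.
move=> s0 df.
have dl t : 0 <= t <= s ->
    is_derive t 1 (fun r : R => f (x + r *: u)) ('D_u f (x + t *: u)).
  by move=> ts; apply: is_derive_line; apply: diff_derivable; exact: df.
have [||c] := @MVT_segment _ (fun r => f (x + r *: u)) (fun t => 'D_u f (x + t *: u)) 0 s s0.
- by move=> t /[!in_itv] /= /andP[t0 ts]; apply: dl; rewrite !ltW.
- apply: derivable_within_continuous => t /[!in_itv] /= ts.
  by have [] := dl t ts.
rewrite in_itv /= => cs; rewrite scale0r addr0 subr0 mulrC => E.
by exists c.
Qed.

(** Both iterated derivatives are limits of the same second difference. *)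
Lemma derive_swap U f x u v : open U -> Ck_on 2 U f -> U x ->
  'D_u ('D_v f) x = 'D_v ('D_u f) x.
Proof.
move=> oU [df Df] Ux.
have D0 w z : U z -> differentiable ('D_w f) z by have [+ _] := Df w; exact.
have D1 w w' z : U z -> {for z, continuous ('D_w' ('D_w f))}.
  by have [_ +] := Df w => /(_ w'); exact.
have dist_near w w' (e : R) : 0 < e -> \forall z \near x,
    `|'D_w' ('D_w f) x - 'D_w' ('D_w f) z| < e.
  by move=> e0; have /cvgrPdist_lt/(_ e e0) := D1 w w' x Ux.
have second w w' (s : R) : 0 <= s ->
    (forall a b, 0 <= a <= s -> 0 <= b <= s -> U (x + a *: w + b *: w')) ->
    exists a b, [/\ 0 <= a <= s, 0 <= b <= s &
      f (x + s *: w + s *: w') - f (x + s *: w) - (f (x + s *: w') - f x) =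
      s * (s * 'D_w' ('D_w f) (x + a *: w + b *: w'))].
  move=> s0 Us; have ss : 0 <= s <= s by rewrite s0 lexx.
  have s00 : 0 <= (0 : R) <= s by rewrite lexx.
  pose G z := f (z + s *: w') - f z.
  have dsh z : U (z + s *: w') -> differentiable (fun z => f (z + s *: w')) z.
    move=> Uz; apply: (@differentiable_comp _ _ _ _ (fun z => z + s *: w') f); last exact: df.
    by apply: differentiableD.
  have Dsh z : U (z + s *: w') -> 'D_w (fun z => f (z + s *: w')) z = 'D_w f (z + s *: w').
    move=> Uz; rewrite /derive (_ : (fun h : R => _) = (fun h : R =>
      h^-1 *: ((f \o shift (z + s *: w')) (h *: w) - f (z + s *: w')))) //.
    by apply/funext => h /=; rewrite addrA.
  have dG z : U z -> U (z + s *: w') -> differentiable G z.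
    by move=> Uz Uz'; apply: differentiableB; [exact: dsh|exact: df].
  have Ua a : 0 <= a <= s -> U (x + a *: w).
    by move=> sa; rewrite -[_ + _]addr0 -[X in _ + X](scale0r w'); exact: Us.
  have [a sa Ea] := @line_MVT G x w s s0 (fun t ts => dG _ (Ua t ts) (Us t s ts ss)).
  have [b sb Eb] := @line_MVT ('D_w f) (x + a *: w) w' s s0 (fun t ts => D0 w _ (Us a t sa ts)).
  exists a, b; split => //; rewrite -Eb -/(G _) -/(G x) Ea; congr (_ * _).
  rewrite deriveB ?Dsh //; [exact: Us| |apply: diff_derivable; apply: df; exact: Ua].
  by apply: diff_derivable; apply: dsh; exact: Us.
apply/eqP; rewrite -subr_eq0 -normr_le0; apply/ler_addgt0Pl => e e0; rewrite addr0.
have e2 : 0 < e / 2 by rewrite divr_gt0.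
have /nbhs_ballP[del /= del0 Bd] : nbhs x [set z | [/\ U z,
    `|'D_u ('D_v f) x - 'D_u ('D_v f) z| < e / 2 &
    `|'D_v ('D_u f) x - 'D_v ('D_u f) z| < e / 2]].
  have nU : nbhs x U by exact: open_nbhs_nbhs.
  apply: filterS (filterI (filterI nU (dist_near v u _ e2)) (dist_near u v _ e2)).
  by move=> z [[]].
pose N := `|u| + `|v| + 1.
have N0 : 0 < N by rewrite /N ltr_wpDl // addr_ge0.
(* The parallelogram with sides [s *: u] and [s *: v] lies in the ball. *)
pose s := del / 2 / N; have s0 : 0 < s by rewrite !divr_gt0.
have inB w w' a b : `|w| + `|w'| <= N -> 0 <= a <= s -> 0 <= b <= s ->
    ball x del (x + a *: w + b *: w').
  move=> wN /andP[a0 as_] /andP[b0 bs]; rewrite -ball_normE /= -addrA opprD addNKr normrN.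
  apply: (le_lt_trans (ler_normD _ _)); rewrite !normrZ !ger0_norm //.
  apply: (@le_lt_trans _ _ (s * N)).
    apply: (@le_trans _ _ (s * (`|w| + `|w'|))); last by rewrite ler_pM2l.
    by rewrite mulrDr lerD // ler_wpM2r.
  by rewrite /s divfK ?gt_eqF // ltr_pdivrMr // ltr_pMr // ltr1n.
have uvN : `|u| + `|v| <= N by rewrite lerDl.
have vuN : `|v| + `|u| <= N by rewrite addrC.
have [a [b [sa sb E1]]] := second u v s (ltW s0)
  (fun a b sa sb => let: And3 Uz _ _ := Bd _ (inB u v a b uvN sa sb) in Uz).
have [a' [b' [sa' sb' E2]]] := second v u s (ltW s0)
  (fun a b sa sb => let: And3 Uz _ _ := Bd _ (inB v u a b vuN sa sb) in Uz).
have [_ _ L1] := Bd _ (inB u v a b uvN sa sb).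
have [_ L2 _] := Bd _ (inB v u a' b' vuN sa' sb').
have E : 'D_v ('D_u f) (x + a *: u + b *: v) = 'D_u ('D_v f) (x + a' *: v + b' *: u).
  have ns : s != 0 by rewrite gt_eqF.
  apply: (mulfI ns); apply: (mulfI ns); move: E1 E2.
  rewrite [x + s *: v + s *: u]addrAC.
  move: ('D_v ('D_u f) _) ('D_u ('D_v f) _) => A B.
  by move=> <- <-; move: (f _) (f _) (f _) (f _) => p q r t; ring.
rewrite (splitr e); apply: ltW; rewrite -(subrKA ('D_u ('D_v f) (x + a' *: v + b' *: u))).
apply: (le_lt_trans (ler_normD _ _)); apply: ltrD; first exact: L2.
by rewrite -E distrC; exact: L1.
Unshelve. all: by end_near. Qed.

End Ck_scalar.

(** ** A smooth step *)

Section Smooth_step.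
Variable R : realType.
Implicit Types (p : {poly R}) (x y : R).

(** Closed under differentiation, hence smooth; [p = 1] is the flat function. *)
Definition flat p x : R := if x <= 0 then 0 else p.[x^-1] * expR (- x^-1).

Lemma poly_bound p : exists2 C : R, 0 <= C & forall y, 1 <= y ->
  `|p.[y]| <= C * y ^+ size p.
Proof.
exists (\sum_(i < size p) `|p`_i|) => [|y y1]; first exact: sumr_ge0.
have y0 : 0 <= y by apply: le_trans y1.
rewrite horner_coef mulr_suml; apply: (le_trans (ler_norm_sum _ _ _)).
apply: ler_sum => i _; rewrite normrM ler_wpM2l // normrX ger0_norm //.
exact: (ler_weXn2l y1 (ltnW (ltn_ord i))).
Qed.

Lemma expR_poly_bound m y : 0 < y -> y ^+ m <= m`!%:R * expR y.
Proof.
move=> y0; case: m => [|m]; first by rewrite expr0 mul1r -expR0 ler_expR ltW.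
rewrite mulrC -ler_pdivrMr ?ltr0n ?fact_gt0 //.
by apply: le_trans (expR_ge1Dxn m (ltW y0)); rewrite lerDr.
Qed.

Lemma flat_bound p : exists2 C : R, 0 <= C & forall x, 0 < x <= 1 -> `|flat p x| <= C * x ^+ 2.
Proof.
have [C C0 HC] := poly_bound p.
exists (C * (2 + size p)`!%:R) => [|x /andP[x0 x1]]; first by rewrite mulr_ge0.
rewrite /flat [x <= 0]leNgt x0 /= normrM [X in _ * X]ger0_norm ?expR_ge0 //.
have y1 : 1 <= x^-1 by rewrite invf_ge1.
apply: (le_trans (ler_wpM2r (expR_ge0 _) (HC _ y1))).
rewrite -!mulrA ler_wpM2l // expRN ler_pdivrMr ?expR_gt0 //.
have := @expR_poly_bound (2 + size p) x^-1; rewrite invr_gt0 => /(_ x0).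
rewrite exprD exprVn mulrC ler_pdivrMr ?exprn_gt0 //.
by rewrite [X in _ <= X -> _]mulrAC.
Qed.

Definition flat_deriv p : {poly R} := 'X^2 * (p - p^`()).

(** At 0, where the two branches meet, the derivative exists because [flat p] is
    quadratically small. *)
Lemma is_derive_flat p x : is_derive x 1 (flat p) (flat (flat_deriv p) x).
Proof.
have [x0|x0|->] := ltrgtP x 0.
- apply: (@near_eq_is_derive _ _ _ (cst 0)); last first.
    by rewrite /flat ltW //; exact: is_derive_cst.
  by near=> y; rewrite /flat ltW //; near: y; exact: lt_nbhsl.
- apply: (@near_eq_is_derive _ _ _ (fun x => p.[x^-1] * expR (- x^-1))).
    by near=> y; rewrite /flat leNgt; have -> : 0 < y by near: y; exact: lt_nbhsr.
  have nx : x != 0 by rewrite gt_eqF.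
  have dV : is_derive x 1 (fun y : R => y^-1) (- x ^- 2).
    have := @derivableV _ _ (@id R) x 1 nx (@derivable_id _ _ x 1) => dv.
    by apply: DeriveDef => //; rewrite deriveV // derive_id -[LHS]/(_ * _) mulr1.
  have dp : is_derive x 1 (fun y : R => p.[y^-1]) (- x ^- 2 * p^`().[x^-1]).
    rewrite mulrC.
    exact: (@is_derive1_comp _ (fun y => p.[y]) (fun y => y^-1) x _ _ (is_derive_poly _ _) dV).
  have de : is_derive x 1 (fun y : R => expR (- y^-1)) (x ^- 2 * expR (- x^-1)).
    have dN : is_derive x 1 (fun y : R => - y^-1) (x ^- 2).
      by have := is_deriveN dV; rewrite opprK.
    rewrite mulrC.
    exact: (@is_derive1_comp _ expR (fun y => - y^-1) x _ _ (is_derive_expR _) dN).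
  apply: is_derive_eq (is_deriveM dp de) _.
  rewrite -[LHS]/(_ * _ + _ * _) /flat leNgt x0 /= /flat_deriv.
  by rewrite hornerM hornerXn hornerD hornerN; field.
have f0 q : flat q 0 = 0 by rewrite /flat lexx.
have [C C0 HC] := flat_bound p.
have cv : (fun h : R => h^-1 *: ((flat p \o shift 0) (h *: 1) - flat p 0)) @ 0^' --> (0 : R).
  apply/cvgrPdist_le => e e0.
  have e1 : 0 < e / (C + 1) by rewrite divr_gt0 // ltr_wpDl.
  near=> h; rewrite sub0r normrN f0 subr0 /= [h%:A]mulr1 addr0 -[_ *: _]/(_ * _).
  have [h0|h0] := leP h 0; first by rewrite /flat h0 mulr0 normr0 ltW.
  have h1 : h <= 1.
    by apply: le_trans (ler_norm h) _; near: h; apply: dnbhs0_le.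
  have he : h <= e / (C + 1).
    by apply: le_trans (ler_norm h) _; near: h; apply: dnbhs0_le.
  rewrite normrM normfV (gtr0_norm h0) mulrC ler_pdivrMr //.
  apply: (le_trans (HC h _)); first by rewrite h0.
  rewrite expr2 mulrA ler_pM2r // (le_trans (ler_wpM2l C0 he)) //.
  by rewrite mulrCA ler_piMr ?(ltW e0) // ler_pdivrMr ?mul1r ?lerDl // ltr_wpDl.
rewrite f0; apply: DeriveDef; first by apply/cvg_ex; exists 0.
exact/cvg_lim.
Unshelve. all: by end_near. Qed.

Lemma smooth_flat p : smooth_on setT (flat p).
Proof.
move=> k; elim: k p => [|k IH] p.
  move=> x _; apply/differentiable_continuous/derivable1_diffP.
  by have [] := is_derive_flat p x.
split=> [x _|v].
  by apply/derivable1_diffP; have [] := is_derive_flat p x.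
have := Ck_M (Ck_cst k setT (v : R)) (IH (flat_deriv p)) openT.
apply: (Ck_eq openT) => x _; have [d1 <-] := is_derive_flat p x.
by rewrite [RHS]deriveE ?diff_scalar //; exact/derivable1_diffP.
Qed.

Definition flat1 := flat 1.

Lemma flat1_ge0 x : 0 <= flat1 x.
Proof. by rewrite /flat1 /flat; case: ifP => // _; rewrite hornerC mul1r expR_ge0. Qed.

Lemma flat1_gt0 x : 0 < x -> 0 < flat1 x.
Proof. by move=> x0; rewrite /flat1 /flat leNgt x0 /= hornerC mul1r expR_gt0. Qed.

Lemma flat1_le0 x : x <= 0 -> flat1 x = 0.
Proof. by rewrite /flat1 /flat => ->. Qed.

Lemma flat1_homo x y : x <= y -> flat1 x <= flat1 y.
Proof.
move=> xy; have [x0|x0] := leP x 0; first by rewrite flat1_le0 ?flat1_ge0.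
have y0 : 0 < y by apply: lt_le_trans xy.
rewrite /flat1 /flat ![_ <= 0]leNgt x0 y0 /= !hornerC !mul1r ler_expR lerN2.
by rewrite lef_pV2.
Qed.

Definition smooth_step x := flat1 x / (flat1 x + flat1 (1 - x)).

Lemma smooth_step_den x : 0 < flat1 x + flat1 (1 - x).
Proof.
have [x0|x0] := leP x 0; last by rewrite ltr_wpDr ?flat1_ge0 ?flat1_gt0.
by rewrite ltr_wpDl ?flat1_ge0 // flat1_gt0 // subr_gt0 (le_lt_trans x0).
Qed.

Lemma smooth_step_smooth : smooth_on setT smooth_step.
Proof.
have sub1 : smooth_on setT (fun x : R => 1 - x).
  move=> k; have := Ck_D (Ck_cst k setT (1 : R)) (Ck_M (Ck_cst k setT (-1 : R))
    (@Ck_lin _ _ k setT (idfun : {linear R -> R}) (fun x => cvg_id)) openT) openT.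
  by apply: (Ck_eq openT) => x _; rewrite /cst /= mulN1r.
move=> k; have f2 := Ck_comp_scalar openT (smooth_flat 1) (sub1 k).
have f1 := smooth_flat 1 k.
apply: (Ck_M f1 _ openT); apply: (Ck_V openT) (Ck_D f1 f2 openT).
by move=> x _; rewrite gt_eqF // smooth_step_den.
Qed.

Lemma smooth_step0 x : x <= 0 -> smooth_step x = 0.
Proof. by move=> x0; rewrite /smooth_step flat1_le0 // mul0r. Qed.

Lemma smooth_step1 x : 1 <= x -> smooth_step x = 1.
Proof.
move=> x1; rewrite /smooth_step [flat1 (1 - x)]flat1_le0 ?subr_le0 // addr0.
by rewrite divff // gt_eqF // flat1_gt0 // (lt_le_trans _ x1).
Qed.

Lemma smooth_step_homo x y : x <= y -> smooth_step x <= smooth_step y.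
Proof.
move=> xy; rewrite /smooth_step ler_pdivrMr ?smooth_step_den // mulrAC.
rewrite ler_pdivlMr ?smooth_step_den // !mulrDr [flat1 y * flat1 x]mulrC lerD2l.
rewrite ler_pM ?flat1_ge0 ?flat1_homo //; lra.
Qed.

Lemma smooth_step_ge0 x : 0 <= smooth_step x.
Proof. by rewrite divr_ge0 ?flat1_ge0 // ltW // smooth_step_den. Qed.

End Smooth_step.

(** * Charts of the manifold and of the bundle of tuples *)

Section Matrix_topology.
Variables (R : realType) (m n : nat).

Lemma cvg_mx (X : Type) (F : set_system X) {FF : Filter F} (f : X -> 'M[R]_(m, n)) (l : 'M[R]_(m, n)) :
  (forall i j, f x i j @[x --> F] --> l i j) -> f x @[x --> F] --> l.
Proof.
move=> fl B [P lP PB].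
have H (ij : 'I_m * 'I_n) : \forall x \near F, P ij.1 ij.2 (f x ij.1 ij.2).
  by apply: fl; exact: lP.
have := @filter_forall X _ (fun ij x => P ij.1 ij.2 (f x ij.1 ij.2)) F FF H.
by apply: filterS => x Px; apply: PB => i j; exact: (Px (i, j)).
Qed.

Lemma compact_mx_box (b : R) :
  compact [set W : 'M[R]_(m, n) | forall i j, `|W i j| <= b].
Proof.
have cI : compact [set v : 'rV[R]_(m * n) | forall i, `[- b, b]%classic (v ord0 i)].
  by apply: (@rV_compact R _ (fun=> `[- b, b]%classic)) => i; exact: segment_compact.
have cV : continuous (@vec_mx R m n).
  move=> v; apply: (@cvg_mx _ (nbhs v) _) => i j.
  have E w : vec_mx w i j = w ord0 (mxvec_index i j) by rewrite mxE.
  rewrite E; under eq_fun do rewrite E.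
  exact: coord_continuous.
have -> : [set W : 'M[R]_(m, n) | forall i j, `|W i j| <= b] =
    @vec_mx R m n @` [set v : 'rV[R]_(m * n) | forall i, `[- b, b]%classic (v ord0 i)].
  apply/seteqP; split=> [W Wb|_ [v vb] <-].
    exists (mxvec W); last exact: mxvecK.
    move=> k; case/mxvec_indexP: k => i j.
    by rewrite mxvecE /= in_itv /= -ler_norml.
  by move=> i j; have := vb (mxvec_index i j); rewrite mxE /= in_itv /= -ler_norml.
apply: continuous_compact cI; exact: continuous_subspaceT.
Qed.

End Matrix_topology.

Lemma cvg_sumr (R : realType) (X : Type) (F : set_system X) {FF : Filter F} (I : Type)
    (r : seq I) (P : pred I) (f : I -> X -> R) (a : I -> R) :
  (forall i, P i -> f i x @[x --> F] --> a i) ->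
  \sum_(i <- r | P i) f i x @[x --> F] --> \sum_(i <- r | P i) a i.
Proof. by move=> fa; apply: cvg_big => //; exact: add_continuous. Qed.

Lemma nbhs_fst (U V : topologicalType) (z : U * V) (P : set U) :
  nbhs z.1 P -> nbhs z [set w | P w.1].
Proof.
by case: z => x y /= xP; exact: (@cvg_fst U V (nbhs x) (nbhs y) _ P xP).
Qed.

(** Locked, since Jacobians of transitions are used only through the chain rule
    [Jtrans_comp] and their entries [Jtrans_entry]. *)
HB.lock Definition Jtrans (R : realType) (d : nat) (M : ptopologicalType)
  (A : smooth_atlas R d M) (i j : idx A) (y : 'rV[R]_d) : 'M[R]_d :=
  'J (chart j \o par i) y.

Section Atlas.
Context {R : realType} {d : nat} {M : ptopologicalType} (A : smooth_atlas R d M).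
Implicit Types (i j k : idx A) (y : 'rV[R]_d) (x : M).

Lemma parK i y : cod i y -> chart i (par i y) = y.
Proof. by case=> x ix <-; rewrite chartK. Qed.

Lemma dom_par i y : cod i y -> dom i (par i y).
Proof. by case=> x ix <-; rewrite chartK. Qed.

Lemma cod_chart i x : dom i x -> cod i (chart i x).
Proof. by move=> ix; exists x. Qed.

Lemma par_at i y : cod i y -> {for y, continuous (par i)}.
Proof.
move=> iy; have := @par_continuous _ _ _ A i.
by rewrite continuous_open_subspace; [move=> /(_ y); apply; exact: mem_set|exact: cod_open].
Qed.

Lemma chart_at_point i x : dom i x -> {for x, continuous (chart i)}.
Proof.
move=> ix; have := @chart_continuous _ _ _ A i.
by rewrite continuous_open_subspace; [move=> /(_ x); apply; exact: mem_set|exact: dom_open].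
Qed.

Definition overlap i j : set 'rV[R]_d := [set y | cod i y /\ dom j (par i y)].
Definition trans i j : 'rV[R]_d -> 'rV[R]_d := chart j \o par i.

Lemma overlapE i j : overlap i j = chart i @` (dom i `&` dom j).
Proof.
apply/seteqP; split=> [y [iy jy]|_ [x [ix jx] <-]].
  by exists (par i y); [split => //; exact: dom_par|exact: parK].
by split; [exact: cod_chart|rewrite chartK].
Qed.

Lemma par_preimage_open i (O : set M) : open O -> open (cod i `&` par i @^-1` O).
Proof.
move=> oO; rewrite openE => y [iy Oy]; rewrite /interior.
have n1 : nbhs y (cod i) by apply: open_nbhs_nbhs; split => //; exact: cod_open.
by apply: filterI n1 _; apply: (par_at iy); exact: open_nbhs_nbhs.
Qed.

Lemma overlap_open i j : open (overlap i j).
Proof. exact: par_preimage_open (@dom_open _ _ _ A j). Qed.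

Lemma trans_smooth i j : smooth_on (overlap i j) (trans i j).
Proof. by rewrite overlapE; exact: transition_smooth. Qed.

Lemma trans_diff i j y : overlap i j y -> differentiable (trans i j) y.
Proof. exact: smooth_differentiable (trans_smooth i j). Qed.

Lemma trans_overlap i j y : overlap i j y -> overlap j i (trans i j y).
Proof.
move=> [iy jy]; rewrite /trans /=; split; first exact: cod_chart.
by rewrite chartK //; exact: dom_par.
Qed.

Lemma par_trans i j y : overlap i j y -> par j (trans i j y) = par i y.
Proof. by move=> [iy jy]; rewrite /trans /= chartK. Qed.

Lemma trans_trans i j k y : overlap i j y -> trans j k (trans i j y) = trans i k y.
Proof. by move=> ij; rewrite /trans /=; rewrite -[chart j _]/(trans i j y) par_trans. Qed.

Lemma row_jacobian (f : 'rV[R]_d -> 'rV[R]_d) y a : differentiable f y ->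
  row a ('J f y : 'M[R]_d) = 'D_(delta_mx 0 a) f y.
Proof. by move=> df; rewrite (rowE a ('J f y : 'M[R]_d)) -(deriveEjacobian _ df). Qed.

Lemma jacobian_near (f g : 'rV[R]_d -> 'rV[R]_d) y :
  (\near y, f y = g y) -> differentiable f y -> ('J f y : 'M[R]_d) = 'J g y.
Proof.
move=> fg df; apply/row_matrixP => a.
have dg := near_eq_differentiable fg df.
exact: etrans (row_jacobian a df) (etrans (near_eq_derive _ fg) (esym (row_jacobian a dg))).
Qed.

Lemma jacobian_comp (f g : 'rV[R]_d -> 'rV[R]_d) y :
  differentiable f y -> differentiable g (f y) ->
  ('J (g \o f) y : 'M[R]_d) = 'J f y *m 'J g (f y).
Proof.
move=> df dg; apply/row_matrixP => a.
have dgf := differentiable_comp df dg.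
apply: (etrans (row_jacobian a dgf)).
apply: (etrans (deriveE _ dgf)); rewrite row_mul.
apply: etrans (congr1 (fun f : 'rV[R]_d -> 'rV[R]_d => f (delta_mx 0 a)) (diff_comp df dg)) _.
apply: etrans (esym (deriveE ('d f y (delta_mx 0 a)) dg)) _.
apply: etrans (deriveEjacobian _ dg) _; congr (_ *m _).
exact: etrans (esym (deriveE _ df)) (esym (row_jacobian a df)).
Qed.

Lemma Jtrans_comp i j k y : overlap i j y -> dom k (par i y) ->
  Jtrans i k y = Jtrans i j y *m Jtrans j k (trans i j y).
Proof.
move=> ij ky; have jk : overlap j k (trans i j y).
  by split; [exact: (trans_overlap ij).1|rewrite par_trans].
rewrite Jtrans.unlock.
apply: etrans (jacobian_comp (trans_diff ij) (trans_diff jk)).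
apply/esym/jacobian_near; last first.
  exact: differentiable_comp (trans_diff ij) (trans_diff jk).
have : nbhs y (overlap i j) by apply: open_nbhs_nbhs; split => //; exact: overlap_open.
by apply: filterS => z ijz /=; rewrite trans_trans.
Qed.

Lemma Jtrans_id i y : cod i y -> Jtrans i i y = 1%:M.
Proof.
move=> iy; have ii : overlap i i y by split => //; exact: dom_par.
rewrite Jtrans.unlock -[chart i \o par i]/(trans i i) (@jacobian_near _ id); last exact: trans_diff.
  apply/row_matrixP => a; rewrite row_jacobian; last exact: ex_diff.
  by rewrite derive_id rowE mulmx1.
have : nbhs y (cod i) by apply: open_nbhs_nbhs; split => //; exact: cod_open.
by apply: filterS => z iz /=; rewrite /trans /= parK.
Qed.

Lemma Jtrans_inv i j y : overlap i j y ->
  Jtrans i j y *m Jtrans j i (trans i j y) = 1%:M.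
Proof.
move=> ij; rewrite -Jtrans_comp //; last by apply: dom_par; case: ij.
by apply: Jtrans_id; case: ij.
Qed.

Lemma Jtrans_entry i j y a b : overlap i j y ->
  Jtrans i j y a b = 'D_(delta_mx 0 a) (fun y => trans i j y 0 b) y.
Proof.
move=> ij; have dt := trans_diff ij.
have <- : row a (Jtrans i j y) 0 b = Jtrans i j y a b by rewrite mxE.
rewrite Jtrans.unlock; apply: (etrans (congr1 (fun v : 'rV[R]_d => v 0 b) (row_jacobian a dt))).
by rewrite derive_mx ?mxE //; exact: diff_derivable.
Qed.

Lemma trans_coord_smooth i j b : smooth_on (overlap i j) (fun y => trans i j y 0 b).
Proof.
by move=> k; apply: Ck_coord; [exact: overlap_open|exact: trans_smooth].
Qed.

Lemma of_chartE i x : of_chart i x = Jtrans i (chart_at A x) (chart i x).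
Proof. by rewrite Jtrans.unlock. Qed.

Lemma to_chartE i x : to_chart i x = Jtrans (chart_at A x) i (chart (chart_at A x) x).
Proof. by rewrite Jtrans.unlock. Qed.

Lemma overlap_chart i j x : dom i x -> dom j x -> overlap i j (chart i x).
Proof. by move=> ix jx; rewrite overlapE; exists x. Qed.

Lemma trans_chart i j x : dom i x -> trans i j (chart i x) = chart j x.
Proof. by move=> ix; rewrite /trans /= chartK. Qed.

Lemma of_chartK i x : dom i x -> of_chart i x *m to_chart i x = 1%:M.
Proof.
move=> ix; rewrite of_chartE to_chartE -[in X in _ *m X](trans_chart _ ix).
apply: Jtrans_inv; apply: overlap_chart => //; exact: dom_chart_at.
Qed.

Lemma to_chartK i x : dom i x -> to_chart i x *m of_chart i x = 1%:M.
Proof. by move=> ix; apply: mulmx1C; exact: of_chartK. Qed.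

Lemma of_chart_trans i j x : dom i x -> dom j x ->
  of_chart i x = Jtrans i j (chart i x) *m of_chart j x.
Proof.
move=> ix jx; rewrite !of_chartE -(trans_chart j ix).
apply: Jtrans_comp; first exact: overlap_chart.
by rewrite chartK //; exact: dom_chart_at.
Qed.

Section Bundle.
Variable n : nat.
Notation T := (tangent A n).
Notation Z := ('rV[R]_d * 'M[R]_(n, d))%type.
Implicit Types (z : Z) (p : T).

Definition tchart i p : Z := (chart i (base p), vec p *m to_chart i (base p)).
Definition ttrans i j z : Z := (trans i j z.1, z.2 *m Jtrans i j z.1).

Lemma tangent_openE (O : set T) : open O =
  (forall i, open (@tcod _ _ _ A n i `&` @tpar _ _ _ A n i @^-1` O)).
Proof. by []. Qed.

Lemma tchartK i p : dom i (base p) -> tpar i (tchart i p) = p.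
Proof.
case: p => x v /= ix; rewrite /tpar /= chartK //.
by rewrite -mulmxA to_chartK // mulmx1.
Qed.

Lemma tchart_tpar i j z : overlap i j z.1 -> tchart j (tpar i z) = ttrans i j z.
Proof.
case: z => y W ij; have [/= iy jy] := ij; have ix := dom_par iy.
rewrite /tchart /ttrans; apply: (congr2 pair); first by rewrite /= /trans.
rewrite [base _]/= [vec _]/=.
by rewrite (of_chart_trans ix jy) -!mulmxA (of_chartK jy) mulmx1 (parK iy).
Qed.

Lemma tpar_ttrans i j z : overlap i j z.1 -> tpar j (ttrans i j z) = tpar i z.
Proof. move=> ij; rewrite -(tchart_tpar ij) tchartK //; exact: ij.2. Qed.

Lemma tpar_at i z : tcod i z -> {for z, continuous (@tpar _ _ _ A n i)}.
Proof.
move=> iz O; rewrite nbhsE => -[B [oB Bz] BO].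
have : nbhs z (@tcod _ _ _ A n i `&` @tpar _ _ _ A n i @^-1` B).
  by apply: open_nbhs_nbhs; split; first exact: oB.
by apply: filterS => w [_ Bw]; exact: BO.
Qed.

Lemma ttrans_at i j z : overlap i j z.1 -> {for z, continuous (ttrans i j)}.
Proof.
move=> ij.
have H1 : trans i j w.1 @[w --> z] --> trans i j z.1.
  apply: (@continuous_comp _ _ _ fst (trans i j)); first exact: cvg_fst.
  exact: smooth_continuous (@trans_smooth i j) ij.
suff H2 : w.2 *m Jtrans i j w.1 @[w --> z] --> z.2 *m Jtrans i j z.1.
  exact: cvg_pair H1 H2.
apply: (@cvg_mx _ _ _ _ (nbhs z)) => k l.
have mE (w : Z) : (w.2 *m Jtrans i j w.1) k l = \sum_a w.2 k a * Jtrans i j w.1 a l.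
  by rewrite mxE.
rewrite mE; under eq_fun do rewrite mE.
apply: cvg_sumr => a _; apply: cvgM.
  apply: (@continuous_comp _ _ _ snd (fun W : 'M[R]_(n, d) => W k a)); first exact: cvg_snd.
  exact: coord_continuous.
rewrite (Jtrans_entry _ _ ij).
pose D (y : 'rV[R]_d) := 'D_(delta_mx 0 a) (fun y => trans i j y 0 l) y.
have cD : {for z.1, continuous D}.
  have := smooth_derive (delta_mx 0 a) (@trans_coord_smooth i j l).
  by move=> /smooth_continuous; exact.
have nz : \forall w \near z, D w.1 = Jtrans i j w.1 a l.
  have : nbhs z.1 (overlap i j) by apply: open_nbhs_nbhs; split => //; exact: overlap_open.
  move=> /(@nbhs_fst _ _ z); apply: filterS => w ijw.
  by rewrite (Jtrans_entry _ _ ijw).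
apply: cvg_trans (near_eq_cvg nz) _.
exact: (@continuous_comp _ _ _ fst D z cvg_fst cD).
Qed.

Lemma tchart_open i (O : set Z) : open O ->
  open [set p : T | dom i (base p) /\ O (tchart i p)].
Proof.
move=> oO; rewrite tangent_openE => j.
have -> : @tcod _ _ _ A n j `&` @tpar _ _ _ A n j @^-1`
    [set p | dom i (base p) /\ O (tchart i p)] =
    [set z | overlap j i z.1] `&` ttrans j i @^-1` O.
  apply/seteqP; split=> z.
    move=> [jz [iz Oz]]; have jiz : overlap j i z.1 by split.
    by split; [exact: jiz|rewrite /= -(tchart_tpar jiz)].
  move=> [jiz Oz]; split; first exact: jiz.1.
  by split; [exact: jiz.2|rewrite (tchart_tpar jiz)].
rewrite openE => z [ij Oz]; rewrite /interior; apply: filterI.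
  have : nbhs z.1 (overlap j i) by apply: open_nbhs_nbhs; split => //; exact: overlap_open.
  exact: nbhs_fst.
by apply: (ttrans_at ij); exact: open_nbhs_nbhs.
Qed.

Lemma continuous_tangent (X : topologicalType) (F : T -> X) :
  (forall i z, tcod i z -> {for z, continuous (F \o @tpar _ _ _ A n i)}) -> continuous F.
Proof.
move=> cF; apply: (iffRL (@continuousP T X F)) => O oO.
rewrite tangent_openE => i; rewrite openE => z [iz Oz].
rewrite /interior; apply: filterI.
  by apply: open_nbhs_nbhs; split => //; exact: tcod_open.
by apply: (cF i z iz); exact: open_nbhs_nbhs.
Qed.

Lemma base_continuous : continuous (@base _ _ _ A n).
Proof.
apply: continuous_tangent => i z iz.
exact: (@continuous_comp _ _ _ fst (par i) z cvg_fst (par_at iz)).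
Qed.

End Bundle.

(** The doubled cubes leave room, inside the chart, for cut-off functions that are
    constant near the cubes themselves. *)
Record cubic_cover := CubicCover {
  csize : nat ;
  cidx : 'I_csize -> idx A ;
  center : 'I_csize -> 'rV[R]_d ;
  radius : 'I_csize -> R ;
  radius_gt0 : forall k : 'I_csize, 0 < radius k ;
  double_cod : forall (k : 'I_csize) y, `|y - center k| <= 2 * radius k -> cod (cidx k) y ;
  cover_all : forall x, exists k : 'I_csize,
    dom (cidx k) x /\ `|chart (cidx k) x - center k| <= radius k
}.

Lemma exists_cover : compact [set: M] -> exists _ : cubic_cover, True.
Proof.
move=> cM.
have loc x : exists r : R, 0 < r /\ forall y,
    `|y - chart (chart_at A x) x| <= 2 * r -> cod (chart_at A x) y.
  have ix := dom_chart_at A x.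
  have : nbhs (chart (chart_at A x) x) (cod (chart_at A x)).
    by apply: open_nbhs_nbhs; split; [exact: cod_open|exact: cod_chart].
  move=> /nbhs_ballP[e /= e0 Be]; exists (e / 4); split; first by rewrite divr_gt0.
  move=> y ye; apply: Be; rewrite -ball_normE /= distrC (le_lt_trans ye) //; lra.
have [r Hr] := choice loc.
pose f x := [set x' | dom (chart_at A x) x' /\
  `|chart (chart_at A x) x' - chart (chart_at A x) x| < r x].
have of_ x : open (f x).
  rewrite openE => x' [ix' x'r]; rewrite /interior; apply: filterI.
    by apply: open_nbhs_nbhs; split => //; exact: dom_open.
  have cx' := chart_at_point ix'.
  have e0 : 0 < r x - `|chart (chart_at A x) x' - chart (chart_at A x) x| by rewrite subr_gt0.
  have /cvgrPdist_lt/(_ _ e0) := cx'; apply: filterS => x0 /=.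
  rewrite ltrBrDr distrC; apply: le_lt_trans.
  by rewrite -[X in `|X| <= _](subrKA (chart (chart_at A x) x')) ler_normD.
have := cM; rewrite compact_cover => /(_ M setT f (fun x _ => of_ x)) [].
  move=> x _; exists x => //; split; first exact: dom_chart_at.
  by rewrite subrr normr0; case: (Hr x).
move=> D _ fD; pose s := finmap.enum_fset D.
pose pt (k : 'I_(size s)) := nth point s k.
have H1 (k : 'I_(size s)) : 0 < r (pt k) by case: (Hr (pt k)).
have H2 (k : 'I_(size s)) (y : 'rV_d) :
    `|y - chart (chart_at A (pt k)) (pt k)| <= 2 * r (pt k) -> cod (chart_at A (pt k)) y.
  by case: (Hr (pt k)) => _; exact.
have H3 x : exists k : 'I_(size s), dom (chart_at A (pt k)) x /\
    `|chart (chart_at A (pt k)) x - chart (chart_at A (pt k)) (pt k)| <= r (pt k).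
  have [x0 /= x0D [ix xr]] := fD x I.
  have x0s : (index x0 s < size s)%N by rewrite index_mem.
  exists (Ordinal x0s); rewrite /pt /= nth_index //; split => //; exact: ltW.
by exists (CubicCover H1 H2 H3).
Qed.

End Atlas.

(** * The exterior derivative in a chart *)

Section Determinants.
Variable R : realType.

Lemma det_row_linear m d (Q : 'M[R]_(d, m)) : row_linear (fun W => \det (W *m Q)).
Proof.
move=> W j a u u'; rewrite !mulmx_setrow -[X in _ = _ + X]mul1r.
have rE X v : row' j (setrow X j v) = row' j X :> 'M[R]_(_, m).
  by apply/matrixP => k l; rewrite !mxE eq_sym (negPf (neq_lift _ _)).
apply: (determinant_multilinear (i0 := j)); rewrite ?rE //.
by rewrite !row_setrow mulmxDl scale1r scalemxAl.
Qed.

Lemma det_row_alternating m d (Q : 'M[R]_(d, m)) :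
  row_alternating (fun W => \det (W *m Q)).
Proof.
move=> W j j' jj' Wjj'; apply: (determinant_alternate jj') => l.
by have /(congr1 (mulmx^~ Q))/rowP/(_ l) := Wjj'; rewrite -!row_mul !mxE.
Qed.

Definition select d m (I : {ffun 'I_m -> 'I_d}) : 'M[R]_(d, m) :=
  \matrix_(a, b) (a == I b)%:R.

Lemma colsub_select m d k (I : {ffun 'I_m -> 'I_d}) (W : 'M[R]_(k, d)) :
  colsub I W = W *m select I.
Proof.
apply/matrixP => a b; rewrite !mxE (bigD1 (I b)) //= mxE eqxx mulr1 big1 ?addr0 //.
by move=> c /negPf cI; rewrite mxE cI mulr0.
Qed.

(** Expansion along the column that holds the covector [al]: the left-hand side is
    the value on [W] of [al /\ dy_(I 0) /\ ... /\ dy_(I (k-1))]. *)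
Lemma expand_bordered k d (W : 'M[R]_(k.+1, d)) (I : {ffun 'I_k -> 'I_d}) (al : 'I_d -> R) :
  \sum_(j < k.+1) (-1) ^+ j * (\sum_a W j a * al a) * \det (colsub I (row' j W)) =
  \det (W *m \matrix_(a, q) if unlift ord0 q is Some q' then (a == I q')%:R else al a).
Proof.
set Q := \matrix_(_, _) _.
rewrite (expand_det_col _ ord0); apply: eq_bigr => j _.
have -> : (W *m Q) j ord0 = \sum_a W j a * al a.
  by rewrite mxE; apply: eq_bigr => a _; rewrite mxE unlift_none.
rewrite [(-1) ^+ j * _]mulrC -mulrA /cofactor addn0; congr (_ * (_ * \det _)).
apply/matrixP => a b; rewrite !mxE (bigD1 (I b)) //= !mxE liftK eqxx mulr1 big1 ?addr0 //.
by move=> c /negPf cI; rewrite !mxE liftK cI mulr0.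
Qed.

Context {V : normedModType R}.

Lemma is_derive_prod n (f : 'I_n -> V -> R) (df : 'I_n -> R) x v :
  (forall i, is_derive x v (f i) (df i)) ->
  is_derive x v (fun y => \prod_i f i y) (\sum_i df i * \prod_(j | j != i) f j x).
Proof.
elim: n f df => [|n IH] f df fd.
  rewrite big_ord0 (_ : (fun _ => _) = cst 1); first exact: is_derive_cst.
  by apply/funext => y; rewrite big_ord0.
have {IH} d2 := IH (fun i => f (lift ord0 i)) (fun i => df (lift ord0 i)) (fun i => fd _).
have -> : (fun y => \prod_i f i y) = f ord0 * (fun y => \prod_i f (lift ord0 i) y).
  by apply/funext => y; rewrite big_ord_recl.
apply: is_derive_eq (is_deriveM (fd ord0) d2) _.
rewrite -[LHS]/(_ * _ + _ * _) big_ord_recl addrC; congr (_ + _).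
  by rewrite mulrC [in RHS]big_mkcond big_ord_recl /= mul1r.
rewrite big_distrr; apply: eq_bigr => i _ /=; rewrite mulrCA; congr (_ * _).
rewrite [in RHS]big_mkcond big_ord_recl /= [in LHS]big_mkcond; congr (_ * _).
Qed.

Lemma is_derive_bigsum (I : Type) (r : seq I) (f : I -> V -> R) (df : I -> R) x v :
  (forall i, is_derive x v (f i) (df i)) ->
  is_derive x v (fun y => \sum_(i <- r) f i y) (\sum_(i <- r) df i).
Proof.
move=> fd; elim: r => [|i r IH].
  rewrite big_nil (_ : (fun _ => _) = cst 0); first exact: is_derive_cst.
  by apply/funext => y; rewrite big_nil.
rewrite big_cons (_ : (fun _ => _) = f i + (fun y => \sum_(i <- r) f i y)).
  exact: is_deriveD.
by apply/funext => y; rewrite big_cons.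
Qed.

Lemma is_derive_det n (F : 'I_n -> 'I_n -> V -> R) (dF : 'I_n -> 'I_n -> R) x v :
  (forall i j, is_derive x v (F i j) (dF i j)) ->
  is_derive x v (fun y => \det (\matrix_(i, j) F i j y))
    (\sum_a \det (setrow (\matrix_(i, j) F i j x) a (\row_j dF a j))).
Proof.
move=> Fd.
have d1 (s : 'S_n) := is_derive_prod (fun i => Fd i (s i)).
have dG (s : 'S_n) : is_derive x v (fun y => (-1) ^+ s * \prod_i F i (s i) y)
    ((-1) ^+ s * \sum_i dF i (s i) * \prod_(j | j != i) F j (s j) x).
  exact: (is_deriveZ ((-1) ^+ s) (d1 s)).
have := is_derive_bigsum (index_enum _) dG.
have -> : (fun y => \det (\matrix_(i, j) F i j y)) =
    (fun y => \sum_(s : 'S_n) (-1) ^+ s * \prod_i F i (s i) y).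
  apply/funext => y; apply: eq_bigr => s _; congr (_ * _).
  by apply: eq_bigr => i _; rewrite mxE.
move=> dS; apply: is_derive_eq dS _.
under eq_bigr do rewrite big_distrr /=.
rewrite exchange_big /=; apply: eq_bigr => a _; apply: eq_bigr => s _; congr (_ * _).
rewrite [RHS](bigD1 a) //= !mxE eqxx; congr (_ * _).
by apply: eq_bigr => j /negPf ja; rewrite !mxE ja.
Qed.

(** [d (dh_1 /\ ... /\ dh_k) = 0]: the second derivatives of the [h b] enter
    symmetrically, the minors antisymmetrically. *)
Lemma ext_deriv_dd k U (h : 'I_k -> V -> R) (w : 'I_k.+1 -> V) x : open U -> U x ->
  (forall b, smooth_on U (h b)) ->
  \sum_(j < k.+1) (-1) ^+ j * 'D_(w j) (fun y =>
     \det (\matrix_(a, b) 'D_(w (lift j a)) (h b) y)) x = 0.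
Proof.
move=> oU Ux hs.
pose X : 'M[R]_(k.+1, k) := \matrix_(m, b) 'D_(w m) (h b) x.
pose B i j : 'rV[R]_k := \row_b 'D_(w i) ('D_(w j) (h b)) x.
have Bsym i j : B i j = B j i.
  apply/rowP => b; have E := derive_swap (w i) (w j) oU (hs b 2%N) Ux.
  exact: etrans (mxE _ _ _ _) (etrans E (esym (mxE _ _ _ _))).
(* The term of the [j]-th derivative in which the row of index [b] in [X] has been
   differentiated; [F j b] and [F b j] cancel. *)
pose F (j b : 'I_k.+1) := (-1) ^+ j * \det (row' j (setrow X b (B j b))).
have FE (j : 'I_k.+1) : (-1) ^+ j * 'D_(w j) (fun y =>
     \det (\matrix_(a, b) 'D_(w (lift j a)) (h b) y)) x = \sum_(b | b != j) F j b.
  have dF (a b : 'I_k) : is_derive x (w j) ('D_(w (lift j a)) (h b))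
      ('D_(w j) ('D_(w (lift j a)) (h b)) x).
    apply: derivableP; apply: diff_derivable.
    exact: smooth_differentiable (smooth_derive _ (hs b)) Ux.
  have [_ ->] := is_derive_det dF.
  rewrite -sum_lift big_distrr /=; apply: eq_bigr => a _; congr (_ * \det _).
  apply/matrixP => p q; rewrite !mxE (inj_eq lift_inj).
  by case: eqP.
rewrite (eq_bigr _ (fun j _ => FE j)).
under eq_bigr do rewrite big_mkcond /=.
set S := \sum_j _.
suff : S + S = 0 by rewrite -mulr2n -mulr_natr => /eqP; rewrite mulf_eq0 pnatr_eq0 orbF => /eqP.
rewrite {2}/S exchange_big /= -big_split /= big1 // => j _.
rewrite -big_split /= big1 // => b _; rewrite [j == b]eq_sym.
case: (eqVneq b j) => [_|bj]; first by rewrite addr0.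
pose Y := setrow (setrow X b (B j b)) j (B j b).
have Yrow : row j Y = row b Y.
  by rewrite row_setrow row_setrow_neq // row_setrow.
have jb : j != b by rewrite eq_sym.
rewrite /= -(minor_swap jb Yrow) /F (Bsym b j) /Y.
generalize (B j b) X => z X0.
have -> : row' j (setrow X0 b z) = row' j (setrow (setrow X0 b z) j z).
  by apply/matrixP => p q; rewrite !mxE [lift j p == j]eq_sym (negPf (neq_lift _ _)).
have -> // : row' b (setrow X0 j z) = row' b (setrow (setrow X0 b z) j z).
by apply/matrixP => p q; rewrite !mxE [lift b p == b]eq_sym (negPf (neq_lift _ _)).
Qed.

End Determinants.

Section Smooth_bundle.
Context {R : realType} {d : nat} {M : ptopologicalType} (A : smooth_atlas R d M) (n : nat).
Notation T := (tangent A n).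

Lemma derive_coord (f : 'rV[R]_d -> R) y v : differentiable f y ->
  'D_v f y = \sum_a v 0 a * 'D_(delta_mx 0 a) f y.
Proof.
move=> df; rewrite (deriveE _ df) {1}(row_sum_delta v) linear_sum.
by apply: eq_bigr => a _; rewrite linearZ -(deriveE _ df).
Qed.

Lemma Ck_entry k (U : set ('rV[R]_d * 'M[R]_(n, d))) a b :
  Ck_on k U (fun z => z.2 a b : R).
Proof.
have lin : linear (fun z : 'rV[R]_d * 'M[R]_(n, d) => z.2 a b : R).
  by move=> c z z' /=; rewrite !mxE.
pose f : {linear ('rV[R]_d * 'M[R]_(n, d))%type -> R} :=
  HB.pack (fun z : 'rV[R]_d * 'M[R]_(n, d) => z.2 a b : R)
    (GRing.isLinear.Build _ _ _ _ _ lin).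
apply: (@Ck_lin _ _ k U f) => z.
apply: (@continuous_comp _ _ _ snd (fun W : 'M[R]_(n, d) => W a b)); first exact: cvg_snd.
exact: coord_continuous.
Qed.

Lemma smooth_fun_continuous (f : T -> R) : smooth_fun f -> continuous f.
Proof.
move=> sf; apply: continuous_tangent => i z iz.
exact: smooth_continuous (sf i) iz.
Qed.

End Smooth_bundle.

Section Forms.
Context {R : realType} {d : nat} {M : ptopologicalType} (A : smooth_atlas R d M).
Implicit Types (i c : idx A) (y : 'rV[R]_d).

Lemma set_vecE k (p : tangent A k) j u :
  set_vec p j u = Tangent A (base p) (setrow (vec p) j u).
Proof. by []. Qed.

Lemma tpar_setrow k i y (W : 'M[R]_(k, d)) j u :
  tpar i (y, setrow W j u) = set_vec (tpar i (y, W)) j (u *m of_chart i (par i y)).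
Proof. by rewrite set_vecE /tpar mulmx_setrow. Qed.

Section One_form.
Variables (k : nat) (w : tangent A k -> R).
Hypothesis wO : Omega A k w.

Lemma form_row_linear i y : row_linear (fun W => w (tpar i (y, W))).
Proof.
move=> W j a u u'; rewrite !tpar_setrow mulmxDl -scalemxAl.
by have [wL _ _] := wO; exact: wL.
Qed.

Lemma form_row_alternating i y : row_alternating (fun W => w (tpar i (y, W))).
Proof.
move=> W j j' jj' Wjj'; have [_ wA _] := wO; apply: (wA _ _ _ jj').
by rewrite !row_mul Wjj'.
Qed.

Definition coef i I y := w (tpar i (y, frame R I)).

Lemma coef_smooth i I : smooth_on (cod i) (coef i I).
Proof. by have [_ _ wS] := wO; exact: wS. Qed.

Lemma form_expand i y W : w (tpar i (y, W)) = k`!%:R^-1 *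
  \sum_(I : {ffun 'I_k -> 'I_d}) coef i I y * \det (colsub I W).
Proof. exact: alternating_expand (form_row_linear i y) (form_row_alternating i y) W. Qed.

Lemma is_derive_form i y v W : cod i y ->
  is_derive y v (fun y => w (tpar i (y, W)))
    (k`!%:R^-1 * \sum_(I : {ffun 'I_k -> 'I_d}) 'D_v (coef i I) y * \det (colsub I W)).
Proof.
move=> iy.
have -> : (fun y => w (tpar i (y, W))) = k`!%:R^-1 \*: (fun y =>
    \sum_(I : {ffun 'I_k -> 'I_d}) \det (colsub I W) * coef i I y).
  apply/funext => z; rewrite form_expand -[RHS]/(_ * _); congr (_ * _).
  by apply: eq_bigr => I _; rewrite mulrC.
have dc (I : {ffun 'I_k -> 'I_d}) : is_derive y v (fun y => \det (colsub I W) * coef i I y)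
    (\det (colsub I W) * 'D_v (coef i I) y).
  have := is_deriveZ (\det (colsub I W)) (derivableP (f := coef i I) (x := y) (v := v) _).
  apply; apply: diff_derivable; exact: smooth_differentiable (coef_smooth i I) iy.
have := is_deriveZ (k`!%:R^-1) (is_derive_bigsum (index_enum _) dc).
move=> dS; apply: is_derive_eq dS _; congr (_ * _).
by apply: eq_bigr => I _; rewrite mulrC.
Qed.

(** By definition [extd] is computed in the preferred chart at each point. Passing
    to the i-th chart also differentiates the Jacobians of the transition; these
    additional terms cancel by [ext_deriv_dd]. *)
Lemma extd_chart i y (W : 'M[R]_(k.+1, d)) : cod i y ->
  extd (n := k.+1) w (tpar i (y, W)) = k`!%:R^-1 *
  \sum_(I : {ffun 'I_k -> 'I_d}) \sum_(j < k.+1)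
    (-1) ^+ j * 'D_(row j W) (coef i I) y * \det (colsub I (row' j W)).
Proof.
move=> iy; set x := par i y; set c := chart_at A x.
have ic : overlap i c y by split => //; exact: dom_chart_at.
have ix : dom i x by exact: dom_par.
have cty : cod c (trans i c y) by exact: (trans_overlap ic).1.
set J := Jtrans i c y.
have ofJ : of_chart i x = J by rewrite of_chartE /J /x parK.
have nic : nbhs y (overlap i c) by apply: open_nbhs_nbhs; split => //; exact: overlap_open.
(* One derivative of [w] in two ways: [D1] by the coefficients in the i-th chart,
   [D2] by those in the preferred chart and the minors [N] of the transition. *)
have D1 j := is_derive_form (row j W) (row' j W) iy.
pose N j I y' : 'M[R]_k := \matrix_(a, b) 'D_(row (lift j a) W) (fun z => trans i c z 0 (I b)) y'.
have NE j I y' : overlap i c y' -> colsub I (row' j W *m Jtrans i c y') = N j I y'.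
  move=> icy'; apply/matrixP => a b; rewrite !mxE.
  have ds : differentiable (fun z => trans i c z 0 (I b)) y'.
    exact: smooth_differentiable (@trans_coord_smooth _ _ _ _ i c (I b)) icy'.
  rewrite (deriveE _ ds) [row _ W]row_sum_delta linear_sum.
  by apply: eq_bigr => e _; rewrite linearZ mxE -(deriveE _ ds) -Jtrans_entry // !mxE.
have dN j (I : {ffun 'I_k -> 'I_d}) : derivable (fun y' => \det (N j I y')) y (row j W).
  apply: diff_derivable; have : Ck_on 1 (overlap i c) (fun y' => \det (N j I y')).
    apply: Ck_det; first exact: overlap_open.
    move=> a b; apply: smooth_derive; exact: trans_coord_smooth.
  by move=> [+ _]; apply.
have dco j (I : {ffun 'I_k -> 'I_d}) : is_derive y (row j W) (fun y' => coef c I (trans i c y'))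
    ('D_(row j W *m J) (coef c I) (trans i c y)).
  have d1 := smooth_differentiable (coef_smooth c I) cty.
  have d2 := trans_diff ic.
  apply: DeriveDef; first by apply: diff_derivable; exact: (differentiable_comp d2 d1).
  apply: etrans (deriveE _ (differentiable_comp d2 d1)) _.
  rewrite (diff_comp d2 d1) /= (deriveE _ d1); congr ('d _ _ _).
  rewrite -(deriveE _ d2) (deriveEjacobian _ d2).
  by rewrite /J Jtrans.unlock.
have D2 j : is_derive y (row j W) (fun y => w (tpar i (y, row' j W)))
    (k`!%:R^-1 * \sum_(I : {ffun 'I_k -> 'I_d})
      ('D_(row j W *m J) (coef c I) (trans i c y) * \det (colsub I (row' j W *m J)) +
       coef c I (trans i c y) * 'D_(row j W) (fun y' => \det (N j I y')) y)).
  have dp (I : {ffun 'I_k -> 'I_d}) : is_derive y (row j W)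
      (fun y' => coef c I (trans i c y') * \det (N j I y'))
      ('D_(row j W *m J) (coef c I) (trans i c y) * \det (colsub I (row' j W *m J)) +
       coef c I (trans i c y) * 'D_(row j W) (fun y' => \det (N j I y')) y).
    have := is_deriveM (dco j I) (derivableP (dN j I)) => dm.
    apply: is_derive_eq dm _; rewrite -[LHS]/(_ * _ + _ * _) addrC -(NE j I y ic) -/J.
    by congr (_ + _); exact: mulrC.
  have := is_deriveZ (k`!%:R^-1) (is_derive_bigsum (index_enum _) dp).
  apply: near_eq_is_derive.
  apply: filterS nic => y' icy'; rewrite -[LHS]/(_ * _).
  rewrite -(tpar_ttrans (i := i) (j := c) (z := (y', _)) icy') form_expand; congr (_ * _).
  by apply: eq_bigr => I _; rewrite NE.
transitivity (\sum_(j < k.+1) (-1) ^+ j * (k`!%:R^-1 * \sum_(I : {ffun 'I_k -> 'I_d})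
    'D_(row j W *m J) (coef c I) (trans i c y) * \det (colsub I (row' j W *m J)))).
  apply: eq_bigr => j _; congr (_ * _).
  rewrite [base _]/= -/x -/c /tpar [vec _]/= ofJ.
  have -> : chart c x = trans i c y by [].
  have [_ <-] := is_derive_form (row j W *m J) (row' j W *m J) cty.
  have rm : row' j (W *m J) = row' j W *m J.
    by apply/matrixP => a b; rewrite !mxE; apply: eq_bigr => e _; rewrite mxE.
  by rewrite row_mul rm.
pose Q j := \sum_(I : {ffun 'I_k -> 'I_d})
  coef c I (trans i c y) * 'D_(row j W) (fun y' => \det (N j I y')) y.
have Q0 : \sum_(j < k.+1) (-1) ^+ j * (k`!%:R^-1 * Q j) = 0.
  under eq_bigr do rewrite mulrCA /Q big_distrr /=.
  rewrite -big_distrr /= exchange_big /= big1 ?mulr0 // => I _.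
  under eq_bigr do rewrite mulrCA.
  rewrite -big_distrr /= (ext_deriv_dd (U := overlap i c)) ?mulr0 //.
    exact: overlap_open.
  by move=> b; exact: trans_coord_smooth.
rewrite -[LHS]addr0 -[X in _ + X]Q0 -big_split /= [X in _ = _ * X]exchange_big big_distrr /=.
apply: eq_bigr => j _; rewrite -mulrDr -mulrDr -big_split /=.
have [_ E1] := D1 j; have [_ E2] := D2 j.
rewrite -E2 E1 mulrCA; congr (_ * _); rewrite big_distrr /=.
by apply: eq_bigr => I _; rewrite mulrA.
Qed.

(** As a sum of determinants of [W] times a matrix, [extd w] is visibly multilinear
    and alternating in the rows of [W]. *)
Definition bordered i (I : {ffun 'I_k -> 'I_d}) y : 'M[R]_(d, k.+1) :=
  \matrix_(a, q) if unlift ord0 q is Some q' then (a == I q')%:R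
                 else 'D_(delta_mx 0 a) (coef i I) y.

Lemma extd_det i y (W : 'M[R]_(k.+1, d)) : cod i y ->
  extd (n := k.+1) w (tpar i (y, W)) = k`!%:R^-1 *
  \sum_(I : {ffun 'I_k -> 'I_d}) \det (W *m bordered i I y).
Proof.
move=> iy; rewrite extd_chart //; congr (_ * _); apply: eq_bigr => I _.
rewrite /bordered -(expand_bordered W I (fun a => 'D_(delta_mx 0 a) (coef i I) y)).
apply: eq_bigr => j _; rewrite derive_coord; last first.
  exact: smooth_differentiable (coef_smooth i I) iy.
by congr (_ * _ * _); apply: eq_bigr => a _; rewrite mxE.
Qed.

Lemma extd_row_linear i y : cod i y ->
  row_linear (fun W => extd (n := k.+1) w (tpar i (y, W))).
Proof.
move=> iy W j a u u'; rewrite !extd_det // mulrCA -mulrDr; congr (_ * _).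
rewrite big_distrr -big_split /=; apply: eq_bigr => I _; exact: det_row_linear.
Qed.

Lemma extd_row_alternating i y : cod i y ->
  row_alternating (fun W => extd (n := k.+1) w (tpar i (y, W))).
Proof.
move=> iy W j j' jj' Wjj'; rewrite extd_det // big1 ?mulr0 // => I _.
exact: (det_row_alternating _ jj').
Qed.

Lemma form_smooth : smooth_fun w.
Proof.
move=> i m; have oT := @tcod_open _ _ _ A k i.
have : Ck_on m (@tcod _ _ _ A k i) (fun z => \sum_(I : {ffun 'I_k -> 'I_d})
    k`!%:R^-1 * (coef i I z.1 * \det (\matrix_(a, b) z.2 a (I b)))).
  apply: Ck_sum => // I _; apply: Ck_M => //; first exact: (@Ck_cst _ _ _ _ _ (k`!%:R^-1 : R)).
  apply: Ck_M => //; first exact: (@Ck_fst R _ 'M[R]_(k, d) m (cod i) (coef i I) (coef_smooth i I m)).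
  by apply: Ck_det => // a b; exact: Ck_entry.
apply: (Ck_eq oT) => -[y W] iy /=; rewrite form_expand.
rewrite big_distrr; apply: eq_bigr => I _; congr (_ * (_ * \det _)).
Qed.

Lemma extd_smooth : smooth_fun (extd (n := k.+1) w).
Proof.
move=> i m; have oT := @tcod_open _ _ _ A k.+1 i.
have : Ck_on m (@tcod _ _ _ A k.+1 i) (fun z => \sum_(I : {ffun 'I_k -> 'I_d})
    k`!%:R^-1 * \det (\matrix_(a, b) \sum_c z.2 a c * bordered i I z.1 c b)).
  apply: Ck_sum => // I _; apply: Ck_M => //; first exact: (@Ck_cst _ _ _ _ _ (k`!%:R^-1 : R)).
  apply: Ck_det => // a b; apply: Ck_sum => // c _; apply: Ck_M => //; first exact: Ck_entry.
  case: (unliftP ord0 b) => [b' ->|->].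
    apply: (Ck_eq oT _ (Ck_cst m _ ((c == I b')%:R : R))) => z _.
    by rewrite mxE liftK.
  apply: (Ck_eq oT _ (@Ck_fst R _ 'M[R]_(k.+1, d) m (cod i) _ (smooth_derive (delta_mx 0 c) (coef_smooth i I) m))) => z _.
  by rewrite mxE unlift_none.
apply: (Ck_eq oT) => -[y W] iy /=; rewrite extd_det //.
rewrite big_distrr; apply: eq_bigr => I _; congr (_ * \det _).
by apply/matrixP => a b; rewrite !mxE.
Qed.

End One_form.
End Forms.

(** * Borel sets and functions *)

Section Sets.
Context {dX : measure_display} {X : measurableType dX} {R : realType}.
Implicit Types D : set X.

Lemma measurable_lt_set D (f : X -> R) (e : R) : measurable D -> measurable_fun D f ->
  measurable (D `&` [set x | f x < e]).
Proof.
move=> mD mf; have /(_ mD [set true] I) := measurable_fun_ltr mf (measurable_cst e).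
by congr measurable; apply/seteqP; split=> x [Dx /= fe].
Qed.

Lemma measurable_forall_set (I : finType) D (P : I -> set X) : measurable D ->
  (forall i, measurable (D `&` P i)) -> measurable (D `&` [set x | forall i, P i x]).
Proof.
move=> mD mP.
have -> : D `&` [set x | forall i, P i x] = D `\` \bigcup_(i in [set: I]) (D `\` (D `&` P i)).
  apply/seteqP; split=> x.
    by move=> [Dx Px]; split => // -[i _ [_ []]]; split.
  move=> [Dx nU]; split => // i; apply: contrapT => nP; apply: nU.
  by exists i => //; split => // -[].
apply: measurableD => //; apply: fin_bigcup_measurable; first exact: finite_finset.
by move=> i _; exact: measurableD.
Qed.

Lemma measurable_gt_fun D (f : X -> R) : measurable D ->
  (forall a, measurable (D `&` [set x | a < f x])) -> measurable_fun D f.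
Proof.
move=> mD H; apply: (measurability _ (RGenOInfty.measurableE R)) => _ [_ [a ->] <-].
have := H a; congr measurable; apply/seteqP; split=> x [Dx].
  by move=> /= ax; split=> //=; rewrite in_itv /= ax.
by rewrite /= in_itv /= andbT.
Qed.

Lemma measurable_finite_pieces (dY : measure_display) (Y : measurableType dY) (I : finType)
    (P : I -> set X) (F : X -> Y) :
  (forall i, measurable (P i)) -> (forall x, exists i, P i x) ->
  (forall i, measurable_fun (P i) F) -> measurable_fun setT F.
Proof.
move=> mP cP mF _ B mB; rewrite setTI.
have -> : F @^-1` B = \bigcup_(i in [set: I]) (P i `&` F @^-1` B).
  apply/seteqP; split=> x; last by move=> [i _ []].
  by move=> Bx; have [i Pi] := cP x; exists i.
apply: fin_bigcup_measurable; first exact: finite_finset.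
by move=> i _; exact: mF.
Qed.

End Sets.

Section Boxes.
Context {R : realType} {d n : nat}.
Notation Z := ('rV[R]_d * 'M[R]_(n, d))%type.

Definition box_index : countType := ('rV[rat]_d * 'M[rat]_(n, d) * nat)%type.

Definition box (q : box_index) : set Z := [set z : Z |
  (forall l, `|z.1 0 l - ratr (q.1.1 0 l)| < q.2.+1%:R^-1) /\
  (forall jl : 'I_n * 'I_d, `|z.2 jl.1 jl.2 - ratr (q.1.2 jl.1 jl.2)| < q.2.+1%:R^-1)].

Lemma ratr_approx (x e : R) : 0 < e -> exists q : rat, `|x - ratr q| < e.
Proof.
move=> e0; have [q] := @rat_in_itvoo R (x - e) (x + e) (ltac:(lra)).
rewrite in_itv /= => /andP[a b]; exists q; rewrite ltr_norml; lra.
Qed.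

Lemma box_basis (z : Z) (O : set Z) : nbhs z O -> exists2 q, box q z & box q `<=` O.
Proof.
move=> /nbhs_ballP[e /= e0 zeO].
have [m me] : exists m : nat, m.+1%:R^-1 < e / 2 :> R.
  have e2 : 0 < e / 2 by rewrite divr_gt0.
  by have [m _ /(_ m (leqnn m)) /= H] := near_infty_natSinv_lt (PosNum e2); exists m.
have m0 : 0 < m.+1%:R^-1 :> R by rewrite invr_gt0.
have /choice[a Ha] l : exists q : rat, `|z.1 0 l - ratr q| < m.+1%:R^-1 by exact: ratr_approx.
have /choice[b Hb] (jl : 'I_n * 'I_d) : exists q : rat, `|z.2 jl.1 jl.2 - ratr q| < m.+1%:R^-1.
  exact: ratr_approx.
exists ((\row_l a l, \matrix_(j, l) b (j, l)), m).
  by split=> [l|[j l]]; rewrite /= mxE; [exact: Ha|exact: (Hb (j, l))].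
have close (x y r : R) : `|x - r| < m.+1%:R^-1 -> `|y - r| < m.+1%:R^-1 -> ball x e y.
  move=> xr yr; rewrite -ball_normE /= -(subrKA r).
  apply: le_lt_trans (ler_normD _ _) _; rewrite (splitr e).
  by apply: ltrD; [exact: lt_trans xr me|rewrite distrC; exact: lt_trans yr me].
move=> w [/= wa wb]; apply: zeO; split => /=.
  split; first exact: e0.
  move=> i l; rewrite !(ord1 i); apply: (close _ _ (ratr (a l))); first exact: Ha.
  by have := wa l; rewrite mxE.
split; first exact: e0.
move=> j l; apply: (close _ _ (ratr (b (j, l)))); first exact: (Hb (j, l)).
by have := wb (j, l); rewrite /= mxE.
Qed.

Lemma box_open q : open (box q).
Proof.
rewrite openE => z [z1 z2]; rewrite /interior.
have N1 l : nbhs z [set w : Z | `|w.1 0 l - ratr (q.1.1 0 l)| < q.2.+1%:R^-1].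
  have c1 : (fun w : Z => `|w.1 0 l - ratr (q.1.1 0 l)|) @ z --> `|z.1 0 l - ratr (q.1.1 0 l)|.
    apply: cvg_norm; apply: cvgB; last exact: cvg_cst.
    apply: (@continuous_comp _ _ _ fst (fun y : 'rV[R]_d => y 0 l)); first exact: cvg_fst.
    exact: coord_continuous.
  by move: c1 => /cvgr_lt/(_ _ (z1 l)).
have N2 (jl : 'I_n * 'I_d) : nbhs z [set w : Z |
    `|w.2 jl.1 jl.2 - ratr (q.1.2 jl.1 jl.2)| < q.2.+1%:R^-1].
  have c2 : (fun w : Z => `|w.2 jl.1 jl.2 - ratr (q.1.2 jl.1 jl.2)|) @ z -->
      `|z.2 jl.1 jl.2 - ratr (q.1.2 jl.1 jl.2)|.
    apply: cvg_norm; apply: cvgB; last exact: cvg_cst.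
    apply: (@continuous_comp _ _ _ snd (fun W : 'M[R]_(n, d) => W jl.1 jl.2)); first exact: cvg_snd.
    exact: coord_continuous.
  by move: c2 => /cvgr_lt/(_ _ (z2 jl)).
have F1 := @filter_forall Z _ _ (nbhs z) (nbhs_filter z) N1.
have F2 := @filter_forall Z _ _ (nbhs z) (nbhs_filter z) N2.
by apply: filterS2 F1 F2 => w.
Qed.

(** Open sets of coordinates are countable unions of rational boxes, so only the
    coordinate functions have to be measurable. *)
Lemma measurable_open_preimage (dX : measure_display) (X : measurableType dX) (D : set X)
    (y : X -> 'rV[R]_d) (W : X -> 'M[R]_(n, d)) (O : set Z) : measurable D ->
  (forall l, measurable_fun D (fun x => y x 0 l)) ->
  (forall j l, measurable_fun D (fun x => W x j l)) ->
  open O -> measurable (D `&` [set x | O (y x, W x)]).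
Proof.
move=> mD my mW oO.
have -> : D `&` [set x | O (y x, W x)] =
    \bigcup_q [set x | box q `<=` O /\ (D `&` [set x | box q (y x, W x)]) x].
  apply/seteqP; split=> x.
    move=> [Dx Ox]; have [|q qx qO] := @box_basis (y x, W x) O.
      by apply: open_nbhs_nbhs; split.
    by exists q.
  by move=> [q _ [qO [Dx qx]]]; split => //; exact: qO.
apply: countable_bigcupT_measurable; first exact: countableP.
move=> q; have [qO|nqO] := pselect (box q `<=` O); last first.
  rewrite (_ : [set x | _] = set0); first exact: measurable0.
  by apply/seteqP; split=> x // [].
rewrite (_ : [set x | _] = (D `&` [set x | forall l, `|y x 0 l - ratr (q.1.1 0 l)| < q.2.+1%:R^-1]) `&`
  (D `&` [set x | forall jl : 'I_n * 'I_d, `|W x jl.1 jl.2 - ratr (q.1.2 jl.1 jl.2)| < q.2.+1%:R^-1])); last first.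
  apply/seteqP; split=> x; first by move=> [_ [Dx [b1 b2]]].
  by move=> [[Dx b1] [_ b2]].
apply: measurableI; apply: measurable_forall_set => // i; apply: measurable_lt_set => //;
  apply: measurableT_comp => //; apply: measurable_funB => //; exact: measurable_cst.
Qed.

End Boxes.

Section Borel.
Context {R : realType} {d : nat} {M : ptopologicalType} {A : smooth_atlas R d M} {n : nat}.
Notation T := (tangent A n).
Notation Z := ('rV[R]_d * 'M[R]_(n, d))%type.

Lemma borel_open (O : set T) : open O -> measurable (O : set (borel A n)).
Proof. by move=> oO; apply: sub_sigma_algebra. Qed.

Lemma measurable_to_borel (dX : measure_display) (X : measurableType dX) (D : set X)
    (F : X -> borel A n) :
  (forall O : set T, open O -> measurable (D `&` F @^-1` O)) -> measurable_fun D F.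
Proof. by move=> H; apply: (@measurability _ _ X (borel A n) D F (@open T)) => // _ [B oB <-]; exact: H. Qed.

Lemma measurable_tchart (i : idx A) (G : Z -> R) (D : set (borel A n)) :
  measurable D -> (forall p, D p -> dom i (base p)) ->
  (forall z, tcod i z -> {for z, continuous G}) ->
  measurable_fun D (fun p => G (tchart i p)).
Proof.
move=> mD Di cG; apply: measurable_gt_fun => // a.
pose O := @tcod _ _ _ A n i `&` [set z | a < G z].
have oO : open O.
  rewrite openE => z [iz az]; rewrite /interior; apply: filterI.
    by apply: open_nbhs_nbhs; split => //; exact: tcod_open.
  by move: (cG z iz) => /cvgr_gt/(_ _ az).
have -> : D `&` [set p | a < G (tchart i p)] = D `&` [set p : T | dom i (base p) /\ O (tchart i p)].
  apply/seteqP; split=> p [Dp].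
    by move=> ap; split => //; have ip := Di p Dp; do !split => //; exact: cod_chart.
  by move=> [_ [_ ap]].
apply: measurableI => //; apply: borel_open; exact: tchart_open.
Qed.

Lemma measurable_continuous (f : T -> R) : continuous f ->
  measurable_fun [set: borel A n] (f : borel A n -> R).
Proof.
move=> cf; apply: measurable_gt_fun => // a; rewrite setTI; apply: borel_open.
have := iffLR (@continuousP T R f) cf [set x | a < x]; apply; exact: open_gt.
Qed.

End Borel.

Section Norms.
Variable R : realType.

Lemma mx_norm_le m n (W : 'M[R]_(m, n)) (a : R) : 0 <= a ->
  (`|W| <= a) <-> (forall i j, `|W i j| <= a).
Proof.
move=> a0; rewrite -[`|W|]/(mx_norm W) mx_normrE; split=> [Wa i j|Wa].
  by apply: le_trans Wa; exact: (le_bigmax _ (fun ij : 'I_m * 'I_n => `|W ij.1 ij.2|) (i, j)).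
by apply: bigmax_le => // -[i j] _; exact: Wa.
Qed.

Lemma compact_cube d (c : 'rV[R]_d) (a : R) : 0 <= a -> compact [set y | `|y - c| <= a].
Proof.
move=> a0.
have -> : [set y | `|y - c| <= a] =
    (fun y => y + c) @` [set W : 'rV[R]_d | forall i j, `|W i j| <= a].
  apply/seteqP; split=> [y yc|_ [y ya <-]].
    by exists (y - c); [apply/mx_norm_le|rewrite subrK].
  by rewrite /= addrK; apply/mx_norm_le.
apply: continuous_compact; last exact: compact_mx_box.
apply: continuous_subspaceT => y.
by apply: (@cvgD _ _ _ (nbhs y) _ id (cst c)); [exact: cvg_id|exact: cvg_cst].
Qed.

End Norms.

(** * A finite Borel choice of coordinates *)

Section Cover.
Context {R : realType} {d : nat} {M : ptopologicalType} {A : smooth_atlas R d M}.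
Variable C : cubic_cover A.
Hypothesis hM : hausdorff_space M.

Definition cell (k : 'I_(csize C)) : set M :=
  [set x | dom (cidx k) x /\ `|chart (cidx k) x - center k| <= radius k].

Definition cube (k : 'I_(csize C)) (a : R) : set 'rV[R]_d :=
  [set y | `|y - center k| <= a * radius k].

Lemma cube_compact k a : 0 <= a -> compact (cube k a).
Proof. by move=> a0; apply: compact_cube; rewrite mulr_ge0 // ltW // radius_gt0. Qed.

Lemma cube_cod k a : a <= 2 -> cube k a `<=` cod (cidx k).
Proof.
move=> a2 y ya; apply: double_cod; apply: le_trans ya _.
by rewrite ler_wpM2r // ltW // radius_gt0.
Qed.

Lemma par_cube_closed k a : 0 <= a <= 2 -> closed (par (cidx k) @` cube k a).
Proof.
move=> /andP[a0 a2]; apply: compact_closed => //.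
apply: continuous_compact; last exact: cube_compact.
apply: continuous_in_subspaceT => y /set_mem ya; apply: par_at.
exact: cube_cod ya.
Qed.

(** Writing a cell as a compact image shows that it is closed. *)
Lemma cellE k : cell k = par (cidx k) @` cube k 1.
Proof.
apply/seteqP; split=> [x [kx xr]|_ [y y1 <-]].
  by exists (chart (cidx k) x); rewrite /cube /= ?mul1r // chartK.
have ky : cod (cidx k) y by apply: cube_cod y1; rewrite ler1n.
by split; [exact: dom_par|rewrite parK //; move: y1; rewrite /cube /= mul1r].
Qed.

Lemma cell_closed k : closed (cell k).
Proof. by rewrite cellE; apply: par_cube_closed; rewrite ler01 ler1n. Qed.

(** The least index of a cell that contains [x]: a choice for which the set of
    points with a given value is a difference of closed sets, hence Borel. *)
Lemma first_cell x : exists k, cell k x /\ forall k' : 'I_(csize C), (k' < k)%N -> ~ cell k' x.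
Proof.
have [k kx] := cover_all C x.
have ex : exists m, [exists k : 'I_(csize C), (val k == m) && `[< cell k x >]].
  by exists (val k); apply/existsP; exists k; rewrite eqxx; apply/asboolP.
case: (ex_minnP ex) => m /existsP[k0 /andP[/eqP <- /asboolP k0x]] mmin.
exists k0; split => // k' k'k0 k'x; move: k'k0; rewrite ltnNge => /negP; apply.
by apply: mmin; apply/existsP; exists k'; rewrite eqxx; apply/asboolP.
Qed.

Definition chosen x : 'I_(csize C) := projT1 (cid (first_cell x)).

Lemma chosen_cell x : cell (chosen x) x.
Proof. by rewrite /chosen; case: cid => k []. Qed.

Lemma chosenP x k : chosen x = k <-> cell k x /\ forall k' : 'I_(csize C), (k' < k)%N -> ~ cell k' x.
Proof.
rewrite /chosen; case: cid => k0 /= [k0x k0m]; split=> [<-//|[kx km]].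
apply/val_inj; case: (ltngtP k0 k) => // [/km|/k0m] //.
Qed.

Definition chosen_idx x : idx A := cidx (chosen x).

Lemma dom_chosen x : dom (chosen_idx x) x.
Proof. by have [] := chosen_cell x. Qed.

Section Bundle.
Variable n : nat.
Notation T := (tangent A n).
Notation Z := ('rV[R]_d * 'M[R]_(n, d))%type.

(** The chosen chart trivializes the bundle over each piece: [pos p] and [fib p] are
    the coordinates of [p], and [with_fib p W] moves [p] in its fibre. *)
Definition pos (p : T) : 'rV[R]_d := chart (chosen_idx (base p)) (base p).
Definition fib (p : T) : 'M[R]_(n, d) := vec p *m to_chart (chosen_idx (base p)) (base p).
Definition with_fib (p : T) (W : 'M[R]_(n, d)) : T := tpar (chosen_idx (base p)) (pos p, W).
Definition piece k : set (borel A n) := [set p : T | chosen (base p) = k].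

Lemma cod_pos p : cod (chosen_idx (base p)) (pos p).
Proof. exact: cod_chart (dom_chosen _). Qed.

Lemma par_pos p : par (chosen_idx (base p)) (pos p) = base p.
Proof. exact: chartK (dom_chosen _). Qed.

Lemma with_fibK p : with_fib p (fib p) = p.
Proof. exact: (tchartK (dom_chosen (base p))). Qed.

Lemma base_with_fib p W : base (with_fib p W) = base p.
Proof. exact: par_pos. Qed.

Lemma vec_with_fib p W : vec (with_fib p W) = W *m of_chart (chosen_idx (base p)) (base p).
Proof. by rewrite /with_fib /= par_pos. Qed.

Lemma pos_with_fib p W : pos (with_fib p W) = pos p.
Proof. by rewrite /pos base_with_fib. Qed.

Lemma fib_with_fib p W : fib (with_fib p W) = W.
Proof.
have ofK := of_chartK (dom_chosen (base p)).
by rewrite /fib base_with_fib vec_with_fib -mulmxA ofK mulmx1.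
Qed.

Lemma with_fib_with p W W' : with_fib (with_fib p W) W' = with_fib p W'.
Proof. by rewrite /with_fib pos_with_fib base_with_fib. Qed.

Lemma pos_cube p : cube (chosen (base p)) 1 (pos p).
Proof. by have [_] := chosen_cell (base p); rewrite /cube /= mul1r. Qed.

Lemma piece_measurable k : measurable (piece k).
Proof.
have mc k' : measurable ([set p : T | cell k' (base p)] : set (borel A n)).
  rewrite -[X in measurable X]setCK; apply: measurableC; apply: borel_open.
  have /closed_openC oC := @cell_closed k'.
  exact: (iffLR (@continuousP T M _) (@base_continuous _ _ _ A n) _ oC).
have -> : piece k = [set p : T | cell k (base p)] `\`
    \bigcup_(k' in [set k' : 'I_(csize C) | (k' < k)%N]) [set p : T | cell k' (base p)].
  apply/seteqP; split=> p.
    by move=> /chosenP[kp km]; split => // -[k' /= k'k]; exact: km.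
  by move=> [kp km]; apply/chosenP; split => // k' k'k k'p; apply: km; exists k'.
apply: measurableD => //; apply: fin_bigcup_measurable; first exact: finite_finset.
by move=> k' _; exact: mc.
Qed.

Lemma measurable_pieces (dY : measure_display) (Y : measurableType dY) (F : borel A n -> Y) :
  (forall k, measurable_fun (piece k) F) -> measurable_fun setT F.
Proof.
apply: measurable_finite_pieces; first exact: piece_measurable.
by move=> p; exists (chosen (base p)).
Qed.

(** The chosen chart jumps from one piece to the next, but on a piece it is one
    fixed chart, and there are finitely many pieces. *)
Lemma measurable_chartwise (G : idx A -> Z -> R) :
  (forall i z, tcod i z -> {for z, continuous (G i)}) ->
  measurable_fun setT (fun p : borel A n => G (chosen_idx (base p)) (pos p, fib p)).
Proof.
move=> cG; apply: measurable_pieces => k.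
apply: (eq_measurable_fun (fun p : borel A n => G (cidx k) (tchart (cidx k) p))).
  by move=> p /set_mem pk; rewrite /pos /fib /chosen_idx pk.
apply: measurable_tchart; [exact: piece_measurable| |exact: cG].
by move=> p <-; exact: dom_chosen.
Qed.

Lemma measurable_fib j l : measurable_fun setT (fun p : borel A n => fib p j l).
Proof.
apply: (measurable_chartwise (G := fun _ z => z.2 j l)) => _ z _.
apply: (@continuous_comp _ _ _ snd (fun W : 'M[R]_(n, d) => W j l)); first exact: cvg_snd.
exact: coord_continuous.
Qed.

Lemma measurable_pos l : measurable_fun setT (fun p : borel A n => pos p 0 l).
Proof.
apply: (measurable_chartwise (G := fun _ z => z.1 0 l)) => _ z _.
apply: (@continuous_comp _ _ _ fst (fun y : 'rV[R]_d => y 0 l)); first exact: cvg_fst.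
exact: coord_continuous.
Qed.

(** Over one piece [with_fib] is a continuous parametrization composed with the
    measurable coordinates [pos] and [W]. *)
Lemma measurable_with_fib (W : T -> 'M[R]_(n, d)) :
  (forall j l, measurable_fun setT (fun p : borel A n => W p j l)) ->
  measurable_fun setT (fun p : borel A n => with_fib p (W p) : borel A n).
Proof.
move=> mW; apply: measurable_pieces => k; apply: measurable_to_borel => B oB.
have EW (p : T) : chosen (base p) = k -> with_fib p (W p) = tpar (cidx k) (pos p, W p).
  by move=> pk; rewrite /with_fib /chosen_idx pk.
have := @measurable_open_preimage R d n _ (borel A n) (piece k) pos W
  (@tcod _ _ _ A n (cidx k) `&` @tpar _ _ _ A n (cidx k) @^-1` B) (piece_measurable k).
move=> /(_ (fun l => measurable_funTS (measurable_pos l)) (fun j l => measurable_funTS (mW j l)) (oB _)).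
congr measurable; apply/seteqP; split=> p [pk].
  move=> [_ Bp]; split; first exact: pk.
  have Bp' : B (tpar (cidx k) (pos p, W p)) := Bp.
  by rewrite -(EW p pk) in Bp'.
move=> Bp; split; first exact: pk.
have Bp' : B (with_fib p (W p)) := Bp.
rewrite (EW p pk) in Bp'; split; last exact: Bp'.
have <- : chosen_idx (base p) = cidx k by rewrite /chosen_idx pk.
exact: cod_pos.
Qed.

(** The complement of the support is null, since the topology has a countable base. *)
Lemma supp_null (mu : {measure set (borel A n) -> \bar R}) :
  measurable (supp mu) /\ mu (~` supp mu) = 0%E.
Proof.
pose B (kq : 'I_(csize C) * @box_index d n) : set T :=
  [set p | dom (cidx kq.1) (base p) /\ box kq.2 (tchart (cidx kq.1) p)].
have oB kq : open (B kq) by apply: tchart_open; exact: box_open.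
pose F (m : nat) : set (borel A n) :=
  if unpickle m is Some kq then if mu (B kq) == 0%E then B kq else set0 else set0.
have E : ~` supp mu = \bigcup_m F m.
  apply/seteqP; split=> p.
    move=> /existsNP[B0 /not_implyP[oO /not_implyP[Op mO]]].
    have mB0 : mu B0 = 0%E.
      by apply/eqP; rewrite -measure_le0 leNgt; apply/negP.
    pose k := chosen (base p).
    have [|q qp qO] := @box_basis R d n (tchart (cidx k) p)
        (@tcod _ _ _ A n (cidx k) `&` @tpar _ _ _ A n (cidx k) @^-1` B0).
      apply: open_nbhs_nbhs; split; first exact: oO.
      split; first exact: cod_pos.
      by rewrite /= (tchartK (dom_chosen (base p))).
    have BO : B (k, q) `<=` B0.
      by move=> p' [/= kp' /qO[_ /=]]; rewrite tchartK.
    exists (pickle (k, q)) => //; rewrite /F pickleK.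
    have -> : mu (B (k, q)) == 0%E.
      rewrite -measure_le0 -mB0; apply: le_measure; last exact: BO.
        by apply: mem_set; apply: borel_open; exact: oB.
      by apply: mem_set; exact: borel_open.
    by split; first exact: dom_chosen.
  move=> [m _]; rewrite /F; case: unpickle => [kq|//].
  by case: eqP => // mB Bp /(_ _ (oB kq) Bp); rewrite mB ltxx.
have mF m : measurable (F m).
  rewrite /F; case: unpickle => [kq|]; last exact: measurable0.
  by case: ifP => _; [exact: borel_open|exact: measurable0].
have mC : measurable (~` supp mu) by rewrite E; exact: bigcupT_measurable.
split; first by rewrite -[supp mu]setCK; exact: measurableC.
apply/negligibleP => //; rewrite E; apply: negligible_bigcup => m.
rewrite /F; case: unpickle => [kq|]; last exact: negligible_set0.
case: eqP => [B0|_]; last exact: negligible_set0.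
by apply/negligibleP => //; exact: borel_open.
Qed.

End Bundle.
End Cover.

(** * Exact forms that are coordinate forms on a cell *)

Lemma cvg_dist (R : realType) (d : nat) (c y : 'rV[R]_d) : `|z - c| @[z --> y] --> `|y - c|.
Proof.
have cd : (z - c) @[z --> y] --> y - c.
  exact: (@cvgD _ 'rV[R]_d _ (nbhs y) _ id (cst (- c)) _ _ cvg_id (cvg_cst _)).
exact: cvg_norm cd.
Qed.

Section Special_forms.
Context {R : realType} {d : nat} {M : ptopologicalType} {A : smooth_atlas R d M}.
Variable C : cubic_cover A.
Hypothesis hM : hausdorff_space M.

Notation ck := (@cidx _ _ _ _ C).

(** The arguments of the steps are 1 at distance 5/4 and 0 at distance 7/4 from the
    center, in units of the radius; both distances are strictly between those of
    the cell and of the doubled cube. *)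
Definition bump (k : 'I_(csize C)) (y : 'rV[R]_d) : R :=
  \prod_l (smooth_step (7 / 2 - 2 * ((y 0 l - center k 0 l) / radius k)) *
           smooth_step (7 / 2 + 2 * ((y 0 l - center k 0 l) / radius k))).

Lemma bump1 k y : `|y - center k| <= 5 / 4 * radius k -> bump k y = 1.
Proof.
move=> yc; rewrite /bump big1 // => l _.
have r0 := radius_gt0 k.
have : `|y 0 l - center k 0 l| <= 5 / 4 * radius k.
  have a0 : 0 <= 5 / 4 * radius k by rewrite mulr_ge0 ?ltW //; lra.
  by have := (iffLR (mx_norm_le _ a0) yc) 0 l; rewrite !mxE.
set t := (y 0 l - center k 0 l) / radius k => yr.
have : `|t| <= 5 / 4 by rewrite normrM normfV (gtr0_norm r0) ler_pdivrMr.
rewrite ler_norml => /andP[h1 h2].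
by rewrite !smooth_step1 ?mulr1 //; lra.
Qed.

Lemma bump0 k y : 7 / 4 * radius k < `|y - center k| -> bump k y = 0.
Proof.
move=> yc; have r0 := radius_gt0 k.
have a0 : 0 <= 7 / 4 * radius k by rewrite mulr_ge0 ?ltW //; lra.
have [l Hl] : exists l, 7 / 4 * radius k < `|y 0 l - center k 0 l|.
  apply: contrapT => /forallNP H; move: yc; rewrite ltNge => /negP; apply.
  apply/mx_norm_le => // i l; rewrite (ord1 i) !mxE leNgt; apply/negP; exact: H.
rewrite /bump (bigD1 l) //=; set t := (y 0 l - center k 0 l) / radius k.
have : 7 / 4 < `|t| by rewrite normrM normfV (gtr0_norm r0) ltr_pdivlMr.
rewrite ltr_normr => /orP[h|h].
  by rewrite smooth_step0 ?mul0r //; lra.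
by rewrite [X in _ * X * _]smooth_step0 ?mulr0 ?mul0r //; lra.
Qed.

Lemma Ck_bump_comp (V : normedModType R) m (U : set V) k (f : V -> 'rV[R]_d) : open U ->
  (forall l, Ck_on m U (fun x => f x 0 l)) -> Ck_on m U (fun x => bump k (f x)).
Proof.
move=> oU cf; apply: Ck_prod => // l _.
have caff (a b : R) : Ck_on m U (fun x => a + b * ((f x 0 l - center k 0 l) / radius k)).
  have c0 (c : R) := @Ck_cst R V R m U c.
  apply: (Ck_D (c0 a)) => //; apply: (Ck_M (c0 b)) => //.
  exact: (Ck_M (Ck_D (cf l) (c0 (- center k 0 l)) oU) (c0 (radius k)^-1) oU).
have E x : 7 / 2 - 2 * ((f x 0 l - center k 0 l) / radius k) =
  7 / 2 + (-2) * ((f x 0 l - center k 0 l) / radius k) by rewrite mulNr.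
apply: Ck_M => //; apply: Ck_comp_scalar => //; try exact: smooth_step_smooth.
by apply: (Ck_eq oU _ (caff (7 / 2) (- 2))) => x _; rewrite E.
Qed.

(** Away from the k-th chart [F] vanishes in a neighborhood, since the image of the
    cube is compact, hence closed. *)
Lemma smooth_extension (k : 'I_(csize C)) j (F : 'rV[R]_d -> R) :
  (forall y, cod j y -> ~ (par (ck k) @` cube k (7 / 4)) (par j y) -> F y = 0) ->
  smooth_on (overlap j (ck k)) F -> smooth_on (cod j) F.
Proof.
move=> F0 sF m; apply: Ck_local => y jy.
have [ky|nky] := pselect (dom (ck k) (par j y)).
  by exists (overlap j (ck k)); [split|exact: sF].
have clK : closed (par (ck k) @` cube k (7 / 4)).
  by apply: par_cube_closed => //; apply/andP; split; lra.
have oW := @par_preimage_open _ _ _ A j _ (closed_openC clK).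
exists (cod j `&` par j @^-1` ~` (par (ck k) @` cube k (7 / 4))).
  split=> // -[y' y'c E]; apply: nky; rewrite -E; apply: dom_par.
  by apply: cube_cod y'c; lra.
apply: (Ck_eq oW _ (@Ck_cst _ _ _ m _ (0 : R))) => y' [jy' ny'] /=.
by rewrite F0.
Qed.

Variable m : nat.

Definition tail (I : {ffun 'I_m.+1 -> 'I_d}) : {ffun 'I_m -> 'I_d} :=
  [ffun a => I (lift ord0 a)].

(** A cut-off of [y_(I 0) dy_(I 1) /\ ... /\ dy_(I m)] in the k-th chart. It makes
    every coordinate form of degree [m.+1] exact on the k-th cell. *)
Definition coord_form k (I : {ffun 'I_m.+1 -> 'I_d}) (p : tangent A m) : R :=
  if `[< dom (ck k) (base p) >] then
    let z := tchart (ck k) p in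
    bump k z.1 * z.1 0 (I ord0) * \det (colsub (tail I) z.2)
  else 0.

Lemma coord_form_tpar k I j y W : overlap j (ck k) y ->
  coord_form k I (tpar j (y, W)) = bump k (trans j (ck k) y) *
    trans j (ck k) y 0 (I ord0) * \det (colsub (tail I) (W *m Jtrans j (ck k) y)).
Proof.
move=> jk; rewrite /coord_form asboolT; last by case: jk.
by have -> := tchart_tpar (i := j) (j := ck k) (z := (y, W)) jk.
Qed.

Lemma coord_form_Omega k I : Omega A m (coord_form k I).
Proof.
split.
- move=> p j a u u'; rewrite /coord_form !set_vecE /=.
  case: asboolP => _; last by rewrite mulr0 addr0.
  rewrite mulrCA -mulrDr; congr (_ * _).
  have := @det_row_linear R m d (to_chart (ck k) (base p) *m select R (tail I)).
  by move=> /(_ (vec p) j a u u'); rewrite !mulmxA -!colsub_select.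
- move=> p j j' jj' pj; rewrite /coord_form; case: asboolP => // _.
  have := @det_row_alternating R m d (to_chart (ck k) (base p) *m select R (tail I)).
  by move=> /(_ (vec p) j j' jj' pj); rewrite !mulmxA -!colsub_select /= => ->; rewrite mulr0.
move=> j W; apply: (@smooth_extension k).
  move=> y jy nK; rewrite /coord_form; case: asboolP => // ky.
  have jk : overlap j (ck k) y by split.
  rewrite (tchart_tpar (i := j) (j := ck k) (z := (y, W)) jk) bump0 ?mul0r //=.
  rewrite ltNge; apply/negP => le; apply: nK; exists (trans j (ck k) y) => //.
  exact: par_trans.
move=> q; have oO := @overlap_open _ _ _ A j (ck k).
have ct l : Ck_on q (overlap j (ck k)) (fun y => trans j (ck k) y 0 l).
  exact: trans_coord_smooth.
have cD : Ck_on q (overlap j (ck k)) (fun y => \det (\matrix_(a, b) \sum_c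
    W a c * 'D_(delta_mx 0 c) (fun y => trans j (ck k) y 0 (tail I b)) y)).
  apply: Ck_det => // a b; apply: Ck_sum => // c _.
  apply: (Ck_M (@Ck_cst _ _ _ q _ (W a c : R))) => //.
  apply: smooth_derive; exact: trans_coord_smooth.
have := Ck_M (Ck_M (Ck_bump_comp k oO ct) (ct (I ord0)) oO) cD oO.
apply: (Ck_eq oO) => y jk; rewrite coord_form_tpar //; congr (_ * \det _).
apply/matrixP => a b; rewrite !mxE; apply: eq_bigr => c _; congr (_ * _).
by rewrite Jtrans_entry.
Qed.

Lemma coord_form_extd k I (p : tangent A m.+1) : cell k (base p) ->
  extd (n := m.+1) (coord_form k I) p = \det (colsub I (tchart (ck k) p).2).
Proof.
move=> kp; have kdom := kp.1.
set y := (tchart (ck k) p).1; set W := (tchart (ck k) p).2.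
have ky : cod (ck k) y by exact: cod_chart.
have pE : p = tpar (ck k) (y, W) by rewrite -[LHS](tchartK kdom) -surjective_pairing.
rewrite {1}pE (extd_chart (coord_form_Omega k I) W ky).
pose f1 (y' : 'rV[R]_d) : R := y' 0 (I ord0).
have coefE (J : {ffun 'I_m -> 'I_d}) : \near y, f1 y * \det (colsub (tail I) (frame R J)) =
    coef (coord_form k I) (ck k) J y.
  have nc : nbhs y (cod (ck k)) by apply: open_nbhs_nbhs; split => //; exact: cod_open.
  have nb : nbhs y [set z : 'rV[R]_d | `|z - center k| < 5 / 4 * radius k].
    have yr : `|y - center k| < 5 / 4 * radius k.
      by apply: le_lt_trans kp.2 _; rewrite ltr_pMl ?radius_gt0 //; lra.
    have cc : (fun z : 'rV[R]_d => `|z - center k|) @ y --> `|y - center k|.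
      exact: cvg_dist.
    by move: cc => /cvgr_lt/(_ _ yr).
  apply: filterS2 nc nb => y' cy' by'.
  rewrite /coef coord_form_tpar; last by split => //; exact: dom_par.
  have -> : trans (ck k) (ck k) y' = y' by rewrite /trans /= parK.
  by rewrite bump1 ?mul1r ?ltW // Jtrans_id // mulmx1.
have dcoef (J : {ffun 'I_m -> 'I_d}) (v : 'rV[R]_d) :
    'D_v (coef (coord_form k I) (ck k) J) y = v 0 (I ord0) * \det (colsub (tail I) (frame R J)).
  rewrite -(near_eq_derive v (coefE J)).
  have d1 : derivable f1 y v.
    apply: diff_derivable; exact: differentiable_coord.
  have E : 'D_v f1 y = v 0 (I ord0).
    have := derive_mx (@derivable_id _ _ y v) => /(congr1 (fun w : 'rV[R]_d => w 0 (I ord0))).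
    by rewrite mxE derive_id.
  by rewrite -E mulrC; exact: (deriveMr (\det (colsub (tail I) (frame R J))) d1).
under eq_bigr => J _ do under eq_bigr => j _ do rewrite dcoef mxE.
rewrite exchange_big /= big_distrr /=.
rewrite [RHS](expand_det_col _ ord0); apply: eq_bigr => j _.
have alt : row_alternating (fun X : 'M[R]_(m, d) => \det (colsub (tail I) X)).
  by move=> X a b ab Xab; rewrite colsub_select; exact: (det_row_alternating _ ab).
have lin : row_linear (fun X : 'M[R]_(m, d) => \det (colsub (tail I) X)).
  by move=> X a b u u'; rewrite !colsub_select; exact: det_row_linear.
rewrite /cofactor addn0 mxE.
have -> : row' j (col' ord0 (colsub I W)) = colsub (tail I) (row' j W).
  by apply/matrixP => a b; rewrite !mxE ffunE.
rewrite (alternating_expand lin alt (row' j W)) !mulrA big_distrr /= big_distrr /=.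
apply: eq_bigr => J _; rewrite -!mulrA mulrCA [RHS]mulrCA; congr (_ * _).
by rewrite [RHS]mulrCA [colsub I W j ord0]mxE /W /= [X in _ = _ * (X * _)]mxE.
Qed.

End Special_forms.

(** * Fibre derivatives and the metric in coordinates *)

Section Fibre_derivative.
Context {R : realType} {d : nat} {M : ptopologicalType} {A : smooth_atlas R d M}.
Variables (C : cubic_cover A) (n : nat).
Notation T := (tangent A n).
Notation Z := ('rV[R]_d * 'M[R]_(n, d))%type.
Notation ci p := (chosen_idx C (base p)).
Implicit Types (p : T) (W H : 'M[R]_(n, d)) (f : T -> R).

(** The differential of [f] along the fibre, as a matrix of partial derivatives with
    respect to the coordinates [fib]. Unlike the gradient it does not involve the
    metric. *)
Definition fdiff f p : 'M[R]_(n, d) :=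
  \matrix_(j, l) 'D_((0, delta_mx j l) : Z) (f \o @tpar _ _ _ A n (ci p)) (pos C p, fib C p).

Definition mdot (U W : 'M[R]_(n, d)) : R := \sum_j \sum_l U j l * W j l.

Lemma derive_fibre (F : Z -> R) z H : differentiable F z ->
  'D_((0, H) : Z) F z = \sum_j \sum_l H j l * 'D_((0, delta_mx j l) : Z) F z.
Proof.
move=> dF; rewrite (deriveE _ dF).
pose L H : R := 'd F z ((0, H) : Z).
have LD : {morph L : H1 H2 / H1 + H2}.
  move=> H1 H2; rewrite /L -linearD; congr ('d F z _).
  by rewrite -[RHS]/(0 + 0, H1 + H2) addr0.
have LZ a H1 : L (a *: H1) = a * L H1.
  rewrite /L -[RHS]/(_ *: _) -linearZ; congr ('d F z _).
  by rewrite -[RHS]/(a *: 0, a *: H1) scaler0.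
have L0 : L 0 = 0 by rewrite -(scale0r (0 : 'M[R]_(n, d))) LZ mul0r.
rewrite -/(L H) {1}(matrix_sum_delta H) (big_morph L LD L0); apply: eq_bigr => j _.
rewrite (big_morph L LD L0); apply: eq_bigr => l _.
by rewrite LZ /L -(deriveE _ dF).
Qed.

Lemma fdiff_with_fib f p W j l : fdiff f (with_fib C p W) j l =
  'D_((0, delta_mx j l) : Z) (f \o @tpar _ _ _ A n (ci p)) (pos C p, W).
Proof. by rewrite mxE base_with_fib pos_with_fib fib_with_fib. Qed.

Lemma is_derive_with_fib f p W H (t : R) : smooth_fun f ->
  is_derive t 1 (fun s : R => f (with_fib C p (W + s *: H)))
    (mdot H (fdiff f (with_fib C p (W + t *: H)))).
Proof.
move=> sf; have ip := cod_pos C p.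
pose F : Z -> R := f \o @tpar _ _ _ A n (ci p).
have lineE (s : R) : ((pos C p, W) : Z) + s *: ((0, H) : Z) = (pos C p, W + s *: H).
  by rewrite -[LHS]/(pos C p + s *: 0, W + s *: H) scaler0 addr0.
have dF : differentiable F (pos C p, W + t *: H).
  apply: smooth_differentiable (sf (ci p)) _; exact: ip.
have := @is_derive_line R _ F (pos C p, W) (0, H) t.
rewrite lineE => /(_ (diff_derivable dF)).
rewrite (derive_fibre H dF) => dl.
have -> : mdot H (fdiff f (with_fib C p (W + t *: H))) =
    \sum_j \sum_l H j l * 'D_((0, delta_mx j l) : Z) F (pos C p, W + t *: H).
  by apply: eq_bigr => j _; apply: eq_bigr => l _; rewrite fdiff_with_fib.
have E : (fun s : R => f (with_fib C p (W + s *: H))) = (fun s : R => F ((pos C p, W) + s *: (0, H))).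
  by apply/funext => s; rewrite lineE.
by rewrite E.
Qed.

(** In each row [f] is affine along lines, so its partial derivative is its value
    with that row replaced by a basis vector. *)
Lemma fdiff_row_linear f p : smooth_fun f -> row_linear (fun W => f (with_fib C p W)) ->
  forall j l, fdiff f p j l = f (with_fib C p (setrow (fib C p) j (delta_mx 0 l))).
Proof.
move=> sf fL j l.
have := is_derive_with_fib p (fib C p) (delta_mx j l) 0 sf.
rewrite scale0r addr0 with_fibK => -[_].
have -> : (fun s : R => f (with_fib C p (fib C p + s *: delta_mx j l))) =
    (fun s : R => f p + s * f (with_fib C p (setrow (fib C p) j (delta_mx 0 l)))).
  apply/funext => s.
  have -> : fib C p + s *: delta_mx j l = setrow (fib C p) j (row j (fib C p) + s *: delta_mx 0 l).
    apply/matrixP => a b; rewrite !mxE eqxx /=; case: (eqVneq a j) => [->|] //=.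
    by rewrite mulr0 addr0.
  by have := row_linear_shift fL (fib C p) j s (delta_mx 0 l); rewrite with_fibK.
set c := f (with_fib _ _ _).
have dc : is_derive (0 : R) (1 : R) (fun s : R => f p + s * c) c.
  have := is_deriveD (is_derive_cst (f p) (0 : R) (1 : R))
    (is_deriveM (is_derive_id (0 : R) (1 : R)) (is_derive_cst c (0 : R) (1 : R))).
  by move=> dd; apply: is_derive_eq dd _; rewrite scaler0 add0r add0r -[LHS]/(c * 1) mulr1.
have [_ ->] := dc; move=> ->; 
rewrite /mdot (bigD1 j) //= (bigD1 l) //= [delta_mx j l j l]mxE !eqxx mul1r.
rewrite big1 => [|b bl]; last by rewrite [delta_mx j l j b]mxE (negPf bl) andbF mul0r.
rewrite big1 ?addr0 // => a aj; rewrite big1 // => b _.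
by rewrite [delta_mx j l a b]mxE (negPf aj) mul0r.
Qed.

Lemma set_vec_with_fib p j (t : R) (v : 'rV[R]_d) :
  set_vec p j (row j (vec p) + t *: (v *m of_chart (ci p) (base p))) =
  with_fib C p (fib C p + t *: (\matrix_(a, b) if a == j then v 0 b else 0)).
Proof.
have E : vec p = fib C p *m of_chart (ci p) (base p).
  by rewrite -vec_with_fib with_fibK.
rewrite set_vecE E row_mul scalemxAl -mulmxDl -mulmx_setrow.
rewrite /with_fib /tpar /= par_pos; congr (Tangent _ _ (_ *m _)).
by apply/matrixP => a b; rewrite !mxE; case: eqP => [->|] //; rewrite mulr0 addr0.
Qed.

Lemma derive_set_vec f p j (v : 'rV[R]_d) : smooth_fun f ->
  derive1 (fun t : R => f (set_vec p j (row j (vec p) + t *: (v *m of_chart (ci p) (base p))))) 0 =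
  \sum_l v 0 l * fdiff f p j l.
Proof.
move=> sf; rewrite derive1E; pose H : 'M[R]_(n, d) := \matrix_(a, b) if a == j then v 0 b else 0.
have [_] := is_derive_with_fib p (fib C p) H 0 sf.
rewrite scale0r addr0 with_fibK.
have -> : (fun t : R => f (set_vec p j (row j (vec p) + t *: (v *m of_chart (ci p) (base p))))) =
    (fun s : R => f (with_fib C p (fib C p + s *: H))).
  by apply/funext => s; rewrite set_vec_with_fib.
move=> ->; rewrite /mdot (bigD1 j) //= [X in _ + X]big1 ?addr0; last first.
  by move=> a aj; rewrite big1 // => b _; rewrite [H a b]mxE (negPf aj) mul0r.
by apply: eq_bigr => l _; rewrite [H j l]mxE eqxx.
Qed.

End Fibre_derivative.

Section Metric.
Context {R : realType} {d : nat} {M : ptopologicalType} {A : smooth_atlas R d M}.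
Variable g : riemannian A.
Implicit Types (i : idx A) (y : 'rV[R]_d).

Definition gram i y : 'M[R]_d :=
  \matrix_(a, b) g (par i y) (delta_mx 0 a *m of_chart i (par i y))
                             (delta_mx 0 b *m of_chart i (par i y)).

Lemma gram_smooth i a b : smooth_on (cod i) (fun y => gram i y a b).
Proof.
have := metric_smooth g i (delta_mx 0 a) (delta_mx 0 b).
by rewrite (_ : (fun y => gram i y a b) = (fun y => g (par i y) (delta_mx 0 a *m of_chart i (par i y))
   (delta_mx 0 b *m of_chart i (par i y)))) //; apply/funext => y; rewrite mxE.
Qed.

Lemma metric0 x v : g x 0 v = 0.
Proof.
have := metric_linear g x 1 0 0 v; rewrite scaler0 addr0 mul1r => /eqP.
by rewrite -subr_eq subrr eq_sym => /eqP.
Qed.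

Lemma metricD x u u' v : g x (u + u') v = g x u v + g x u' v.
Proof. by have := metric_linear g x 1 u u' v; rewrite scale1r mul1r. Qed.

Lemma metricZ x (a : R) u v : g x (a *: u) v = a * g x u v.
Proof. by have := metric_linear g x a u 0 v; rewrite metric0 !addr0. Qed.

Lemma metric_sum (I : Type) (r : seq I) (u : I -> 'rV[R]_d) x v :
  g x (\sum_(i <- r) u i) v = \sum_(i <- r) g x (u i) v.
Proof. by apply: (big_morph (fun u => g x u v)); [move=> u' u''; exact: metricD|exact: metric0]. Qed.

Lemma metric_gram i y (u v : 'rV[R]_d) :
  g (par i y) (u *m of_chart i (par i y)) (v *m of_chart i (par i y)) =
  \sum_a \sum_b u 0 a * v 0 b * gram i y a b.
Proof.
rewrite {1}(row_sum_delta u) mulmx_suml metric_sum; apply: eq_bigr => a _.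
rewrite -scalemxAl metricZ (Defs.metric_sym g) {1}(row_sum_delta v) mulmx_suml metric_sum big_distrr /=.
apply: eq_bigr => b _; rewrite -scalemxAl metricZ mulrA; congr (_ * _).
by rewrite mxE (Defs.metric_sym g).
Qed.

Lemma gram_sym i y a b : gram i y a b = gram i y b a.
Proof. by rewrite !mxE (Defs.metric_sym g). Qed.

Lemma gram_pos i y (u : 'rV[R]_d) : cod i y -> u != 0 ->
  0 < \sum_a \sum_b u 0 a * u 0 b * gram i y a b.
Proof.
move=> iy u0; rewrite -metric_gram; apply: metric_pos; apply: contra u0 => /eqP E.
have := of_chartK (dom_par iy) => /(congr1 (mulmx u)).
by rewrite mulmxA E mul0mx mulmx1 => <-.
Qed.

(** A vector in the kernel would have zero length. *)
Lemma gram_unit i y : cod i y -> gram i y \in unitmx.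
Proof.
move=> iy; rewrite -row_free_unit -kermx_eq0; apply/contraT => /rowV0Pn[v].
move=> /sub_kermxP vG v0; have := gram_pos iy v0.
rewrite exchange_big /= big1 ?ltxx // => b _.
have := congr1 (fun w : 'rV[R]_d => w 0 b) vG; rewrite !mxE => E.
rewrite (eq_bigr (fun a => v 0 b * (v 0 a * gram i y a b))); last by move=> a _; rewrite mulrCA mulrA.
by rewrite -big_distrr /= E mulr0.
Qed.

Section Gradient.
Variables (C : cubic_cover A) (n : nat).
Notation T := (tangent A n).
Notation ci p := (chosen_idx C (base p)).
Implicit Types (p : T) (f : T -> R).

Definition gram_at p : 'M[R]_d := gram (ci p) (pos C p).

Lemma metric_gram_at p (u v : 'rV[R]_d) :
  g (base p) (u *m of_chart (ci p) (base p)) (v *m of_chart (ci p) (base p)) =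
  \sum_a \sum_b u 0 a * v 0 b * gram_at p a b.
Proof. by have := metric_gram (ci p) (pos C p) u v; rewrite par_pos. Qed.

Lemma gram_at_unit p : gram_at p \in unitmx.
Proof. exact: gram_unit (cod_pos C p). Qed.

(** Raising an index: the defining equations of the gradient are the linear system
    with matrix [gram_at p] and right-hand side [fdiff C f p]. *)
Lemma vgradE f p : smooth_fun f ->
  vgrad g f p = fdiff C f p *m invmx (gram_at p) *m of_chart (ci p) (base p).
Proof.
move=> sf; set W0 := fdiff C f p *m invmx (gram_at p).
have Gsym : (gram_at p)^T = gram_at p by apply/matrixP => a b; rewrite mxE /gram_at gram_sym.
have isW W : is_vgrad g f p (W *m of_chart (ci p) (base p)) <-> W *m gram_at p = fdiff C f p.
  split=> [H|WG j u].
    apply/matrixP => j l; have := H j (delta_mx 0 l *m of_chart (ci p) (base p)).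
    rewrite row_mul metric_gram_at derive_set_vec // => E.
    have -> : fdiff C f p j l = \sum_l0 (delta_mx 0 l : 'rV[R]_d) 0 l0 * fdiff C f p j l0.
      rewrite (bigD1 l) //= [delta_mx 0 l 0 l]mxE !eqxx mul1r big1 ?addr0 // => b bl.
      by rewrite [delta_mx 0 l 0 b]mxE (negPf bl) andbF mul0r.
    rewrite -E mxE [RHS](bigD1 l) //= [X in _ = _ + X]big1 ?addr0; last first.
      by move=> a al; rewrite big1 // => b _; rewrite [delta_mx 0 l 0 a]mxE (negPf al) andbF !mul0r.
    apply: eq_bigr => b _; rewrite [delta_mx 0 l 0 l]mxE !eqxx mul1r [row j W 0 b]mxE; congr (_ * _).
    exact: gram_sym.
  have -> : u = (u *m to_chart (ci p) (base p)) *m of_chart (ci p) (base p).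
    by rewrite -mulmxA to_chartK ?mulmx1 //; exact: dom_chosen.
  move: (u *m to_chart _ _) => u'.
  rewrite row_mul metric_gram_at derive_set_vec //.
  apply: eq_bigr => a _; rewrite -WG [(W *m gram_at p) j a]mxE big_distrr /=.
  apply: eq_bigr => b _; rewrite -mulrA [row j W 0 b]mxE; congr (_ * (_ * _)).
  exact: gram_sym.
have W0ok : is_vgrad g f p (W0 *m of_chart (ci p) (base p)).
  by apply/isW; rewrite /W0 -mulmxA mulVmx ?mulmx1 // gram_at_unit.
have : is_vgrad g f p (vgrad g f p).
  apply: (@xgetPex _ 0 [set U | is_vgrad g f p U]); exact: (ex_intro _ _ W0ok).
set U := vgrad g f p.
have -> : U = (U *m to_chart (ci p) (base p)) *m of_chart (ci p) (base p).
  by rewrite -mulmxA to_chartK ?mulmx1 //; exact: dom_chosen.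
move=> /isW E; congr (_ *m _).
by rewrite /W0 -E -mulmxA mulmxV ?mulmx1 // gram_at_unit.
Qed.

End Gradient.
End Metric.

(** * Uniform bounds on fibre balls *)

Section Fibre_balls.
Context {R : realType} {d : nat} {M : ptopologicalType} {A : smooth_atlas R d M}.
Variables (C : cubic_cover A) (n : nat).
Notation T := (tangent A n).
Notation Z := ('rV[R]_d * 'M[R]_(n, d))%type.
Implicit Types (p : T) (f : T -> R).

Definition entries_le (W : 'M[R]_(n, d)) (b : R) := forall j l, `|W j l| <= b.

Definition fibre_box k (b : R) : set Z := [set z : Z | cube (C := C) k 1 z.1 /\ entries_le z.2 b].

Lemma fibre_box_compact k b : compact (fibre_box k b).
Proof.
have -> : fibre_box k b = cube k 1 `*` [set W : 'M[R]_(n, d) | forall j l, `|W j l| <= b] by [].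
by apply: compact_setX; [apply: cube_compact|exact: compact_mx_box].
Qed.

Lemma fibre_box_tcod k b : fibre_box k b `<=` @tcod _ _ _ A n (cidx k).
Proof. by move=> z [z1 _]; apply: (cube_cod (a := 1)) z1; rewrite ler1n. Qed.

Lemma fibre_boxP p b : entries_le (fib C p) b ->
  fibre_box (chosen C (base p)) b (pos C p, fib C p).
Proof. by split => //; exact: pos_cube. Qed.

(** [p] has coordinates in one of finitely many compact boxes. *)
Lemma bounded_chartwise (F : idx A -> Z -> R) b :
  (forall i z, tcod i z -> {for z, continuous (F i)}) ->
  exists2 B, 0 <= B & forall p, entries_le (fib C p) b ->
    `|F (chosen_idx C (base p)) (pos C p, fib C p)| <= B.
Proof.
move=> cF.
have bk (k : 'I_(csize C)) : exists B, 0 <= B /\ forall z, fibre_box k b z -> `|F (cidx k) z| <= B.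
  have : compact (F (cidx k) @` fibre_box k b).
    apply: continuous_compact; last exact: fibre_box_compact.
    apply: continuous_in_subspaceT => z /set_mem zb; apply: cF; exact: fibre_box_tcod zb.
  move=> /compact_bounded[B [_ HB]]; exists (`|B| + 1); split; first by rewrite addr_ge0.
  move=> z zb; apply: HB; last by exists z.
  by apply: le_lt_trans (ler_norm B) _; rewrite ltrDl.
have [B HB] := choice bk; exists (\sum_k B k) => [|p pb].
  by apply: sumr_ge0 => k _; case: (HB k).
apply: le_trans ((HB (chosen C (base p))).2 _ (fibre_boxP pb)) _.
by rewrite (bigD1 (chosen C (base p))) //= lerDl sumr_ge0 // => k _; case: (HB k).
Qed.

Lemma bounded_fib f b : smooth_fun f ->
  exists2 B, 0 <= B & forall p, entries_le (fib C p) b -> `|f p| <= B.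
Proof.
move=> sf; have [i z iz|B B0 HB] := @bounded_chartwise (fun i => f \o @tpar _ _ _ A n i) b.
  exact: smooth_continuous (sf i) iz.
by exists B => // p /HB; rewrite /= -[tpar _ _]/(with_fib C p (fib C p)) with_fibK.
Qed.

Lemma fdiff_chart f p j l : fdiff C f p j l =
  'D_((0, delta_mx j l) : Z) (f \o @tpar _ _ _ A n (chosen_idx C (base p))) (pos C p, fib C p).
Proof. by rewrite mxE. Qed.

Lemma continuous_fibre_derivative f i (j : 'I_n) (l : 'I_d) z : smooth_fun f -> tcod i z ->
  {for z, continuous ('D_((0, delta_mx j l) : Z) (f \o @tpar _ _ _ A n i))}.
Proof. move=> sf iz; have s1 := sf i.
have s2 := @smooth_derive _ _ _ _ _ ((0, delta_mx j l) : Z) s1.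
have := smooth_continuous s2 iz. exact.
Qed.

Lemma bounded_fdiff f b : smooth_fun f ->
  exists2 B, 0 <= B & forall p, entries_le (fib C p) b -> entries_le (fdiff C f p) B.
Proof.
move=> sf.
have bjl (jl : 'I_n * 'I_d) : exists B, 0 <= B /\
    forall p, entries_le (fib C p) b -> `|fdiff C f p jl.1 jl.2| <= B.
  have [i z iz|B B0 HB] := @bounded_chartwise
    (fun i => 'D_((0, delta_mx jl.1 jl.2) : Z) (f \o @tpar _ _ _ A n i)) b.
    exact: continuous_fibre_derivative.
  by exists B; split => // p /HB; rewrite fdiff_chart.
have [B HB] := choice bjl; exists (\sum_k B k) => [|p pb j l].
  by apply: sumr_ge0 => k _; case: (HB k).
apply: le_trans ((HB (j, l)).2 _ pb) _.
by rewrite (bigD1 (j, l)) //= lerDl sumr_ge0 // => k _; case: (HB k).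
Qed.

Lemma measurable_fdiff f j l : hausdorff_space M -> smooth_fun f ->
  measurable_fun setT (fun p : borel A n => fdiff C f p j l).
Proof.
move=> hM sf; apply: (eq_measurable_fun (fun p : borel A n =>
  (fun i => 'D_((0, delta_mx j l) : Z) (f \o @tpar _ _ _ A n i))
    (chosen_idx C (base p)) (pos C p, fib C p))).
  by move=> p _; rewrite fdiff_chart.
apply: (@measurable_chartwise _ _ _ _ C hM n ( fun i =>
  'D_((0, delta_mx j l) : Z) (f \o @tpar _ _ _ A n i))) => i z iz.
exact: continuous_fibre_derivative.
Qed.

Lemma measurable_smooth f : smooth_fun f -> measurable_fun [set: borel A n] (f : borel A n -> R).
Proof. by move=> /smooth_fun_continuous; exact: measurable_continuous. Qed.

Definition fibre_ball b : set T :=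
  \big[setU/set0]_(k < csize C) (@tpar _ _ _ A n (cidx k) @` fibre_box k b).

Lemma fibre_ball_compact b : compact (fibre_ball b).
Proof.
apply: bigsetU_compact => k _; apply: continuous_compact; last exact: fibre_box_compact.
apply: continuous_in_subspaceT => z /set_mem zb; apply: tpar_at; exact: fibre_box_tcod zb.
Qed.

Lemma fibre_ballP p b : entries_le (fib C p) b -> fibre_ball b p.
Proof.
move=> pb; rewrite /fibre_ball -bigcup_seq; exists (chosen C (base p)); first exact: mem_index_enum.
exists (pos C p, fib C p); first exact: fibre_boxP.
exact: (with_fibK C p).
Qed.

End Fibre_balls.

Section Metric_bounds.
Context {R : realType} {d : nat} {M : ptopologicalType} {A : smooth_atlas R d M}.
Variable g : riemannian A.

Lemma metricDr x u u' v : g x v (u + u') = g x v u + g x v u'.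
Proof. by rewrite !(Defs.metric_sym g x v) metricD. Qed.

Lemma metricZr x (a : R) u v : g x v (a *: u) = a * g x v u.
Proof. by rewrite !(Defs.metric_sym g x v) metricZ. Qed.

Lemma metric_ge0 x u : 0 <= g x u u.
Proof.
by have [->|u0] := eqVneq u 0; [rewrite metric0|rewrite ltW // metric_pos].
Qed.

(** Positivity at [u] minus its component along [v]. *)
Lemma metric_CS x u v : g x u v ^+ 2 <= g x u u * g x v v.
Proof.
have [->|v0] := eqVneq v 0.
  by rewrite (Defs.metric_sym g x u) !metric0 mulr0 expr0n.
have vv : 0 < g x v v := metric_pos g x v0.
have := metric_ge0 x (u + (- (g x u v / g x v v)) *: v).
rewrite metricD !metricDr !metricZ !metricZr (Defs.metric_sym g x v u).
set a := g x u v; set b := g x v v.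
have -> : g x u u + - (a / b) * a + (- (a / b) * a + - (a / b) * (- (a / b) * b)) =
   g x u u - a ^+ 2 / b.
  by field; rewrite gt_eqF.
by rewrite subr_ge0 ler_pdivrMr.
Qed.

Lemma invgram_smooth i a b : smooth_on (cod i) (fun y => invmx (gram g i y) a b).
Proof.
move=> q; have oc : open (cod i) by exact: cod_open.
have cg a' b' : Ck_on q (cod i) (fun y => gram g i y a' b') by exact: gram_smooth.
have E1 y : \det (\matrix_(a, b) gram g i y a b) = \det (gram g i y).
  by congr (\det _); apply/matrixP => s t; rewrite mxE.
have c1 : Ck_on q (cod i) (fun y => (\det (gram g i y))^-1).
  apply: Ck_V => //.
    by move=> y iy; have := gram_unit g iy; rewrite unitmxE unitfE.
  by apply: (Ck_eq oc _ (Ck_det oc cg)) => y _; rewrite E1.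
have c2 : Ck_on q (cod i) (fun y => (-1) ^+ (b + a) *
    \det (\matrix_(s < d.-1, t < d.-1) gram g i y (lift b s) (lift a t))).
  exact: (Ck_M (@Ck_cst _ _ _ q _ ((-1) ^+ (b + a) : R)) (Ck_det oc (fun s t => cg (lift b s) (lift a t))) oc).
apply: (Ck_eq oc _ (Ck_M c1 c2 oc)) => y iy.
rewrite /invmx (gram_unit g iy) !mxE /cofactor; congr (_ * (_ * \det _)).
by apply/matrixP => s t; rewrite !mxE.
Qed.

Section Bounds.
Variables (C : cubic_cover A) (n : nat).
Notation T := (tangent A n).
Notation Z := ('rV[R]_d * 'M[R]_(n, d))%type.
Notation ci p := (chosen_idx C (base p)).
Notation O p := (of_chart (chosen_idx C (base p)) (base p)).
Implicit Types (p : T).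

(** The rows of the inverse Gram matrix represent the coordinate functions, whence
    the coordinates are bounded by the length ([coord_metric_le]). *)
Lemma metric_invgram p a (u : 'rV[R]_d) :
  g (base p) (row a (invmx (gram_at g C p)) *m O p) (u *m O p) = u 0 a.
Proof.
rewrite metric_gram_at exchange_big /=.
have E b : \sum_c (row a (invmx (gram_at g C p))) 0 c * u 0 b * gram_at g C p c b = (a == b)%:R * u 0 b.
  have := mulVmx (gram_at_unit g C p) => /matrixP/(_ a b); rewrite !mxE => <-.
  by rewrite big_distrl /=; apply: eq_bigr => c _; rewrite mxE mulrAC.
under eq_bigr => b _ do rewrite E.
by rewrite (bigD1 a) //= eqxx mul1r big1 ?addr0 // => b ba; rewrite eq_sym (negPf ba) mul0r.
Qed.

Lemma metric_delta p a (u : 'rV[R]_d) :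
  g (base p) (u *m O p) (delta_mx 0 a *m O p) = (u *m gram_at g C p) 0 a.
Proof.
rewrite metric_gram_at mxE; apply: eq_bigr => b _.
rewrite (bigD1 a) //= [delta_mx _ _ _ _]mxE !eqxx mulr1 big1 ?addr0 // => c ca.
by rewrite [delta_mx _ _ _ _]mxE (negPf ca) andbF mulr0 mul0r.
Qed.

(** Only base points matter for the metric, so bounds over boxes of the fibre become
    bounds over all of the bundle when taken at the zero tuples. *)
Lemma with_fib0 p : entries_le (fib C (with_fib C p 0)) 0.
Proof. by move=> j l; rewrite fib_with_fib mxE normr0. Qed.

(** The chosen coordinates range over finitely many compact cubes, on which the Gram
    matrix and its inverse are continuous. *)
Lemma gram_bounded : exists2 B, 0 < B & forall p a b,
  `|gram_at g C p a b| <= B /\ `|invmx (gram_at g C p) a b| <= B.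
Proof.
have bnd (F : idx A -> 'rV[R]_d -> R) : (forall i, smooth_on (cod i) (F i)) ->
    exists B, 0 <= B /\ forall p : T, `|F (ci p) (pos C p)| <= B.
  move=> sF; have [i z iz|B B0 HB] := @bounded_chartwise R d M A C n (fun i z => F i z.1) 0.
    by apply: (@continuous_comp _ _ _ fst (F i)); [exact: cvg_fst|exact: (smooth_continuous (sF i) iz)].
  exists B; split => // p; have := HB _ (with_fib0 p).
  by rewrite base_with_fib pos_with_fib.
have [B1 H1] := choice (fun ab : 'I_d * 'I_d => bnd _ (fun i => @gram_smooth _ _ _ _ g i ab.1 ab.2)).
have [B2 H2] := choice (fun ab : 'I_d * 'I_d => bnd _ (fun i => @invgram_smooth i ab.1 ab.2)).
have s1 : 0 <= \sum_ab B1 ab by apply: sumr_ge0 => ab _; case: (H1 ab).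
have s2 : 0 <= \sum_ab B2 ab by apply: sumr_ge0 => ab _; case: (H2 ab).
exists (1 + \sum_ab B1 ab + \sum_ab B2 ab); first by lra.
move=> p a b; split.
  have [_ /(_ p) /= h] := H1 (a, b).
  suff : B1 (a, b) <= \sum_ab B1 ab by rewrite /gram_at; lra.
  by rewrite (bigD1 (a, b)) //= lerDl sumr_ge0 // => ab _; case: (H1 ab).
have [_ /(_ p) /= h] := H2 (a, b).
suff : B2 (a, b) <= \sum_ab B2 ab by rewrite /gram_at; lra.
by rewrite (bigD1 (a, b)) //= lerDl sumr_ge0 // => ab _; case: (H2 ab).
Qed.

Lemma coord_metric_le : exists2 B, 0 < B & forall p a (u : 'rV[R]_d),
  u 0 a ^+ 2 <= B * g (base p) (u *m O p) (u *m O p).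
Proof.
have [B B0 HB] := gram_bounded; exists B => // p a u.
rewrite -(metric_invgram p a u); apply: le_trans (metric_CS _ _ _) _.
apply: ler_wpM2r; first exact: metric_ge0.
rewrite metric_invgram mxE; apply: le_trans (ler_norm _) _; exact: (HB p a a).2.
Qed.

(** For the two norms of a fibre derivative [W], Euclidean in the chosen coordinates
    and Riemannian once the index has been raised. This reduces the statement about
    gradients to one about fibre derivatives. *)
Lemma gdot_fdiff_le : exists2 K, 0 < K & forall p (W : 'M[R]_(n, d)),
  let U := W *m invmx (gram_at g C p) *m O p in
  gdot g (base p) U U <= K * mdot W W /\ mdot W W <= K * gdot g (base p) U U.
Proof.
have [B B0 HB] := gram_bounded; have [B' B'0 HB'] := coord_metric_le.
pose D : R := d%:R + 1; have D0 : 0 < D by rewrite ltr_wpDl.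
exists (D * B' + D * B); first by rewrite addr_gt0 // mulr_gt0.
move=> p W U; pose xi := W *m invmx (gram_at g C p).
have xiG : xi *m gram_at g C p = W by rewrite /xi -mulmxA mulVmx ?mulmx1 // gram_at_unit.
pose X j := g (base p) (row j xi *m O p) (row j xi *m O p).
have X0 j : 0 <= X j by exact: metric_ge0.
have UE : gdot g (base p) U U = \sum_j X j.
  by apply: eq_bigr => j _; rewrite /U row_mul.
have WE j l : W j l = (row j xi *m gram_at g C p) 0 l by rewrite -row_mul xiG mxE.
have up j l : W j l ^+ 2 <= B * X j.
  rewrite WE -metric_delta; apply: le_trans (metric_CS _ _ _) _.
  rewrite mulrC; apply: ler_wpM2r; rewrite ?metric_delta; first exact: X0.
  have -> : ((delta_mx 0 l : 'rV[R]_d) *m gram_at g C p) 0 l = gram_at g C p l l.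
    by rewrite -rowE mxE.
  by apply: le_trans (ler_norm _) _; exact: (HB p l l).1.
have lo j : X j <= D * B' * \sum_l W j l ^+ 2.
  have XE : X j = \sum_l row j xi 0 l * W j l.
    rewrite /X metric_gram_at exchange_big /=; apply: eq_bigr => l _.
    rewrite WE [(_ *m gram_at g C p) 0 l]mxE big_distrr /=; apply: eq_bigr => b _.
    by rewrite -mulrA mulrCA.
  (* Young's inequality, with the factor that lets half of [X j] absorb the
     contribution of [xi]. *)
  have : X j <= \sum_l ((D * B')^-1 / 2 * (row j xi 0 l) ^+ 2 + D * B' / 2 * W j l ^+ 2).
    rewrite {1}XE; apply: ler_sum => l _; set x := row j xi 0 l; set y := W j l.
    have c0 : 0 < D * B' by rewrite mulr_gt0.
    have := sqr_ge0 (x - D * B' * y); move: (D * B') c0 => c c0 h.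
    rewrite -subr_ge0.
    have -> : c^-1 / 2 * x ^+ 2 + c / 2 * y ^+ 2 - x * y = c^-1 / 2 * (x - c * y) ^+ 2.
      by field; rewrite gt_eqF.
    by rewrite mulr_ge0 // divr_ge0 // invr_ge0 ltW.
  have : \sum_l (row j xi 0 l) ^+ 2 <= D * B' * X j.
    apply: (@le_trans _ _ (\sum_(l < d) B' * X j)); first by apply: ler_sum => l _; exact: HB'.
    rewrite sumr_const card_ord -mulr_natl mulrA ler_wpM2r // ler_wpM2r ?ltW // /D.
    by lra.
  rewrite big_split /= -!mulr_sumr; move: (\sum_l _) (\sum_l _) => s2 s1 h1 h2.
  have c0 : 0 < D * B' by rewrite mulr_gt0.
  have : (D * B')^-1 / 2 * s1 <= X j / 2.
    rewrite mulrAC ler_pM2r ?invr_gt0 // mulrC ler_pdivrMr //.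
    by rewrite mulrC.
  by move: h2; lra.
have mE : mdot W W = \sum_j \sum_l W j l ^+ 2.
  by apply: eq_bigr => j _; apply: eq_bigr => l _; rewrite expr2.
have m0 : 0 <= mdot W W by rewrite mE; apply: sumr_ge0 => j _; apply: sumr_ge0 => l _; exact: sqr_ge0.
split.
  rewrite UE; apply: (@le_trans _ _ (D * B' * mdot W W)).
    by rewrite mE mulr_sumr; apply: ler_sum => j _; exact: lo.
  by rewrite ler_wpM2r // lerDl mulr_ge0 // ltW.
rewrite UE; apply: (@le_trans _ _ (D * B * \sum_j X j)); last first.
  by rewrite ler_wpM2r ?sumr_ge0 // lerDr mulr_ge0 // ltW.
rewrite mE mulr_sumr; apply: ler_sum => j _.
apply: (@le_trans _ _ (\sum_(l < d) B * X j)); first by apply: ler_sum => l _; exact: up.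
rewrite sumr_const card_ord -mulr_natl mulrA ler_wpM2r // ler_wpM2r ?ltW // /D.
by lra.
Qed.

End Bounds.
End Metric_bounds.

(** * Energy of a tuple *)

Section Energy.
Context {R : realType} {d : nat} {M : ptopologicalType} {A : smooth_atlas R d M}.
Variables (g : riemannian A) (C : cubic_cover A) (n : nat).
Notation T := (tangent A n).
Notation Z := ('rV[R]_d * 'M[R]_(n, d))%type.
Implicit Types (p : T).

(** A smooth proper function on the bundle: it measures the size of the tuple
    independently of the charts, up to the comparisons [energy_fib] and
    [energy_ball]. *)
Definition energy p : R := gdot g (base p) (vec p) (vec p).

Lemma energy_chart i z : energy (tpar i z) =
  \sum_j \sum_a \sum_b z.2 j a * z.2 j b * gram g i z.1 a b.
Proof.
apply: eq_bigr => j _; rewrite /= row_mul metric_gram.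
by apply: eq_bigr => a _; apply: eq_bigr => b _; rewrite !mxE.
Qed.

Lemma energy_smooth : smooth_fun energy.
Proof.
move=> i q; have oc := @tcod_open _ _ _ A n i.
have cg a b : Ck_on q (@tcod _ _ _ A n i) (fun z : Z => gram g i z.1 a b).
  exact: (@Ck_fst _ _ _ q (cod i) (fun y => gram g i y a b) (@gram_smooth _ _ _ _ g i a b q)).
apply: (Ck_eq oc) => [z _|]; first by rewrite /= energy_chart.
apply: Ck_sum => // j _; apply: Ck_sum => // a _; apply: Ck_sum => // b _.
by apply: Ck_M => //; apply: Ck_M => //; exact: Ck_entry.
Qed.

Lemma vec_fib p : vec p = fib C p *m of_chart (chosen_idx C (base p)) (base p).
Proof. by rewrite -vec_with_fib with_fibK. Qed.

Lemma metric_le_energy p j : g (base p) (row j (vec p)) (row j (vec p)) <= energy p.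
Proof.
by rewrite /energy /gdot (bigD1 j) //= lerDl sumr_ge0 // => a _; exact: metric_ge0.
Qed.

Lemma energy_ge0 p : 0 <= energy p.
Proof. by apply: sumr_ge0 => j _; exact: metric_ge0. Qed.

Lemma energy_fib b : exists b', forall p, energy p <= b -> entries_le (fib C p) b'.
Proof.
have [B B0 HB] := coord_metric_le g C n; exists (B * b + 1) => p pb j l.
have le : fib C p j l ^+ 2 <= B * b.
  have -> : fib C p j l = row j (fib C p) 0 l by rewrite [RHS]mxE.
  apply: le_trans (HB p l _) _; apply: ler_wpM2l; first exact: ltW.
  by rewrite -row_mul -vec_fib; apply: le_trans (metric_le_energy p j) pb.
rewrite -(ler_pXn2r (n := 2)) ?nnegrE // ?addr_ge0 // ?(le_trans (sqr_ge0 _) le) //.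
rewrite real_normK ?num_real //; have Bb0 := le_trans (sqr_ge0 _) le.
apply: le_trans le _; move: (B * b) Bb0 => x x0.
by have := sqr_ge0 (x : R); rewrite !expr2; nra.
Qed.

Lemma energy_ball b : exists2 E, 0 <= E & forall p, entries_le (fib C p) b -> energy p <= E.
Proof.
have [E E0 HE] := bounded_fib C b energy_smooth.
by exists E => // p /HE; apply: le_trans; exact: ler_norm.
Qed.

Lemma compact_fib (K : set T) : compact K -> exists b, forall p, K p -> entries_le (fib C p) b.
Proof.
move=> cK; have : compact (energy @` K).
  apply: continuous_compact => //; apply: continuous_subspaceT.
  exact: smooth_fun_continuous energy_smooth.
move=> /compact_bounded[B [_ HB]]; have [b' Hb'] := energy_fib (`|B| + 1).
exists b' => p Kp; apply: Hb'; apply: le_trans (ler_norm _) _.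
by apply: HB; [apply: le_lt_trans (ler_norm B) _; rewrite ltrDl|exists p].
Qed.

Lemma fdiff_near0 (f : T -> R) p : (\forall q \near p, f q = 0) -> fdiff C f p = 0.
Proof.
move=> f0; apply/matrixP => j l; rewrite fdiff_chart [RHS]mxE.
have ct := @tpar_at _ _ _ A n (chosen_idx C (base p)) (pos C p, fib C p) (cod_pos C p).
have nz : \forall z \near (pos C p, fib C p),
    (f \o @tpar _ _ _ A n (chosen_idx C (base p))) z = (cst 0 : Z -> R) z.
  move: f0; rewrite -{1}(with_fibK C p) => f0; exact: ct f0.
rewrite (near_eq_derive _ nz); exact: derive_cst.
Qed.

(** ** A partition of unity by energy shells *)

Definition cutoff (k : nat) p : R := smooth_step (energy p + 1 - k%:R).
Definition shell (k : nat) p : R := cutoff k p - cutoff k.+1 p.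

Lemma cutoff_smooth k : smooth_fun (cutoff k).
Proof.
move=> i q; have oc := @tcod_open _ _ _ A n i.
apply: Ck_comp_scalar => //; first exact: smooth_step_smooth.
apply: (Ck_eq oc) (Ck_D (energy_smooth i q) (@Ck_cst _ _ _ q _ (1 - k%:R : R)) oc) => z _.
by rewrite /= addrA.
Qed.

Lemma smooth_funB (f h : T -> R) : smooth_fun f -> smooth_fun h -> smooth_fun (fun p => f p - h p).
Proof.
move=> sf sh i q; have oc := @tcod_open _ _ _ A n i.
apply: (Ck_eq oc) (Ck_D (sf i q) (Ck_M (@Ck_cst _ _ _ q _ (-1 : R)) (sh i q) oc) oc) => z _.
by rewrite /= mulN1r.
Qed.

Lemma smooth_funM (f h : T -> R) : smooth_fun f -> smooth_fun h -> smooth_fun (fun p => f p * h p).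
Proof. by move=> sf sh i q; exact: Ck_M (sf i q) (sh i q) (@tcod_open _ _ _ A n i). Qed.

Lemma shell_smooth k : smooth_fun (shell k).
Proof. by apply: smooth_funB; exact: cutoff_smooth. Qed.

Lemma shell_ge0 k p : 0 <= shell k p.
Proof.
rewrite subr_ge0; apply: smooth_step_homo.
by rewrite lerD2l lerN2 ler_nat.
Qed.

Lemma shell_inner k p : energy p + 1 <= k%:R -> shell k p = 0.
Proof.
move=> le; rewrite /shell /cutoff !smooth_step0 ?subrr // subr_le0 //.
by apply: le_trans le _; rewrite ler_nat.
Qed.

Lemma shell_outer k p : k%:R + 1 <= energy p -> shell k p = 0.
Proof.
move=> le; rewrite /shell /cutoff !smooth_step1 ?subrr //; last lra.
by rewrite -natr1; lra.
Qed.

Lemma sum_shell m p : \sum_(0 <= k < m) shell k p = 1 - cutoff m p.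
Proof.
elim: m => [|m IH]; first by rewrite big_geq // /cutoff smooth_step1 ?subrr // subr0 lerDr energy_ge0.
by rewrite big_nat_recr //= IH /shell addrA subrK.
Qed.

Lemma sum_shell_eventually m p : energy p + 1 <= m%:R -> \sum_(0 <= k < m) shell k p = 1.
Proof. by move=> le; rewrite sum_shell /cutoff smooth_step0 ?subr0 // subr_le0. Qed.

(** A single [k0] serves a whole fibre ball, and a neighborhood of each of its
    points, as derivatives of the shells are to vanish as well. *)
Lemma shell_near0 b : exists k0, forall p, entries_le (fib C p) b ->
  \forall q \near p, forall k, (k0 <= k)%N -> shell k q = 0.
Proof.
have [E E0 HE] := energy_ball b; pose m := (Num.truncn (E + 2)).+1.
have mE : E + 2 < m%:R by rewrite truncnS_gt.
exists m => p /HE pE.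
have /cvgr_lt/(_ (E + 1)) := smooth_fun_continuous energy_smooth (x := p).
move=> /(_ (le_lt_trans pE _)) h; have {h} : \forall q \near p, energy q < E + 1.
  by apply: h; rewrite ltrDl.
apply: filterS => q qE k mk; apply: shell_inner.
by apply: le_trans (_ : m%:R <= _); [lra|rewrite ler_nat].
Qed.

Lemma shell_fib k : exists b, forall p, ~ entries_le (fib C p) b -> shell k p = 0.
Proof.
have [b Hb] := energy_fib (k%:R + 1); exists b => p np; apply: shell_outer.
by rewrite leNgt; apply/negP => lt; apply: np; apply: Hb; exact: ltW.
Qed.

Lemma test_fun_ball (f : T -> R) b : smooth_fun f ->
  (forall p, ~ entries_le (fib C p) b -> f p = 0) -> test_fun f.
Proof.
move=> sf f0; split => //; exists (fibre_ball C b); first exact: fibre_ball_compact.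
by move=> p np; apply: f0 => /fibre_ballP.
Qed.

Lemma shell_test (f : T -> R) k : smooth_fun f -> test_fun (fun p => shell k p * f p).
Proof.
move=> sf; have [b Hb] := shell_fib k.
apply: (@test_fun_ball _ b); first by apply: smooth_funM => //; exact: shell_smooth.
by move=> p /Hb ->; rewrite mul0r.
Qed.

Lemma shell_partition : partition_of_unity shell.
Proof.
split; last 1 first.
- move=> p; apply: (@cvg_trans _ ((fun=> 1 : R) @ \oo)); last exact: cvg_cst.
  apply: near_eq_cvg; exists (Num.truncn (energy p + 1)).+1 => // m /= le.
  rewrite sum_shell_eventually //; apply: le_trans (ltW (truncnS_gt _)) _.
  by rewrite ler_nat.
- move=> k; have [b Hb] := shell_fib k; exact: (test_fun_ball (@shell_smooth k) Hb).
- exact: shell_ge0.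
move=> p; have [k0 Hk] := @shell_near0 (\sum_j \sum_l `|fib C p j l|).
exists k0; apply: Hk => j l; rewrite (bigD1 j) //= (bigD1 l) //= -addrA lerDl addr_ge0 //.
  by apply: sumr_ge0.
by apply: sumr_ge0 => a _; apply: sumr_ge0.
Qed.

(** ** Forms and the comass *)

Lemma Omega_scale k (w : tangent A k -> R) (a : R) : Omega A k w -> Omega A k (fun p : tangent A k => a * w p).
Proof.
move=> [w1 w2 w3]; split.
- by move=> p j c u u'; rewrite w1; ring.
- by move=> p j j' jj' E; rewrite (w2 p j j') // mulr0.
by move=> i W q; apply: (Ck_M (@Ck_cst _ _ _ q _ (a : R)) (w3 i W q)); exact: cod_open.
Qed.

Lemma Omega_add k (w w' : tangent A k -> R) : Omega A k w -> Omega A k w' ->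
  Omega A k (fun p : tangent A k => w p + w' p).
Proof.
move=> [w1 w2 w3] [v1 v2 v3]; split.
- by move=> p j c u u'; rewrite w1 v1; ring.
- by move=> p j j' jj' E; rewrite (w2 p j j') // (v2 p j j') // addr0.
by move=> i W q; apply: (Ck_D (w3 i W q) (v3 i W q)); exact: cod_open.
Qed.

Lemma Omega_0 k : Omega A k (fun=> 0).
Proof.
split=> [p j a u u'|//|i W q]; first by rewrite mulr0 addr0.
exact: (@Ck_cst _ _ _ q _ (0 : R)).
Qed.

Lemma form_scale (w : T -> R) p (s : R) : Omega A n w ->
  w (with_fib C p (s *: fib C p)) = s ^+ n * w p.
Proof.
move=> wO; have lin := form_row_linear wO (chosen_idx C (base p)) (pos C p).
rewrite -[in RHS](with_fibK C p).
have := multilinear_expand lin => ml.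
rewrite -[with_fib C p (s *: _)]/(tpar _ (_, _)) ml.
rewrite -[with_fib C p (fib C p)]/(tpar _ (_, _)) ml.
rewrite mulr_sumr; apply: eq_bigr => I _; rewrite mulrA; congr (_ * _).
under eq_bigr => k _ do rewrite mxE.
by rewrite big_split /= prodr_const card_ord.
Qed.

Lemma comass_energy p : (forall j, Num.sqrt (g (base p) (row j (vec p)) (row j (vec p))) <= 1) ->
  energy p <= n%:R.
Proof.
move=> p1; apply: (@le_trans _ _ (\sum_(j < n) 1)); last by rewrite sumr_const card_ord.
apply: ler_sum => j _; have := p1 j; have := metric_ge0 g (base p) (row j (vec p)).
set x := g _ _ _ => x0 x1; by rewrite -(sqr_sqrtr x0) expr_le1 // sqrtr_ge0.
Qed.

Lemma voln_ge0 p : (0 <= voln g p)%E.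
Proof.
apply: ereal_sup_ubound; exists (fun=> 0) => //; split; first exact: Omega_0.
by apply: ge_ereal_sup => _ [q _ <-]; rewrite lee_fin ler01.
Qed.

(** A form is bounded on tuples of vectors of length at most 1, so a multiple of it
    has comass at most 1 and competes in the supremum [voln]. *)
Lemma form_le_voln (w : T -> R) : Omega A n w ->
  exists2 c, 0 < c & forall p, ((`|w p| / c)%:E <= voln g p)%E.
Proof.
move=> wO; have [b Hb] := energy_fib n%:R.
have [B B0 HB] := bounded_fib C b (form_smooth wO).
have c0 : 0 < B + 1 by rewrite ltr_wpDl.
exists (B + 1) => // p.
have le (s : R) : `|s| = 1 -> ((s * w p / (B + 1))%:E <= voln g p)%E.
  move=> s1; apply: ereal_sup_ubound; exists (fun q => s / (B + 1) * w q); last by rewrite mulrAC.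
  split; first exact: Omega_scale.
  apply: ge_ereal_sup => _ [q q1 <-]; rewrite lee_fin; apply: le_trans (ler_norm _) _.
  rewrite !normrM s1 mul1r normfV (gtr0_norm c0) mulrC ler_pdivrMr // mul1r.
  by apply: le_trans (HB q (Hb _ (comass_energy q1))) _; rewrite lerDl.
have [w0|w0] := leP 0 (w p).
  by rewrite ger0_norm // -[w p]mul1r; apply: le; rewrite normr1.
by rewrite ltr0_norm // -mulN1r; apply: le; rewrite normrN1.
Qed.

(** Scaling a bounded tuple down to vectors of length at most 1 divides an n-form by
    a bounded n-th power. *)
Lemma voln_ball b : exists2 c : R, 0 <= c & forall p, entries_le (fib C p) b -> (voln g p <= c%:E)%E.
Proof.
have [E E0 HE] := energy_ball b; pose s := E + 1; have s0 : 0 < s by rewrite ltr_wpDl.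
exists (s ^+ n) => [|p /HE pE]; first by rewrite exprn_ge0 // ltW.
apply: ge_ereal_sup => _ [w [wO w1] <-]; rewrite lee_fin.
have [q qE] : exists q, q = with_fib C p (s^-1 *: fib C p) by eexists.
have pq : p = with_fib C q (s *: fib C q).
  by rewrite qE with_fib_with fib_with_fib scalerA divff ?gt_eqF // scale1r with_fibK.
have wq : w p = s ^+ n * w q by have := form_scale q s wO; rewrite -pq.
suff wq1 : ((w q)%:E <= 1%:E)%E.
  rewrite lee_fin in wq1; rewrite wq -[leRHS]mulr1; apply: ler_wpM2l => //.
  by rewrite exprn_ge0 // ltW.
apply: le_trans w1; apply: ereal_sup_ubound; exists q => //= j.
rewrite -[X in _ <= X]sqrtr1 ler_sqrt // qE base_with_fib -qE.
have -> : row j (vec q) = s^-1 *: row j (vec p).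
  by rewrite qE vec_with_fib -scalemxAl -vec_fib; apply/rowP => l; rewrite !mxE.
rewrite metricZ metricZr mulrA -expr2; have := metric_le_energy p j => h.
rewrite exprVn mulrC ler_pdivrMr ?exprn_gt0 // mul1r; apply: le_trans h _; apply: le_trans pE _.
by rewrite /s expr2; nra.
Qed.

(** A supremum of continuous functions is lower semicontinuous. *)
Lemma measurable_voln : measurable_fun setT (fun p : borel A n => voln g (p : T)).
Proof.
apply: (measurability _ (ErealGenOInfty.measurableE R)) => _ [_ [a ->]] <-.
rewrite setTI; apply: borel_open.
have -> : (fun p : borel A n => voln g (p : T)) @^-1` `]a%:E, +oo[%classic =
    \bigcup_(w in [set w | Omega A n w /\ (comass g w <= 1)%E]) [set p | a < w p].
  apply/seteqP; split=> p.
    rewrite /= in_itv /= andbT => /ereal_sup_gt[_ [w wO <-]]; rewrite lte_fin => aw.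
    by exists w.
  move=> [w wO aw]; rewrite /= in_itv /= andbT; apply: (@lt_le_trans _ _ (w p)%:E).
    by rewrite lte_fin.
  by apply: ereal_sup_ubound; exists w.
apply: bigcup_open => w [wO _].
have cw := smooth_fun_continuous (form_smooth wO).
have := iffLR (@continuousP T R w) cw [set x | a < x]; apply; exact: open_gt.
Qed.

End Energy.

(** * Real integrals *)

Section Real_integrals.
Context {dX : measure_display} {X : measurableType dX} {R : realType}.
Variable mu : {measure set X -> \bar R}.
Implicit Types (f h : X -> R).

Definition integr f := mu.-integrable setT (EFin \o f).

Lemma integr_measurable f : integr f -> measurable_fun setT f.
Proof. by move=> /measurable_int/measurable_EFinP. Qed.

Lemma integr_le f h : measurable_fun setT f -> (forall x, `|f x| <= h x) -> integr h -> integr f.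
Proof.
move=> mf fh ih; apply: (le_integrable measurableT _ _ ih); first exact/measurable_EFinP.
by move=> x _ /=; rewrite lee_fin (le_trans (fh x)) // ler_norm.
Qed.

Lemma integr_ge0 f : measurable_fun setT f -> (forall x, 0 <= f x) ->
  (\int[mu]_x (f x)%:E < +oo)%E -> integr f.
Proof.
move=> mf f0 fi; apply/integrableP; split; first exact/measurable_EFinP.
by under eq_integral => x _ do rewrite /= ger0_norm //.
Qed.

Lemma integrD f h : integr f -> integr h -> integr (fun x => f x + h x).
Proof. by move=> iF ih; exact: (integrableD measurableT iF ih). Qed.

Lemma integrZ (a : R) f : integr f -> integr (fun x => a * f x).
Proof. by move=> iF; exact: (integrableZl measurableT a iF). Qed.

Lemma integrB f h : integr f -> integr h -> integr (fun x => f x - h x).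
Proof. by move=> iF ih; exact: (integrableB measurableT iF ih). Qed.

Lemma integr_norm f : integr f -> integr (fun x => `|f x|).
Proof. by move=> iF; exact: integrable_norm. Qed.

Lemma integr0 : integr (fun=> 0).
Proof. exact: integrable0. Qed.

Lemma integr_sum (I : Type) (r : seq I) (P : pred I) (F : I -> X -> R) :
  (forall i, P i -> integr (F i)) -> integr (fun x => \sum_(i <- r | P i) F i x).
Proof.
move=> iF; elim: r => [|i r IH].
  by rewrite (_ : (fun x => _) = fun=> 0) ?funeqE // => [|x]; [exact: integr0|rewrite big_nil].
rewrite (_ : (fun x => _) = fun x => (if P i then F i x else 0) + \sum_(j <- r | P j) F j x).
  by case E: (P i); [apply: integrD => //; exact: iF|apply: integrD => //; exact: integr0].
by apply/funext => x; rewrite big_cons; case: ifP => //; rewrite add0r.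
Qed.

Lemma integr_EFin f : integr f -> (\int[mu]_x (f x)%:E)%E = (\int[mu]_x f x)%:E.
Proof. by move=> iF; rewrite /Rintegral fineK //; exact: integrable_fin_num. Qed.

Lemma RintD f h : integr f -> integr h -> \int[mu]_x (f x + h x) = \int[mu]_x f x + \int[mu]_x h x.
Proof. exact: RintegralD. Qed.

Lemma RintB f h : integr f -> integr h -> \int[mu]_x (f x - h x) = \int[mu]_x f x - \int[mu]_x h x.
Proof. exact: RintegralB. Qed.

Lemma RintZ (a : R) f : integr f -> \int[mu]_x (a * f x) = a * \int[mu]_x f x.
Proof. exact: RintegralZl. Qed.

Lemma Rint_sum (I : Type) (r : seq I) (P : pred I) (F : I -> X -> R) :
  (forall i, P i -> integr (F i)) ->
  \int[mu]_x (\sum_(i <- r | P i) F i x) = \sum_(i <- r | P i) \int[mu]_x F i x.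
Proof.
move=> iF; elim: r => [|i r IH].
  rewrite big_nil; under eq_Rintegral => x _ do rewrite big_nil.
  by rewrite Rintegral_cst // mul0r.
rewrite big_cons; under eq_Rintegral => x _ do rewrite big_cons.
case: ifP => // Pi; rewrite RintD ?IH //; [exact: iF|exact: integr_sum].
Qed.

Lemma Rint_le f h : integr f -> integr h -> (forall x, f x <= h x) ->
  \int[mu]_x f x <= \int[mu]_x h x.
Proof. by move=> iF ih fh; exact: le_Rintegral. Qed.

Lemma Rint_ge0 f : (forall x, 0 <= f x) -> 0 <= \int[mu]_x f x.
Proof. by move=> f0; exact: Rintegral_ge0. Qed.

Lemma Rint_norm_le f h : integr f -> integr h -> (forall x, `|f x| <= h x) ->
  `|\int[mu]_x f x| <= \int[mu]_x h x.
Proof.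
move=> iF ih fh; apply: le_trans (le_normr_Rintegral measurableT iF) _.
by apply: Rint_le => //; exact: integr_norm.
Qed.

Lemma Rint_cvg (F : nat -> X -> R) f h : (forall k, measurable_fun setT (F k)) ->
  (forall x, F k x @[k --> \oo] --> f x) -> integr h -> (forall k x, `|F k x| <= h x) ->
  integr f /\ \int[mu]_x F k x @[k --> \oo] --> \int[mu]_x f x.
Proof.
move=> mF cF ih Fh; have mf : measurable_fun setT f by apply: measurable_fun_cvg => // x _; exact: cF.
have [|||||iF _ cv] := @dominated_convergence _ X R mu setT measurableT
  (fun k => EFin \o F k) (EFin \o f) (EFin \o h).
- by move=> k; exact/measurable_EFinP.
- exact/measurable_EFinP.
- by apply: aeW => x _; apply/fine_cvgP; split; [exact: nearW|exact: cF].
- exact: ih.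
- by apply: aeW => x k _; rewrite /= lee_fin.
split => //; move: cv; rewrite /= (integr_EFin iF) => /fine_cvgP[_]; exact.
Qed.

Lemma Rint_cvg_right (F : R -> X -> R) f h : (forall t, measurable_fun setT (F t)) ->
  (forall x, F t x @[t --> 0^'+] --> f x) -> integr h ->
  (forall t x, 0 < t < 1 -> `|F t x| <= h x) ->
  integr f /\ \int[mu]_x F t x @[t --> 0^'+] --> \int[mu]_x f x.
Proof.
move=> mF cF ih Fh.
have seqc (u : nat -> R) : (forall k, 0 < u k) -> u k @[k --> \oo] --> 0 ->
    integr f /\ \int[mu]_x F (u k) x @[k --> \oo] --> \int[mu]_x f x.
  move=> u0 cu; have [N _ HN] : \forall k \near \oo, u k < 1.
    by move: cu => /cvgr_lt; apply.
  have [||||iF cv] := @Rint_cvg (fun k => F (u (k + N)%N)) f h.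
  - by move=> k; exact: mF.
  - move=> x; move/cvg_at_rightP: (cF x) => /(_ (fun k => u (k + N)%N)); apply; split => //.
    by rewrite cvg_shiftn.
  - exact: ih.
  - by move=> k x; apply: Fh; rewrite u0 HN //= leq_addl.
  by split => //; move: cv; rewrite (@cvg_shiftn N _ (fun k => \int[mu]_x F (u k) x)).
have [||iF _] := seqc (fun k => k.+1%:R^-1).
- by move=> k; rewrite invr_gt0.
- exact: cvg_harmonic.
split => //; apply/cvg_at_rightP => u [u0 cu].
by have [] := seqc u u0 cu.
Qed.

End Real_integrals.

(** * Weighted images of a measure *)

Section Transport.
Import HBNNSimple.
Context {dX : measure_display} {X : measurableType dX} {R : realType}.
Implicit Types (mu nu : {measure set X -> \bar R}).

(** The measure [nu] is the sum of the images under [F i] of [mu] with density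
    [ka i]. *)
Definition transports (I : finType) mu nu (ka : I -> X -> R) (F : I -> X -> X) :=
  forall f : X -> \bar R, measurable_fun setT f -> (forall x, 0 <= f x)%E ->
    (\int[nu]_x f x = \int[mu]_x (\sum_i (ka i x)%:E * f (F i x)))%E.

(** Checked on indicators and simple functions, then extended by monotone
    convergence. *)
Lemma weighted_image mu (ka : X -> R) (F : X -> X) : measurable_fun setT ka ->
  (forall x, 0 <= ka x) -> measurable_fun setT F ->
  exists nu : {measure set X -> \bar R}, forall f : X -> \bar R, measurable_fun setT f ->
    (forall x, 0 <= f x)%E -> (\int[nu]_x f x = \int[mu]_x ((ka x)%:E * f (F x)))%E.
Proof.
move=> mka ka0 mF.
have mE : measurable_fun setT (EFin \o ka) by exact/measurable_EFinP.
pose nu0 B : \bar R := (\int[mu]_(x in F @^-1` B) (ka x)%:E)%E.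
have mpre B : measurable B -> measurable (F @^-1` B).
  by move=> mB; rewrite -[X in measurable X]setTI; exact: mF.
have n0 : nu0 set0 = 0%E by rewrite /nu0 preimage_set0 integral_set0.
have nge0 B : (0 <= nu0 B)%E by apply: integral_ge0 => x _; rewrite lee_fin.
have nsig : semi_sigma_additive nu0.
  move=> B mB tB mUB; rewrite /nu0 preimage_bigcup.
  apply: (@semi_sigma_additive_nng_induced _ X R mu _ mE _ (fun k => F @^-1` B k)) => [x|k||].
  - by rewrite lee_fin.
  - exact: mpre.
  - apply/trivIsetP => i j _ _ ij; rewrite -preimage_setI.
    by move/trivIsetP: tB => /(_ i j Logic.I Logic.I ij) ->; rewrite preimage_set0.
  by rewrite -preimage_bigcup; exact: mpre.
pose mix := isMeasure.Build _ _ _ nu0 n0 nge0 nsig.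
pose nu : {measure set X -> \bar R} := HB.pack nu0 mix.
have nuE B : measurable B -> nu B = (\int[mu]_x ((ka x)%:E * (\1_B (F x))%:E))%E.
  move=> mB; rewrite [LHS]integral_mkcond; apply: eq_integral => x _.
  have E : (x \in F @^-1` B) = (F x \in B) by apply/idP/idP => /set_mem h; apply/mem_set.
  by rewrite patchE indicE E; case: ifP => _; rewrite ?mule1 ?mule0.
exists nu => f mf f0; pose f_ := nnsfun_approx measurableT mf.
have f0' x : setT x -> (0 <= f x)%E by [].
have cf x : (f_ k x)%:E @[k --> \oo] --> f x by exact: cvg_nnsfun_approx.
have ndf x : {homo (fun k => (f_ k x)%:E) : i j / (i <= j)%N >-> (i <= j)%E}.
  by move=> i j ij; rewrite lee_fin; exact/lefP/nd_nnsfun_approx.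
have mf_ k : measurable_fun setT (fun x => (f_ k (F x))%:E).
  by apply/measurable_EFinP; apply: measurableT_comp => //; exact: measurable_funP.
have kaf k : (\int[nu]_x (f_ k x)%:E = \int[mu]_x ((ka x)%:E * (f_ k (F x))%:E))%E.
  move: (f_ k) => h.
  have mh r : measurable (h @^-1` [set r]) by [].
  have ind r : (\int[nu]_x (r * \1_(h @^-1` [set r]) x)%:E =
      \int[mu]_x ((ka x)%:E * (r * \1_(h @^-1` [set r]) (F x))%:E))%E.
    have [r0|r0] := ltP r 0.
      by rewrite preimage_nnfun0 // !integral0_eq // => x _; rewrite indic0 mulr0 ?mule0.
    rewrite integralZl_indic_nnsfun // integral_indic // setIT nuE // -ge0_integralZl //.
    - by apply: eq_integral => x _; rewrite EFinM muleCA.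
    - apply/measurable_EFinP; apply: measurable_funM => //.
      by apply: measurableT_comp.
    by move=> x _; rewrite -EFinM lee_fin mulr_ge0.
  transitivity (\sum_(r \in range h) \int[nu]_x (r * \1_(h @^-1` [set r]) x)%:E)%E.
    rewrite -ge0_integral_fsum //.
    - by apply: eq_integral => x _; rewrite fsumEFin // -fimfunE.
    - by move=> r; exact/measurable_EFinP/measurable_funM.
    - by move=> r x _; rewrite EFinM nnfun_muleindic_ge0.
  under eq_fsbigr do rewrite ind.
  rewrite -ge0_integral_fsum //.
  - apply: eq_integral => x _; rewrite -ge0_mule_fsumr ?fsumEFin -?fimfunE //.
    by move=> r; rewrite EFinM nnfun_muleindic_ge0.
  - move=> r; apply/measurable_EFinP; apply: measurable_funM => //.
    by apply: measurable_funM => //; exact: measurableT_comp.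
  - by move=> r x _; apply: mule_ge0; [rewrite lee_fin|rewrite EFinM nnfun_muleindic_ge0].
have limf x : limn (fun k => (f_ k x)%:E) = f x by exact: cvg_lim.
have limkf x : limn (fun k => ((ka x)%:E * (f_ k (F x))%:E)%E) = ((ka x)%:E * f (F x))%E.
  by apply: cvg_lim => //; apply: cvgeZl => //; exact: cf.
transitivity (limn (fun k => \int[nu]_x (f_ k x)%:E)%E).
  rewrite -monotone_convergence //.
  - by apply: eq_integral => x _; rewrite limf.
  - by move=> k; apply/measurable_EFinP.
  - by move=> k x _; rewrite lee_fin.
transitivity (limn (fun k => \int[mu]_x ((ka x)%:E * (f_ k (F x))%:E))%E).
  by congr (limn _); apply/funext => k; rewrite kaf.
rewrite -monotone_convergence //.
- by apply: eq_integral => x _; rewrite limkf.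
- by move=> k; exact: emeasurable_funM.
- by move=> k x _; rewrite mule_ge0 // lee_fin.
by move=> x _ i j ij; apply: lee_pmul; rewrite ?lee_fin //; exact: ndf.
Qed.

Lemma transports_exists (I : finType) mu (ka : I -> X -> R) (F : I -> X -> X) :
  (forall i, measurable_fun setT (ka i)) -> (forall i x, 0 <= ka i x) ->
  (forall i, measurable_fun setT (F i)) ->
  exists nu : {measure set X -> \bar R}, transports mu nu ka F.
Proof.
move=> mka ka0 mF.
suff [nu Hnu] : exists nu : {measure set X -> \bar R}, forall f : X -> \bar R,
    measurable_fun setT f -> (forall x, 0 <= f x)%E ->
    (\int[nu]_x f x = \int[mu]_x (\sum_(i <- index_enum I) (ka i x)%:E * f (F i x)))%E.
  by exists nu.
elim: (index_enum I) => [|i s [nu IH]].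
  exists (mzero : {measure set X -> \bar R}) => f mf f0; rewrite integral_measure_zero.
  by under eq_integral => x _ do rewrite big_nil; rewrite integral0.
have [nu1 H1] := weighted_image mu (mka i) (ka0 i) (mF i).
exists (measure_add nu1 nu) => f mf f0.
rewrite ge0_integral_measure_add // IH // H1 // -ge0_integralD //.
- by apply: eq_integral => x _; rewrite big_cons.
- by move=> x _; rewrite mule_ge0 // lee_fin.
- by apply: emeasurable_funM; [exact/measurable_EFinP|exact: measurableT_comp].
- by move=> x _; apply: sume_ge0 => j _; rewrite mule_ge0 // lee_fin.
apply: emeasurable_sum => j.
by apply: emeasurable_funM; [exact/measurable_EFinP|exact: measurableT_comp].
Qed.

Section Integration.
Variables (I : finType) (mu nu : {measure set X -> \bar R}) (ka : I -> X -> R) (F : I -> X -> X).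
Hypothesis mka : forall i, measurable_fun setT (ka i).
Hypothesis mF : forall i, measurable_fun setT (F i).
Hypothesis tr : transports mu nu ka F.

Lemma transports_ge0 (f : X -> R) : measurable_fun setT f -> (forall x, 0 <= f x) ->
  (\int[nu]_x (f x)%:E = \int[mu]_x (\sum_i ka i x * f (F i x))%:E)%E.
Proof.
move=> mf f0; rewrite (tr (f := EFin \o f)).
- by apply: eq_integral => x _; rewrite -sumEFin; apply: eq_bigr => i _; rewrite EFinM.
- exact/measurable_EFinP.
by move=> x; rewrite lee_fin.
Qed.

(** The positive and the negative part are transported separately. *)
Lemma transports_integr (f : X -> R) : measurable_fun setT f ->
  (forall i, integr mu (fun x => ka i x * f (F i x))) ->
  integr nu f /\ \int[nu]_x f x = \sum_i \int[mu]_x (ka i x * f (F i x)).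
Proof.
move=> mf iF.
have pos (h : X -> R) : measurable_fun setT h -> (forall x, 0 <= h x) -> (forall x, h x <= `|f x|) ->
    integr nu h /\ \int[nu]_x h x = \int[mu]_x (\sum_i ka i x * h (F i x)).
  move=> mh h0 hf.
  have ih : integr mu (fun x => \sum_i ka i x * h (F i x)).
    apply: integr_sum => i _; apply: (@integr_le _ _ _ _ _ (fun x => `|ka i x * f (F i x)|)).
    - by apply: measurable_funM => //; exact: measurableT_comp.
    - by move=> x; rewrite !normrM; apply: ler_wpM2l => //; rewrite ger0_norm.
    exact: integr_norm.
  have E := transports_ge0 mh h0; split; last by rewrite /Rintegral E.
  apply: integr_ge0 => //; rewrite E.
  by rewrite integr_EFin // ltry.
have mp : measurable_fun setT (fun x => Num.max (f x) 0) by exact: measurable_maxr.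
have mn : measurable_fun setT (fun x => Num.max (- f x) 0).
  by apply: measurable_maxr => //; exact: measurableT_comp.
have [x|x|ip Ep] := pos _ mp; first by rewrite le_max lexx orbT.
  by rewrite ge_max normr_ge0 ler_norm.
have [x|x|iN En] := pos _ mn; first by rewrite le_max lexx orbT.
  by rewrite ge_max normr_ge0 -normrN ler_norm.
have fE : f = (fun x => Num.max (f x) 0 - Num.max (- f x) 0).
  apply/funext => x; move: (f x) => a; have [a0|/ltW a0] := lerP 0 a.
    by rewrite max_r ?oppr_le0 // subr0.
  by rewrite max_l ?oppr_ge0 // sub0r opprK.
split; first by rewrite fE; exact: integrB.
have ik (h : X -> R) : measurable_fun setT h -> (forall x, `|h x| <= `|f x|) ->
    forall i, true -> integr mu (fun x => ka i x * h (F i x)).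
  move=> mh hf i _; apply: (@integr_le _ _ _ _ _ (fun x => `|ka i x * f (F i x)|)).
  - by apply: measurable_funM => //; exact: measurableT_comp.
  - by move=> x; rewrite !normrM; apply: ler_wpM2l.
  exact: integr_norm.
have ikp := ik _ mp; have ikn := ik _ mn.
rewrite {1}fE RintB // Ep En -RintB; first last.
- by apply: integr_sum; apply: ikn => x; rewrite ger0_norm ?le_max ?lexx ?orbT // ge_max normr_ge0 -normrN ler_norm.
- by apply: integr_sum; apply: ikp => x; rewrite ger0_norm ?le_max ?lexx ?orbT // ge_max normr_ge0 ler_norm.
rewrite -Rint_sum; last by move=> i _; exact: iF.
apply: eq_Rintegral => x _; rewrite -sumrB; apply: eq_bigr => i _.
by rewrite [in RHS]fE mulrBr.
Qed.

End Integration.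

End Transport.

(** * Orthogonal projection in a vector-valued L^2 space *)

Section Square_integrable.
Context {dX : measure_display} {X : measurableType dX} {R : realType} {I : finType}.
Variable mu : {measure set X -> \bar R}.
Implicit Types (f h u v : I -> X -> R).

Definition dot f h (x : X) : R := \sum_i f i x * h i x.
Definition sq f := (forall i, measurable_fun setT (f i)) /\ integr mu (dot f f).
Definition ip f h : R := \int[mu]_x dot f h x.
Definition lin (a : R) f h : I -> X -> R := fun i x => a * f i x + h i x.

Lemma dotC f h x : dot f h x = dot h f x.
Proof. by apply: eq_bigr => i _; rewrite mulrC. Qed.

Lemma dot_linl a f h u x : dot (lin a f h) u x = a * dot f u x + dot h u x.
Proof.
rewrite /dot mulr_sumr -big_split; apply: eq_bigr => i _.
by rewrite /lin mulrDl mulrA.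
Qed.

Lemma dot_linr a f h u x : dot u (lin a f h) x = a * dot u f x + dot u h x.
Proof. by rewrite dotC dot_linl !(dotC u). Qed.

Lemma dot_ge0 f x : 0 <= dot f f x.
Proof. by apply: sumr_ge0 => i _; rewrite -expr2 sqr_ge0. Qed.

Lemma measurable_dot f h : (forall i, measurable_fun setT (f i)) ->
  (forall i, measurable_fun setT (h i)) -> measurable_fun setT (dot f h).
Proof. by move=> mf mh; apply: measurable_sum => i; exact: measurable_funM. Qed.

Lemma dot_le f h x : `|dot f h x| <= dot f f x + dot h h x.
Proof.
have d1 : dot (lin 1 f h) (lin 1 f h) x = dot f f x + 2 * dot f h x + dot h h x.
  by rewrite dot_linl !dot_linr (dotC h f); ring.
have d2 : dot (lin (-1) f h) (lin (-1) f h) x = dot f f x - 2 * dot f h x + dot h h x.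
  by rewrite dot_linl !dot_linr (dotC h f); ring.
have := dot_ge0 (lin 1 f h) x; have := dot_ge0 (lin (-1) f h) x.
have := dot_ge0 f x; have := dot_ge0 h x.
rewrite d1 d2 ler_norml; move: (dot f f x) (dot h h x) (dot f h x) => a b c; lra.
Qed.

Lemma integr_dot f h : sq f -> sq h -> integr mu (dot f h).
Proof.
move=> [mf iF] [mh ih]; apply: (@integr_le _ _ _ _ _ (fun x => dot f f x + dot h h x)).
- exact: measurable_dot.
- exact: dot_le.
exact: integrD.
Qed.

Lemma sq_lin a f h : sq f -> sq h -> sq (lin a f h).
Proof.
move=> sf sh; split=> [i|].
  by apply: measurable_funD; [apply: measurable_funM => //; exact: sf.1|exact: sh.1].
have -> : dot (lin a f h) (lin a f h) =
    fun x => a * (a * dot f f x + dot f h x) + (a * dot h f x + dot h h x).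
  by apply/funext => x; rewrite dot_linl !dot_linr.
have := integr_dot sf sf; have := integr_dot sf sh; have := integr_dot sh sf; have := integr_dot sh sh.
by move=> i1 i2 i3 i4; apply: integrD; [apply: integrZ; apply: integrD => //; exact: integrZ|
  apply: integrD => //; exact: integrZ].
Qed.

Lemma ip_linl a f h u : sq f -> sq h -> sq u -> ip (lin a f h) u = a * ip f u + ip h u.
Proof.
move=> sf sh su; rewrite /ip; under eq_Rintegral => x _ do rewrite dot_linl.
have i1 := integr_dot sf su; have i2 := integr_dot sh su.
by rewrite RintD ?RintZ //; exact: integrZ.
Qed.

Lemma ipC f h : ip f h = ip h f.
Proof. by apply: eq_Rintegral => x _; exact: dotC. Qed.

Lemma ip_linr a f h u : sq f -> sq h -> sq u -> ip u (lin a f h) = a * ip u f + ip u h.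
Proof. by move=> sf sh su; rewrite ipC ip_linl // !(ipC u). Qed.

Lemma ip_ge0 f : 0 <= ip f f.
Proof. by apply: Rint_ge0 => x; exact: dot_ge0. Qed.

(** With [a = 1] and [a = -1], the parallelogram law. *)
Lemma ip_lin2 a f h : sq f -> sq h ->
  ip (lin a f h) (lin a f h) = a ^+ 2 * ip f f + 2 * a * ip f h + ip h h.
Proof.
move=> sf sh; have sl := sq_lin a sf sh.
by rewrite ip_linl // !ip_linr // (ipC h f); ring.
Qed.

Lemma ip_le u f : sq u -> sq f -> 2 * `|ip u f| <= ip u u + ip f f.
Proof.
move=> su sf; have := ip_ge0 (lin 1 u f); have := ip_ge0 (lin (-1) u f).
by rewrite !ip_lin2 //; case: (ger0P (ip u f)) => _; lra.
Qed.

Lemma geometric_cvg (a : nat -> R) (s : R) : (forall k, `|a k.+1 - a k| <= s * 2^-1 ^+ k) ->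
  exists l, a k @[k --> \oo] --> l /\ forall k, `|a k - l| <= 2 * s * 2^-1 ^+ k.
Proof.
move=> as_; have s0 : 0 <= s by have := as_ 0%N; rewrite expr0 mulr1; apply: le_trans.
pose q k : R := 2 * s * 2^-1 ^+ k.
have qS k : q k.+1 = s * 2^-1 ^+ k by rewrite /q exprS; field.
have q0 k : 0 <= q k by rewrite /q !mulr_ge0 // exprn_ge0 // invr_ge0.
have qE k : q k = 2 * q k.+1 by rewrite qS /q mulrA.
have cq : q k @[k --> \oo] --> 0.
  rewrite -[X in _ --> X](mulr0 (2 * s)); apply: cvgMr; apply: cvg_expr.
  by rewrite ger0_norm ?invr_ge0 // invf_lt1 // ltr1n.
pose b k := a k - q k; pose c k := a k + q k.
have ndb : {homo b : i j / (i <= j)%N >-> i <= j}.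
  apply/nondecreasing_seqP => k; have := as_ k; rewrite -qS ler_norml => /andP[h1 h2].
  by rewrite /b (qE k); lra.
have nic : {homo c : i j / (i <= j)%N >-> j <= i}.
  apply/nonincreasing_seqP => k; have := as_ k; rewrite -qS ler_norml => /andP[h1 h2].
  by rewrite /c (qE k); lra.
have bc k : b k <= c k by rewrite /b /c; have := q0 k; lra.
have cvb : cvgn b.
  apply: nondecreasing_is_cvgn => //; exists (c 0%N) => _ [k _ <-].
  by apply: le_trans (bc k) _; exact: nic.
pose l := limn b; exists l; have cvbl : b k @[k --> \oo] --> l by exact: cvb.
have cva : a k @[k --> \oo] --> l.
  rewrite -[X in _ --> X]addr0 (_ : a = fun k => b k + q k); first exact: cvgD.
  by apply/funext => k; rewrite /b subrK.
split => // k; rewrite -/(q k) ler_norml.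
have h1 : b k <= l by exact: nondecreasing_cvgn_le.
have cvc : c k @[k --> \oo] --> l by rewrite -[X in _ --> X]addr0; exact: cvgD.
have h2 : l <= c k.
  have -> : l = limn c by apply/esym/cvg_lim.
  by apply: nonincreasing_cvgn_ge => //; apply/cvg_ex; exists l.
by move: h1 h2; rewrite /b /c; lra.
Qed.

Lemma le_geometric (x y c : R) : (forall k, x <= y + c * 2^-1 ^+ k) -> x <= y.
Proof.
move=> H; have cv : (y + c * 2^-1 ^+ k) @[k --> \oo] --> y + c * 0.
  apply: cvgD; first exact: cvg_cst.
  by apply: cvgMr; apply: cvg_expr; rewrite ger0_norm ?invr_ge0 // invf_lt1 // ltr1n.
rewrite -[leRHS]addr0 -(mulr0 c) -(cvg_lim _ cv) //.
by apply: limr_ge; [apply/cvg_ex; exists (y + c * 0)|exact: nearW].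
Qed.

(** A sequence whose increments decay geometrically in the mean converges pointwise
    almost everywhere and in the mean: the sum [H] of the squared increments with
    weights [4 ^ k], which the rate 8^-k leaves integrable, controls both. *)
Lemma sq_complete (r : nat -> I -> X -> R) (c : R) : (forall k, sq (r k)) ->
  (forall k, ip (lin (-1) (r k) (r k.+1)) (lin (-1) (r k) (r k.+1)) <= c * 2^-1 ^+ (3 * k)) ->
  exists u, sq u /\ exists c', forall k,
    ip (lin (-1) u (r k)) (lin (-1) u (r k)) <= c' * 2^-1 ^+ (2 * k).
Proof.
move=> sr rc; pose D k x := dot (lin (-1) (r k) (r k.+1)) (lin (-1) (r k) (r k.+1)) x.
have sD k : sq (lin (-1) (r k) (r k.+1)) by exact: sq_lin.
have D0 k x : 0 <= D k x by exact: dot_ge0.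
pose w k : R := 4 ^+ k.
have w0 k : 0 < w k by rewrite exprn_gt0.
pose H x : \bar R := (\sum_(0 <= k <oo) (w k * D k x)%:E)%E.
have iwD k : integr mu (fun x => w k * D k x) by apply: integrZ; exact: (sD k).2.
have H0 x : (0 <= H x)%E by apply: nneseries_ge0 => k _ _; rewrite lee_fin mulr_ge0 // ltW.
have mwD k : measurable_fun setT (fun x => (w k * D k x)%:E).
  by apply/measurable_EFinP; exact: integr_measurable (iwD k).
have mH : measurable_fun setT H.
  apply: ge0_emeasurable_sum => //.
  by move=> k x _ _; rewrite lee_fin mulr_ge0 // ltW.
have HD k x : ((w k * D k x)%:E <= H x)%E.
  rewrite /H (@nneseriesD1 _ _ k) //; last by move=> j _; rewrite lee_fin mulr_ge0 // ltW.
  by rewrite leeDl //; apply: nneseries_ge0 => j _ _; rewrite lee_fin mulr_ge0 // ltW.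
have c0 : 0 <= c by have := rc 0%N; rewrite muln0 expr0 mulr1; apply: le_trans; exact: ip_ge0.
have iH : (\int[mu]_x H x < +oo)%E.
  rewrite integral_nneseries //; last by move=> k x _; rewrite lee_fin mulr_ge0 // ltW.
  apply: (@le_lt_trans _ _ (\sum_(0 <= k <oo) (c * 2^-1 ^+ k)%:E)%E).
    apply: lee_nneseries => [k _ _|k _].
      by apply: integral_ge0 => x _; rewrite lee_fin mulr_ge0 // ltW.
    rewrite (integr_EFin (iwD k)) lee_fin RintZ; last exact: (sD k).2.
    apply: le_trans (ler_wpM2l (ltW (w0 k)) (rc k)) _.
    rewrite le_eqVlt; apply/orP; left; apply/eqP.
    rewrite /w mulrCA; congr (_ * _).
    rewrite exprM -exprMn; congr (_ ^+ _); by field.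
  apply: (@le_lt_trans _ _ (c / (1 - 2^-1))%:E); last exact: ltry.
  apply: lime_le; first by apply: is_cvg_nneseries => k _ _; rewrite lee_fin mulr_ge0 // exprn_ge0 // invr_ge0.
  apply: nearW => m; rewrite sumEFin lee_fin.
  apply: (@geometric_le_lim R m c 2^-1 c0); first by rewrite invr_gt0.
  by rewrite ger0_norm ?invr_ge0 // invf_lt1 // ltr1n.
(* Where [H] is finite, the k-th increment is at most 2^-k times its root. *)
pose Om : set X := [set x | (H x < +oo)%E].
have mOm : measurable Om.
  rewrite -[X in measurable X]setTI; exact: emeasurable_fun_infty_o.
pose h x : R := fine (H x).
have hE x : Om x -> H x = (h x)%:E by move=> Hx; rewrite /h fineK // ge0_fin_numE.
have incr k i x : Om x -> `|r k.+1 i x - r k i x| <= Num.sqrt (h x) * 2^-1 ^+ k.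
  move=> Hx; have h0 : 0 <= h x by rewrite fine_ge0.
  rewrite -(ler_pXn2r (n := 2)) ?nnegrE // ?mulr_ge0 ?sqrtr_ge0 ?exprn_ge0 ?invr_ge0 //.
  rewrite real_normK ?num_real // exprMn sqr_sqrtr // -exprM mulnC exprM.
  have := HD k x; rewrite (hE x Hx) lee_fin => le.
  have -> : (2^-1 ^+ 2 : R) ^+ k = (w k)^-1 by rewrite /w -exprVn; congr (_ ^+ _); field.
  rewrite ler_pdivlMr // mulrC; apply: le_trans le; apply: ler_wpM2l; first exact: ltW.
  rewrite /D /dot (bigD1 i) //= /lin mulN1r (addrC (- _)) -expr2.
  by rewrite lerDl; apply: sumr_ge0 => j _; rewrite -expr2 sqr_ge0.
pose u i x : R := if `[< Om x >] then limn (fun k => r k i x) else 0.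
have uP i x : Om x -> r k i x @[k --> \oo] --> u i x /\
    forall k, `|r k i x - u i x| <= 2 * Num.sqrt (h x) * 2^-1 ^+ k.
  move=> Hx; have [l [cl bl]] := geometric_cvg (fun k => incr k i x Hx).
  by rewrite /u asboolT // (cvg_lim _ cl).
have mu_ i : measurable_fun setT (u i).
  apply: (@measurable_fun_cvg _ _ _ _ (fun k x => \1_Om x * r k i x)) => [k|x _].
    by apply: measurable_funM; [exact: measurable_indic|exact: (sr k).1].
  rewrite indicE; have [Hx|Hx] := pselect (Om x).
    by rewrite mem_set //; under eq_fun do rewrite mul1r; have [] := uP i x Hx.
  rewrite memNset //; under eq_fun do rewrite mul0r.
  by rewrite /u asboolF //; exact: cvg_cst.
pose s : R := \sum_(i : I) 1; pose a := 4 * s + 1.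
have s0 : 0 <= s by exact: sumr_ge0.
have a0 : 0 < a by rewrite ltr_wpDl // mulr_ge0.
have q0 k : 0 < (2^-1 : R) ^+ (2 * k) by rewrite exprn_gt0 // invr_gt0.
have bnd k x : ((dot (lin (-1) u (r k)) (lin (-1) u (r k)) x)%:E <= (a * 2^-1 ^+ (2 * k))%:E * H x)%E.
  have [Hx|/negP Hx] := pselect (Om x); last first.
    have -> : H x = +oo%E by apply/eqP; rewrite -leye_eq leNgt.
    by rewrite gt0_muley ?lte_fin ?mulr_gt0 // leey.
  have h0 : 0 <= h x by rewrite fine_ge0.
  rewrite hE // -EFinM lee_fin.
  apply: (@le_trans _ _ (\sum_(i : I) 4 * h x * 2^-1 ^+ (2 * k))).
    apply: ler_sum => i _; rewrite /lin mulN1r addrC -expr2 -real_normK ?num_real //.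
    apply: (@le_trans _ _ ((2 * Num.sqrt (h x) * 2^-1 ^+ k) ^+ 2)).
      by apply: lerXn2r; rewrite ?nnegrE // ?mulr_ge0 ?sqrtr_ge0 ?exprn_ge0 ?invr_ge0 //; exact: (uP i x Hx).2.
    rewrite !exprMn sqr_sqrtr // -exprM mulnC.
    by have -> : (2 : R) ^+ 2 = 4 by ring.
  have -> : \sum_(i : I) 4 * h x * 2^-1 ^+ (2 * k) = s * (4 * h x * 2^-1 ^+ (2 * k)).
    by rewrite /s mulr_suml; apply: eq_bigr => i _; rewrite mul1r.
  have := q0 k; rewrite /a; move: (2^-1 ^+ (2 * k)) => q q1.
  have -> : s * (4 * h x * q) = 4 * s * q * h x by ring.
  by apply: ler_wpM2r => //; apply: ler_wpM2r; [exact: ltW|rewrite lerDl].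
have mlin k i : measurable_fun setT (lin (-1) u (r k) i).
  by apply: measurable_funD; [apply: measurable_funM|exact: (sr k).1].
have fin k : (\int[mu]_x ((a * 2^-1 ^+ (2 * k))%:E * H x) = (a * 2^-1 ^+ (2 * k))%:E * \int[mu]_x H x)%E.
  by rewrite ge0_integralZl // lee_fin mulr_ge0 // ltW.
have iHf : (\int[mu]_x H x = (fine (\int[mu]_x H x))%:E)%E.
  by rewrite fineK // ge0_fin_numE // integral_ge0.
have bint k : (\int[mu]_x (dot (lin (-1) u (r k)) (lin (-1) u (r k)) x)%:E <=
    (a * 2^-1 ^+ (2 * k) * fine (\int[mu]_x H x))%:E)%E.
  rewrite EFinM -iHf -fin; apply: ge0_le_integral => //.
  - by move=> x _; rewrite lee_fin dot_ge0.
  - by apply/measurable_EFinP; exact: measurable_dot.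
  - by apply: emeasurable_funM.
have sql k : sq (lin (-1) u (r k)).
  split => //; apply: integr_ge0; [exact: measurable_dot|exact: dot_ge0|].
  by apply: le_lt_trans (bint k) _; exact: ltry.
exists u; split.
  have -> : u = lin (-1) (lin (-1) u (r 0%N)) (r 0%N).
    by apply/funext => i; apply/funext => x; rewrite /lin; ring.
  exact: sq_lin.
exists (a * fine (\int[mu]_x H x)%E) => k.
by have := bint k; rewrite (integr_EFin (sql k).2) lee_fin mulrAC.
Qed.

(** By the parallelogram law at the midpoint of two of its terms, a minimizing
    sequence of the distance from [F] to [V] is Cauchy; the residuals converge, and
    their limit [u] is orthogonal to [V] since no element of [V] brings them
    closer to 0. *)
Lemma sq_projection (V : set (I -> X -> R)) (F v0 : I -> X -> R) :
  (forall v, V v -> sq v) -> (forall a f h, V f -> V h -> V (lin a f h)) -> V v0 -> sq F ->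
  exists u (v_ : nat -> I -> X -> R), [/\ sq u, forall k, V (v_ k), forall v, V v -> ip u v = 0 &
    exists c, forall k, let e := lin (-1) u (lin (-1) (v_ k) F) in ip e e <= c * 2^-1 ^+ k].
Proof.
move=> Vsq Vlin V0 sF; pose S : set R := [set ip (lin (-1) v F) (lin (-1) v F) | v in V].
have S0 : has_inf S.
  split; first by exists (ip (lin (-1) v0 F) (lin (-1) v0 F)); exists v0.
  by exists 0 => _ [v _ <-]; exact: ip_ge0.
pose del := inf S.
have delP v : V v -> del <= ip (lin (-1) v F) (lin (-1) v F).
  by move=> Vv; apply: ge_inf; [exact: S0.2|exists v].
have ex k : exists v, V v /\ ip (lin (-1) v F) (lin (-1) v F) < del + 2^-1 ^+ (3 * k).
  have e0 : 0 < (2^-1 : R) ^+ (3 * k) by rewrite exprn_gt0 // invr_gt0.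
  by have [_ [v Vv <-] lt] := inf_adherent e0 S0; exists v.
have [v_ Hv] := choice ex; pose r k := lin (-1) (v_ k) F.
have sr k : sq (r k) by apply: sq_lin => //; apply: Vsq; exact: (Hv k).1.
have [|u [su [c Hc]]] := @sq_complete r 4 sr.
  move=> k; have sk := sr k; have sk1 := sr k.+1.
  have mid : 4 * del <= ip (lin 1 (r k) (r k.+1)) (lin 1 (r k) (r k.+1)).
    have Vm : V (lin 2^-1 (v_ k) (lin (- 2^-1) (v_ k.+1) (v_ k.+1))).
      apply: (Vlin _ _ _ (Hv k).1); apply: Vlin; exact: (Hv k.+1).1.
    have := delP _ Vm; set m := lin (-1) _ F => dm.
    have -> : lin 1 (r k) (r k.+1) = lin 1 m m.
      by apply/funext => i; apply/funext => x; rewrite /m /r /lin; field.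
    rewrite ip_lin2; last 2 first; try by (apply: sq_lin => //; exact: Vsq).
    by lra.
  move: mid; rewrite (ip_lin2 1 sk sk1) (ip_lin2 (-1) sk sk1) !expr1n sqrrN expr1n.
  have lt1 := (Hv k).2; have lt2 := (Hv k.+1).2; rewrite -/(r k) -/(r k.+1) in lt1 lt2.
  have : (2^-1 : R) ^+ (3 * k.+1) <= 2^-1 ^+ (3 * k).
    apply: ler_wiXn2l; rewrite ?invr_ge0 // ?invf_le1 // ?ler1n //.
    by rewrite leq_mul2l leqnSn.
  by move: (ip (r k) (r k.+1)) (ip (r k) (r k)) (ip (r k.+1) (r k.+1)) lt1 lt2 => x y z; lra.
exists u, v_; split => //.
- by move=> k; exact: (Hv k).1.
- move=> v Vv; have sv := Vsq _ Vv.
  have q1 k : (2^-1 : R) ^+ (2 * k) = 2^-1 ^+ k * 2^-1 ^+ k by rewrite mul2n -addnn exprD.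
  have q0 k : 0 < (2^-1 : R) ^+ k by rewrite exprn_gt0 // invr_gt0.
  have q2 k : (2^-1 : R) ^+ k <= 1 by rewrite exprn_ile1 ?invr_ge0 // invf_le1 // ler1n.
  (* Moving the k-th term of the sequence by [s *: v] cannot beat the infimum. *)
  have near s k : 2 * s * ip (r k) v <= 2^-1 ^+ k + s ^+ 2 * ip v v.
    have Vk : V (lin s v (v_ k)) by apply: Vlin => //; exact: (Hv k).1.
    have := delP _ Vk.
    have -> : lin (-1) (lin s v (v_ k)) F = lin (- s) v (r k).
      by apply/funext => i; apply/funext => x; rewrite /r /lin; ring.
    rewrite ip_lin2 // sqrrN mulrN mulNr (ipC v).
    have := (Hv k).2; rewrite -/(r k).
    have : (2^-1 : R) ^+ (3 * k) <= 2^-1 ^+ k.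
      by apply: ler_wiXn2l; rewrite ?invr_ge0 // ?invf_le1 // ?ler1n // leq_pmull.
    by move: (ip (r k) (r k)) (ip (r k) v) (ip v v) => x y z; lra.
  have close k : `|ip u v - ip (r k) v| <= (c + ip v v) * 2^-1 ^+ k.
    have sl : sq (lin (-1) u (r k)) by exact: sq_lin.
    have E : ip u v - ip (r k) v = - ip (lin (-1) u (r k)) v by rewrite ip_linl //; ring.
    rewrite E normrN.
    have h1 := ip_ge0 (lin (2^-1 ^+ k) v (lin (-1) u (r k))).
    have h2 := ip_ge0 (lin (- 2^-1 ^+ k) v (lin (-1) u (r k))).
    rewrite ip_lin2 // in h1; rewrite ip_lin2 // in h2; rewrite (ipC v) in h1 h2.
    have := Hc k; rewrite q1; have := q0 k; move: (2^-1 ^+ k) h1 h2 => q.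
    have := ip_ge0 v.
    move: (ip (lin (-1) u (r k)) v) (ip (lin (-1) u (r k)) (lin (-1) u (r k))) (ip v v) => x y z z0 h1 h2 qq0 yc.
    rewrite ler_norml; apply/andP; split; rewrite -(ler_pM2l qq0); nra.
  have main s : 2 * s * ip u v <= s ^+ 2 * ip v v.
    apply: (@le_geometric _ _ (1 + 2 * `|s| * (c + ip v v))) => k.
    have := near s k; have := close k; have := q0 k.
    set y := ip (r k) v; set x := ip u v; set z := ip v v; move: (2^-1 ^+ k) => q qq0 cl ns.
    have : 2 * s * (x - y) <= 2 * `|s| * ((c + z) * q).
      apply: le_trans (ler_norm _) _; rewrite !normrM ger0_norm //.
      by apply: ler_wpM2l => //; rewrite mulr_ge0.
    by move: ns; lra.
  (* The minimizer of the quadratic polynomial in [s], up to the 1 that avoids a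
     division by 0. *)
  have z0 := ip_ge0 v; have := main (ip u v / (ip v v + 1)).
  move: (ip u v) (ip v v) z0 => x z z0.
  have z1 : 0 < z + 1 by rewrite ltr_wpDl.
  have -> : 2 * (x / (z + 1)) * x = (2 * x ^+ 2 * (z + 1)) / (z + 1) ^+ 2 by field; rewrite gt_eqF.
  have -> : (x / (z + 1)) ^+ 2 * z = (x ^+ 2 * z) / (z + 1) ^+ 2 by field; rewrite gt_eqF.
  rewrite ler_pM2r ?invr_gt0 ?exprn_gt0 // => le.
  by apply/eqP; rewrite -sqrf_eq0 eq_le sqr_ge0 andbT; have := sqr_ge0 x; nra.
exists c => k /=; apply: le_trans (Hc k) _; have c0 : 0 <= c.
  by have := Hc 0%N; rewrite muln0 expr0 mulr1; apply: le_trans; exact: ip_ge0.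
apply: ler_wpM2l => //; apply: ler_wiXn2l; rewrite ?invr_ge0 // ?invf_le1 // ?ler1n //.
by rewrite leq_pmull.
Qed.

End Square_integrable.

(** * Displacing and adding mass *)

Section Frames.
Context {R : realType} {d : nat} {M : ptopologicalType} {A : smooth_atlas R d M}.
Variables (C : cubic_cover A) (m : nat).
Notation n := m.+1.
Notation T := (tangent A n).
Implicit Types (p : T) (W U : 'M[R]_(n, d)).

Lemma extd_Omega (w : tangent A m -> R) : Omega A m w -> Omega A n (extd (n := n) w).
Proof.
move=> wO.
have setE p j u : set_vec p j u =
    with_fib C p (setrow (fib C p) j (u *m to_chart (chosen_idx C (base p)) (base p))).
  rewrite /with_fib tpar_setrow -[tpar _ _]/(with_fib C p (fib C p)) with_fibK par_pos.
  by rewrite -mulmxA to_chartK ?mulmx1 //; exact: dom_chosen.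
split.
- move=> p j a u u'; rewrite !setE mulmxDl -scalemxAl.
  exact: (extd_row_linear wO (cod_pos C p)).
- move=> p j j' jj' pj; rewrite -(with_fibK C p).
  apply: (extd_row_alternating wO (cod_pos C p) jj').
  by rewrite /fib !row_mul pj.
move=> i W q; have oc : open (cod i) by exact: cod_open.
have cB : Ck_on q (cod i) (fun y => \sum_(I : {ffun 'I_m -> 'I_d})
    m`!%:R^-1 * \det (\matrix_(a, b) \sum_c W a c * bordered w i I y c b)).
  apply: Ck_sum => // I _; apply: Ck_M => //; first exact: (@Ck_cst _ _ _ _ _ (m`!%:R^-1 : R)).
  apply: Ck_det => // a b; apply: Ck_sum => // c _; apply: Ck_M => //; first exact: (@Ck_cst _ _ _ _ _ (W a c : R)).
  case: (unliftP ord0 b) => [b' ->|->].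
    by apply: (Ck_eq oc _ (Ck_cst q _ ((c == I b')%:R : R))) => y _; rewrite mxE liftK.
  apply: (Ck_eq oc _ (smooth_derive (delta_mx 0 c) (coef_smooth wO i I) q)) => y _.
  by rewrite mxE unlift_none.
apply: (Ck_eq oc) cB => y iy; rewrite extd_det // big_distrr.
by apply: eq_bigr => I _; congr (_ * \det _); apply/matrixP => a b; rewrite !mxE.
Qed.

Lemma form_with_fib_linear (w : T -> R) p : Omega A n w -> row_linear (fun W => w (with_fib C p W)).
Proof. by move=> wO; exact: form_row_linear. Qed.

Lemma form_fdiff_row (w : T -> R) p j (u : 'rV[R]_d) : Omega A n w ->
  \sum_l u 0 l * fdiff C w p j l = w (with_fib C p (setrow (fib C p) j u)).
Proof.
move=> wO; have lw := form_with_fib_linear p wO; rewrite (row_linear_coord lw).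
by apply: eq_bigr => l _; rewrite (fdiff_row_linear (form_smooth wO) lw).
Qed.

(** Only one vector is moved at a time, so that forms, being linear in each vector,
    are affine in [t]. The factor [n] compensates the average over
    [j]. *)
Definition row_part j U : 'M[R]_(n, d) := \matrix_(a, l) if a == j then n%:R * U a l else 0.

Lemma form_shift (w : T -> R) p j U t : Omega A n w ->
  w (with_fib C p (fib C p + t *: row_part j U)) = w p + t * (n%:R * \sum_l U j l * fdiff C w p j l).
Proof.
move=> wO; have lw := form_with_fib_linear p wO.
have -> : fib C p + t *: row_part j U = setrow (fib C p) j (row j (fib C p) + (t * n%:R) *: row j U).
  apply/matrixP => a l; rewrite !mxE; case: eqP => [->|_]; first by rewrite mulrA.
  by rewrite mulr0 addr0.
rewrite (row_linear_shift lw) with_fibK -mulrA; congr (_ + _ * (_ * _)).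
rewrite -form_fdiff_row //; apply: eq_bigr => l _; by rewrite mxE.
Qed.

(** The two orientations of each frame allow masses, which are positive, to
    represent coefficients of either sign. *)
Definition oframe (Is : {ffun 'I_n -> 'I_d} * bool) : 'M[R]_(n, d) :=
  setrow (frame R Is.1) ord0 ((-1) ^+ Is.2 *: row ord0 (frame R Is.1)).

Lemma oframe_le Is : entries_le (oframe Is) 1.
Proof.
move=> a l; rewrite !mxE; case: ifP => _; last by case: (l == _); rewrite ?normr1 ?normr0.
by rewrite normrM normrX normrN1 expr1n mul1r; case: (l == _); rewrite ?normr1 ?normr0.
Qed.

Lemma form_oframe (w : T -> R) p Is : Omega A n w ->
  w (with_fib C p (oframe Is)) = (-1) ^+ Is.2 * w (with_fib C p (frame R Is.1)).
Proof.
by move=> wO; rewrite (row_linearZ (form_with_fib_linear p wO)) setrow_id.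
Qed.

(** Mass to be put on the oriented frames so that they represent, on n-forms, the
    derivative in the direction [U j] of the j-th vector. *)
Definition minor U p j (Is : {ffun 'I_n -> 'I_d} * bool) : R :=
  n`!%:R^-1 * Num.max ((-1) ^+ Is.2 * \det (colsub Is.1 (setrow (fib C p) j (row j U)))) 0.

Lemma minor_ge0 U p j Is : 0 <= minor U p j Is.
Proof. by rewrite mulr_ge0 ?invr_ge0 // le_max lexx orbT. Qed.

(** The derivative of [w] along [U] is a sum of values of [w] with one row replaced
    ([form_fdiff_row]), to which [alternating_expand] applies. *)
Lemma form_minor (w : T -> R) p U : Omega A n w ->
  mdot U (fdiff C w p) = \sum_j \sum_Is minor U p j Is * w (with_fib C p (oframe Is)).
Proof.
move=> wO; apply: eq_bigr => j _.
have -> : \sum_l U j l * fdiff C w p j l = \sum_l (row j U) 0 l * fdiff C w p j l.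
  by apply: eq_bigr => l _; rewrite [row j U 0 l]mxE.
rewrite form_fdiff_row //.
have alt : row_alternating (fun W => w (with_fib C p W)) by exact: form_row_alternating.
rewrite (alternating_expand (form_with_fib_linear p wO) alt) mulr_sumr.
rewrite -(pair_bigA_idem _ (fun I s => minor U p j (I, s) * w (with_fib C p (oframe (I, s))))) ?addr0 //=; last exact: addr0.
apply: eq_bigr => I _; rewrite big_bool /= !form_oframe //= /minor /= expr0 expr1 !mul1r !mulN1r.
set x := \det _; set y := w _; case: (lerP 0 x) => x0.
  by rewrite (max_r (_ : - x <= 0)) ?oppr_le0 //; ring.
by rewrite (max_l (_ : 0 <= - x)) ?oppr_ge0 ?ltW //; ring.
Qed.

Lemma minor_sum U p j I : minor U p j (I, false) + minor U p j (I, true) =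
  n`!%:R^-1 * `|\det (colsub I (setrow (fib C p) j (row j U)))|.
Proof.
rewrite /minor /= expr0 expr1 mul1r mulN1r -mulrDr; congr (_ * _); set x := \det _.
case: (lerP 0 x) => x0; first by rewrite (max_r (_ : - x <= 0)) ?oppr_le0 // addr0 ger0_norm.
by rewrite (max_l (_ : 0 <= - x)) ?oppr_ge0 ?ltW // add0r ltr0_norm.
Qed.

Lemma measurable_minor (U : T -> 'M[R]_(n, d)) j Is : hausdorff_space M ->
  (forall a l, measurable_fun setT (fun p : borel A n => U p a l)) ->
  measurable_fun setT (fun p : borel A n => minor (U p) p j Is).
Proof.
move=> hM mU; apply: measurable_funM => //; apply: measurable_maxr => //.
apply: measurable_funM => //; apply: measurable_sum => s.
apply: measurable_funM => //; apply: measurable_prod => a _.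
have [E|E] := eqVneq a j.
  by apply: eq_measurable_fun (mU a (Is.1 (s a))) => p _; rewrite !mxE E eqxx.
by apply: eq_measurable_fun (measurable_fib C hM a (Is.1 (s a))) => p _; rewrite [RHS]mxE [RHS]mxE (negPf E).
Qed.

Lemma mdot_le U W (a b : R) : entries_le U a -> entries_le W b ->
  `|mdot U W| <= \sum_(j < n) \sum_(l < d) a * b.
Proof.
move=> Ua Wb; apply: le_trans (ler_norm_sum _ _ _) _; apply: ler_sum => j _.
apply: le_trans (ler_norm_sum _ _ _) _; apply: ler_sum => l _.
by rewrite normrM; apply: ler_pM.
Qed.

Lemma fdiff_lin (f h : T -> R) (a : R) p : smooth_fun f -> smooth_fun h ->
  fdiff C (fun q => a * f q + h q) p = a *: fdiff C f p + fdiff C h p.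
Proof.
move=> sf sh; apply/matrixP => j l.
have df (f' : T -> R) : smooth_fun f' -> derivable (f' \o @tpar _ _ _ A n (chosen_idx C (base p)))
    (pos C p, fib C p) ((0, delta_mx j l) : 'rV[R]_d * 'M[R]_(n, d)).
  by move=> sf'; apply: diff_derivable; apply: smooth_differentiable (sf' _) _; exact: cod_pos.
have h1 := is_deriveD (is_deriveZ a (derivableP (df _ sf))) (derivableP (df _ sh)).
rewrite [RHS]mxE [X in _ = X + _]mxE !fdiff_chart; case: h1 => _ E; exact: E.
Qed.

End Frames.

(** * The variation attached to a pair of fields *)

Section Variations.
Context {R : realType} {d : nat} {M : ptopologicalType} {A : smooth_atlas R d M}.
Variables (g : riemannian A) (C : cubic_cover A) (m : nat).
Hypothesis hM : hausdorff_space M.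
Notation n := m.+1.
Notation T := (tangent A n).
Notation X := (borel A n).
Implicit Types (p : T) (W U : 'M[R]_(n, d)) (f : T -> R).
Variable mu : {measure set X -> \bar R}.
Hypothesis mu_hol : holonomic g mu.

Lemma integr_cst (c : R) : integr mu (fun=> c).
Proof.
apply/integrableP; split; first exact: measurable_cst.
by have [_ mT _] := mu_hol; rewrite integral_cst //= mT mule1 ltry.
Qed.

Lemma Rint_cst_mu (c : R) : \int[mu]_p c = c.
Proof. by have [_ mT _] := mu_hol; rewrite Rintegral_cst // mT mulr1. Qed.

Lemma integr_bounded f (B : R) : measurable_fun setT (f : X -> R) -> (forall p, `|f p| <= B) -> integr mu f.
Proof. by move=> mf fB; apply: (integr_le mf fB); exact: integr_cst. Qed.

Lemma integr_form (w : T -> R) : Omega A n w -> integr mu w.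
Proof.
move=> wO; have [c c0 Hc] := form_le_voln g C wO; have [mild _ _] := mu_hol.
have mw := measurable_smooth (form_smooth wO).
have i1 : integr mu (fun p => `|w p| / c).
  apply: integr_ge0 => [|p|]; first by apply: measurable_funM => //; exact: measurableT_comp.
    by rewrite divr_ge0 // ltW.
  apply: le_lt_trans mild; apply: ge0_le_integral => //.
  - by move=> p _; rewrite lee_fin divr_ge0 // ltW.
  - by apply/measurable_EFinP; apply: measurable_funM => //; exact: measurableT_comp.
  - exact: measurable_voln.
apply: (integr_le mw) (integrZ c i1) => p.
by rewrite mulrC divfK ?gt_eqF.
Qed.

Lemma integr_test f : test_fun f -> integr mu f.
Proof.
move=> [sf [K cK f0]]; have [b Hb] := compact_fib g C cK.
have [B B0 HB] := bounded_fib C b sf.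
apply: (integr_bounded (B := B)); first exact: measurable_smooth.
move=> p; have [Kp|nKp] := pselect (K p); first exact: HB (Hb p Kp).
by rewrite f0 // normr0.
Qed.

(** [mu] is displaced along [u1], and masses are added that represent [u2]; by
    [balance] the two effects on exact forms cancel. *)
Variables (u1 u2 : T -> 'M[R]_(n, d)) (b : R).
Hypothesis mu1 : forall j l, measurable_fun setT (fun p : X => u1 p j l).
Hypothesis mu2 : forall j l, measurable_fun setT (fun p : X => u2 p j l).
Hypothesis u1b : forall p, entries_le (u1 p) b.
Hypothesis u10 : forall p, ~ entries_le (fib C p) b -> u1 p = 0.
Hypothesis b0 : 0 <= b.

Definition cost p : R := \sum_j \sum_Is minor C (u2 p) p j Is.

Hypothesis icost : integr mu cost.
Hypothesis balance : forall w, Omega A m w ->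
  \int[mu]_p mdot (u1 p) (fdiff C (extd (n := n) w) p) +
  \int[mu]_p mdot (u2 p) (fdiff C (extd (n := n) w) p) = 0.

Notation K := (\int[mu]_p cost p).
Notation index := ('I_n + 'I_n * ({ffun 'I_n -> 'I_d} * bool))%type.

(** One branch per displaced vector and one per oriented frame and row. The factor
    [(1 + t * K)^-1] compensates the mass [t * K] that has been added. *)
Definition weight (t : R) (i : index) (p : X) : R :=
  match i with
  | inl j => (1 + t * K)^-1 * n%:R^-1
  | inr (j, Is) => (1 + t * K)^-1 * t * minor C (u2 p) p j Is
  end.

Definition displace (t : R) (j : 'I_n) p : T := with_fib C p (fib C p + t *: row_part j (u1 p)).

Definition target (t : R) (i : index) (p : X) : X :=
  match i with
  | inl j => displace t j p
  | inr (j, Is) => with_fib C p (@oframe R d m Is)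
  end.

Lemma cost_ge0 p : 0 <= cost p.
Proof. by apply: sumr_ge0 => j _; apply: sumr_ge0 => Is _; exact: minor_ge0. Qed.

Lemma K_ge0 : 0 <= K.
Proof. by apply: Rint_ge0 => p; exact: cost_ge0. Qed.

Lemma den_gt0 t : 0 <= t -> 0 < 1 + t * K.
Proof. by move=> t0; rewrite ltr_wpDr // mulr_ge0 // K_ge0. Qed.

Lemma measurable_minor2 j Is : measurable_fun setT (fun p : X => minor C (u2 p) p j Is).
Proof. exact: measurable_minor. Qed.

Lemma integr_minor j Is : integr mu (fun p => minor C (u2 p) p j Is).
Proof.
apply: (integr_le (measurable_minor2 j Is)) icost => p.
rewrite ger0_norm ?minor_ge0 // /cost (bigD1 j) //= (bigD1 Is) //= -addrA lerDl addr_ge0 //.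
  by apply: sumr_ge0 => Is' _; exact: minor_ge0.
by apply: sumr_ge0 => j' _; apply: sumr_ge0 => Is' _; exact: minor_ge0.
Qed.

Lemma measurable_weight t i : measurable_fun setT (weight t i).
Proof.
case: i => [j|[j Is]]; first exact: measurable_cst.
by apply: measurable_funM => //; exact: measurable_minor2.
Qed.

Lemma weight_ge0 t i p : 0 <= t -> 0 <= weight t i p.
Proof.
move=> t0; have D0 := ltW (den_gt0 t0); case: i => [j|[j Is]] /=.
  by rewrite mulr_ge0 ?invr_ge0.
by apply: mulr_ge0; [apply: mulr_ge0; rewrite ?invr_ge0|exact: minor_ge0].
Qed.

Lemma measurable_target t i : measurable_fun setT (target t i).
Proof.
case: i => [j|[j Is]]; last by apply: measurable_with_fib => // a l; exact: measurable_cst.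
apply: measurable_with_fib => // a l.
have [E|E] := eqVneq a j.
  apply: (eq_measurable_fun (fun p : X => fib C p a l + t * (n%:R * u1 p a l))).
    by move=> p _; rewrite !mxE E eqxx.
  apply: measurable_funD; first exact: measurable_fib.
  by do 2 apply: measurable_funM => //.
apply: eq_measurable_fun (measurable_fib C hM a l) => p _.
by rewrite [RHS]mxE [X in _ = _ + X]mxE [X in _ = _ + _ * X]mxE (negPf E) mulr0 addr0.
Qed.

Lemma row_part_le p j : entries_le (row_part j (u1 p)) (n%:R * b).
Proof.
move=> a l; rewrite mxE; case: ifP => _; last by rewrite normr0 mulr_ge0.
by rewrite normrM normr_nat; apply: ler_wpM2l => //; exact: u1b.
Qed.

Lemma displace_still t j p : ~ entries_le (fib C p) b -> displace t j p = p.
Proof.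
move=> /u10 u0; rewrite /displace; have -> : row_part j (u1 p) = 0.
  by apply/matrixP => a l; rewrite !mxE u0 mxE mulr0 if_same.
by rewrite scaler0 addr0 with_fibK.
Qed.

Lemma displace_fib t j p : 0 <= t -> entries_le (fib C p) b ->
  entries_le (fib C (displace t j p)) (b + t * (n%:R * b)).
Proof.
move=> t0 pb a l; rewrite fib_with_fib mxE; apply: le_trans (ler_normD _ _) _.
apply: lerD; first exact: pb.
rewrite mxE normrM ger0_norm //; apply: ler_wpM2l => //; exact: row_part_le.
Qed.

Lemma displace0 j p : displace 0 j p = p.
Proof. by rewrite /displace scale0r addr0 with_fibK. Qed.

Section Transported_integrals.
Variable f : T -> R.
Hypothesis sf : smooth_fun f.
Hypothesis iF : integr mu f.

Lemma measurable_displace t j : measurable_fun setT (fun p : X => f (displace t j p)).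
Proof.
exact: (measurableT_comp (measurable_smooth sf) (measurable_target t (inl j))).
Qed.

Lemma integr_displace t j : 0 <= t -> integr mu (fun p => f (displace t j p)).
Proof.
move=> t0; have [B B0 HB] := bounded_fib C (b + t * (n%:R * b)) sf.
apply: (integr_le (measurable_displace t j)) (integrD (integr_norm iF) (integr_cst B)) => p.
have [pb|npb] := pselect (entries_le (fib C p) b).
  by apply: le_trans (HB _ (displace_fib j t0 pb)) _; rewrite lerDr.
by rewrite displace_still // lerDl.
Qed.

Lemma integr_frame j Is : integr mu (fun p => minor C (u2 p) p j Is * f (with_fib C p (@oframe R d m Is))).
Proof.
have [B B0 HB] := bounded_fib C 1 sf.
apply: (@integr_le _ X R mu _ (fun p : X => B * minor C (u2 p) p j Is)).
- apply: measurable_funM; first exact: measurable_minor2.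
  exact: (measurableT_comp (measurable_smooth sf) (measurable_target 0 (inr (j, Is)))).
- move=> p; rewrite normrM ger0_norm ?minor_ge0 // mulrC; apply: ler_wpM2r; first exact: minor_ge0.
  by apply: HB; rewrite fib_with_fib; exact: oframe_le.
by apply: integrZ; exact: integr_minor.
Qed.

Definition displaced t : R := n%:R^-1 * \sum_j \int[mu]_p f (displace t j p).
Definition framed : R :=
  \sum_j \sum_Is \int[mu]_p (minor C (u2 p) p j Is * f (with_fib C p (@oframe R d m Is))).

Lemma integr_transport t i : 0 <= t -> integr mu (fun p => weight t i p * f (target t i p)).
Proof.
move=> t0; case: i => [j|[j Is]] /=; first by apply: integrZ; exact: integr_displace.
rewrite (_ : (fun p => _) = (fun p => (1 + t * K)^-1 * t *
   (minor C (u2 p) p j Is * f (with_fib C p (@oframe R d m Is))))).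
  by apply: integrZ; exact: integr_frame.
by apply/funext => p; exact/esym/mulrA.
Qed.

Lemma transport_integral t (nu : {measure set X -> \bar R}) : 0 <= t ->
  transports mu nu (weight t) (target t) ->
  integr nu f /\ \int[nu]_p f p = (1 + t * K)^-1 * (displaced t + t * framed).
Proof.
move=> t0 tr; have [inu ->] := transports_integr (measurable_weight t)
  (measurable_target t) tr (measurable_smooth sf)
  (fun i => integr_transport i t0).
split => //; rewrite big_sumType /= mulrDr; congr (_ + _).
  rewrite /displaced mulrA mulr_sumr; apply: eq_bigr => j _.
  by rewrite RintZ //; exact: integr_displace.
transitivity (\sum_j \sum_Is \int[mu]_p ((1 + t * K)^-1 * t * minor C (u2 p) p j Is *
   f (with_fib C p (@oframe R d m Is)))).
  by rewrite pair_bigA /=; apply: eq_bigr => -[j Is].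
rewrite /framed mulrA !mulr_sumr; apply: eq_bigr => j _; rewrite mulr_sumr; apply: eq_bigr => Is _.
rewrite -(RintZ _ (integr_frame j Is)).
by apply: eq_Rintegral => p _; rewrite mulrA.
Qed.

Definition fdiff_mean : R := \int[mu]_p mdot (u1 p) (fdiff C f p).

Lemma fdiff_u1_le : exists B, forall p, `|mdot (u1 p) (fdiff C f p)| <= B.
Proof.
have [B B0 HB] := bounded_fdiff C b sf; exists (\sum_(j < n) \sum_(l < d) b * B) => p.
have [pb|npb] := pselect (entries_le (fib C p) b).
  by apply: mdot_le; [exact: u1b|exact: HB].
rewrite u10 // (_ : mdot _ _ = 0) ?normr0; last first.
  by apply: big1 => j _; apply: big1 => l _; rewrite mxE mul0r.
by apply: sumr_ge0 => j _; apply: sumr_ge0 => l _; exact: mulr_ge0.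
Qed.

Lemma measurable_mdot (u : T -> 'M[R]_(n, d)) :
  (forall j l, measurable_fun setT (fun p : X => u p j l)) ->
  measurable_fun setT (fun p : X => mdot (u p) (fdiff C f p)).
Proof.
move=> mU; apply: measurable_sum => j; apply: measurable_sum => l.
by apply: measurable_funM => //; exact: measurable_fdiff.
Qed.

Lemma integr_fdiff_u1 : integr mu (fun p => mdot (u1 p) (fdiff C f p)).
Proof. by have [B HB] := fdiff_u1_le; apply: integr_bounded HB; exact: measurable_mdot. Qed.

Lemma displaced0 : displaced 0 = \int[mu]_p f p.
Proof.
rewrite /displaced; under eq_bigr => j _ do under eq_Rintegral => p _ do rewrite displace0.
by rewrite sumr_const card_ord -[X in _ * X]mulr_natl mulrA mulVf ?mul1r // pnatr_eq0.
Qed.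

(** Differentiation under the integral: by the mean value theorem the difference
    quotients are bounded on the support of [u1] and vanish elsewhere. *)
Lemma displaced_derivative : (displaced t - displaced 0) / t @[t --> 0^'+] --> fdiff_mean.
Proof.
have [B B0 HB] := bounded_fdiff C (b + n%:R * b) sf.
pose c : R := \sum_(j < n) \sum_(l < d) n%:R * b * B.
have c0 : 0 <= c by apply: sumr_ge0 => j _; apply: sumr_ge0 => l _; rewrite !mulr_ge0.
pose q j t p := (f (displace t j p) - f p) / t.
have dq p j (t : R) : is_derive t 1 (fun s => f (displace s j p))
    (mdot (row_part j (u1 p)) (fdiff C f (displace t j p))).
  exact: is_derive_with_fib.
have cj j : integr mu (fun p => mdot (row_part j (u1 p)) (fdiff C f p)) /\
    \int[mu]_p q j t p @[t --> 0^'+] --> \int[mu]_p mdot (row_part j (u1 p)) (fdiff C f p).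
  apply: (@Rint_cvg_right _ _ _ mu (q j) (fun p => mdot (row_part j (u1 p)) (fdiff C f p)) (fun=> c)).
  - move=> t; apply: measurable_funM => //; apply: measurable_funB; first exact: measurable_displace.
    exact: measurable_smooth.
  - move=> p; have := dq p j 0; rewrite displace0 => -[dd <-].
    have cF : h^-1 *: (f (displace (h *: 1 + 0) j p) - f (displace 0 j p)) @[h --> (0 : R)^'] -->
      'D_1 (fun s : R => f (displace s j p)) 0 by exact: dd.
    have cr : (0 : R)^'+ --> (0 : R)^'.
      by move=> B' [e e0 He]; exists e => // y ye y0; apply: He => //; rewrite gt_eqF.
    apply: cvg_trans (cvg_trans (cvg_app _ cr) cF); apply: near_eq_cvg; apply: nearW => h.
    by rewrite displace0 addr0 -[h *: 1]/(h * 1) mulr1 /q -[LHS]/(h^-1 * _) mulrC.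
  - exact: integr_cst.
  - move=> t p /andP[t0 t1].
    have [pb|npb] := pselect (entries_le (fib C p) b); last first.
      by rewrite /q displace_still // subrr mul0r normr0.
    have cw : {within `[0, t], continuous (fun s => f (displace s j p))}.
      by apply: derivable_within_continuous => s _; have [] := dq p j s.
    have [s s01 E] := @MVT_segment R (fun s => f (displace s j p))
      (fun s => mdot (row_part j (u1 p)) (fdiff C f (displace s j p))) 0 t (ltW t0)
      (fun s _ => dq p j s) cw.
    move: E; rewrite displace0 subr0 => E.
    rewrite /q E mulfK ?gt_eqF //; move: s01; rewrite in_itv /= => /andP[s0 st].
    apply: mdot_le; first exact: row_part_le.
    apply: HB => a l; apply: le_trans (displace_fib j s0 pb a l) _.
    rewrite lerD2l ler_piMl ?mulr_ge0 //; exact: le_trans st (ltW t1).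
have E t : displaced t - displaced 0 = n%:R^-1 * \sum_j (\int[mu]_p f (displace t j p) - \int[mu]_p f p).
  rewrite sumrB mulrBr; congr (_ - _); rewrite /displaced; congr (_ * _); apply: eq_bigr => j _.
  by apply: eq_Rintegral => p _; rewrite displace0.
have -> : fdiff_mean = n%:R^-1 * \sum_j \int[mu]_p mdot (row_part j (u1 p)) (fdiff C f p).
  transitivity (\int[mu]_p (n%:R^-1 * \sum_j mdot (row_part j (u1 p)) (fdiff C f p))).
    apply: eq_Rintegral => p _; rewrite /mdot mulr_sumr; apply: eq_bigr => j _.
    rewrite (bigD1 j) //= [X in _ + X]big1 ?addr0 => [|a aj]; last first.
      by rewrite big1 // => l _; rewrite mxE (negPf aj) mul0r.
    rewrite mulr_sumr; apply: eq_bigr => l _; rewrite [row_part j (u1 p) j l]mxE eqxx.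
    by rewrite !mulrA mulVf ?mul1r // pnatr_eq0.
  by rewrite RintZ ?Rint_sum // => [j _|]; [|apply: integr_sum => j _]; case: (cj j).
have cs : n%:R^-1 * \sum_j \int[mu]_p q j t p @[t --> 0^'+] -->
    n%:R^-1 * \sum_j \int[mu]_p mdot (row_part j (u1 p)) (fdiff C f p).
  by apply: cvgMr; apply: cvg_sumr => j _; case: (cj j).
apply: cvg_trans cs; apply: near_eq_cvg; near=> t.
have t0 : 0 < t by [].
rewrite E -mulrA mulr_suml; congr (_ * _); apply: eq_bigr => j _.
rewrite -RintB //; last exact: integr_displace (ltW t0).
rewrite mulrC -RintZ; last by apply: integrB => //; exact: integr_displace (ltW t0).
by apply: eq_Rintegral => p _; rewrite mulrC.
Unshelve. all: by end_near.
Qed.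

(** The last term is the derivative of the normalizing factor. *)
Definition eta : R := fdiff_mean + framed - K * \int[mu]_p f p.

Lemma transport_derivative (nu : R -> {measure set X -> \bar R}) :
  (forall t, 0 <= t -> transports mu (nu t) (weight t) (target t)) ->
  right_derivative0 (fun t => \int[nu t]_p f p) eta.
Proof.
move=> tr; rewrite /right_derivative0.
have E t : 0 <= t -> \int[nu t]_p f p = (1 + t * K)^-1 * (displaced t + t * framed).
  by move=> t0; have [] := transport_integral t0 (tr t t0).
have E0 : \int[nu 0]_p f p = \int[mu]_p f p.
  by rewrite E // !mul0r !addr0 invr1 mul1r displaced0.
have cinv : (1 + t * K)^-1 @[t --> 0^'+] --> (1 : R).
  have ct : 1 + t * K @[t --> 0^'+] --> 1 + 0 * K.
    apply: cvgD; first exact: cvg_cst.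
    by apply: cvgMl; exact: cvg_at_right_filter cvg_id.
  rewrite mul0r addr0 in ct; rewrite -[X in _ --> X]invr1.
  by apply: cvgV => //; exact: oner_neq0.
have cv : (1 + t * K)^-1 * ((displaced t - displaced 0) / t + framed - K * \int[mu]_p f p)
    @[t --> 0^'+] --> 1 * eta.
  apply: cvgM => //; apply: cvgB; last exact: cvg_cst.
  by apply: cvgD; [exact: displaced_derivative|exact: cvg_cst].
rewrite mul1r in cv; apply: cvg_trans cv; apply: near_eq_cvg; near=> t.
have t0 : 0 < t by [].
rewrite (E _ (ltW t0)) E0 displaced0; have D0 := den_gt0 (ltW t0).
by field; rewrite !gt_eqF.
Unshelve. all: by end_near.
Qed.

End Transported_integrals.

Lemma K_sum : K = \sum_j \sum_Is \int[mu]_p minor C (u2 p) p j Is.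
Proof.
rewrite /cost Rint_sum => [|j _]; last by apply: integr_sum => Is _; exact: integr_minor.
by apply: eq_bigr => j _; rewrite Rint_sum // => Is _; exact: integr_minor.
Qed.

Lemma framed_le f (B : R) : smooth_fun f ->
  (forall p, entries_le (fib C p) 1 -> `|f p| <= B) -> `|framed f| <= B * K.
Proof.
move=> sf fB; rewrite K_sum mulr_sumr; apply: le_trans (ler_norm_sum _ _ _) _.
apply: ler_sum => j _; rewrite mulr_sumr; apply: le_trans (ler_norm_sum _ _ _) _.
apply: ler_sum => Is _; rewrite -(RintZ _ (integr_minor j Is)).
apply: Rint_norm_le; first exact: integr_frame.
  by apply: integrZ; exact: integr_minor.
move=> p; rewrite normrM ger0_norm ?minor_ge0 // mulrC; apply: ler_wpM2r; first exact: minor_ge0.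
by apply: fB; rewrite fib_with_fib; exact: oframe_le.
Qed.

Lemma eta_lin (a : R) f h : smooth_fun f -> smooth_fun h -> integr mu f -> integr mu h ->
  eta (fun p => a * f p + h p) = a * eta f + eta h.
Proof.
move=> sf sh iF ih.
have E1 : fdiff_mean (fun p => a * f p + h p) = a * fdiff_mean f + fdiff_mean h.
  rewrite /fdiff_mean -RintZ; last exact: integr_fdiff_u1.
  rewrite -RintD; first last.
  - exact: integr_fdiff_u1.
  - by apply: integrZ; exact: integr_fdiff_u1.
  apply: eq_Rintegral => p _; rewrite fdiff_lin // /mdot mulr_sumr -big_split.
  apply: eq_bigr => j _; rewrite mulr_sumr -big_split; apply: eq_bigr => l _ /=.
  by rewrite !mxE; ring.
have E2 : framed (fun p => a * f p + h p) = a * framed f + framed h.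
  rewrite /framed mulr_sumr -big_split; apply: eq_bigr => j _.
  rewrite mulr_sumr -big_split; apply: eq_bigr => Is _ /=.
  rewrite -(RintZ _ (integr_frame sf j Is)) -RintD; first last.
  - exact: integr_frame.
  - by apply: integrZ; exact: integr_frame.
  by apply: eq_Rintegral => p _; ring.
have E3 : \int[mu]_p (a * f p + h p) = a * (\int[mu]_p f p) + \int[mu]_p h p.
  by rewrite RintD //; [rewrite RintZ|exact: integrZ].
have lem (x y z v k i j : R) :
  a * x + y + (a * z + v) - k * (a * i + j) = a * (x + z - k * i) + (y + v - k * j) by ring.
by rewrite /eta E1 E2 E3; exact: lem.
Qed.

(** [eta] sees only the values of [f] and its first derivatives along the fibres
    where [u1] does not vanish. *)
Lemma eta_small : exists2 c, 0 <= c & forall f e, smooth_fun f -> integr mu f -> 0 <= e ->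
  (forall p, `|f p| <= e) ->
  (forall p, entries_le (fib C p) b -> entries_le (fdiff C f p) e) -> `|eta f| <= c * e.
Proof.
pose s : R := \sum_(j < n) \sum_(l < d) b.
have s0 : 0 <= s by apply: sumr_ge0 => j _; exact: sumr_ge0.
have K0 := K_ge0; exists (s + K + K) => [|f e sf iF e0 fe dfe]; first by rewrite !addr_ge0.
have h1 : `|fdiff_mean f| <= s * e.
  rewrite -(Rint_cst_mu (s * e)); apply: Rint_norm_le; [exact: integr_fdiff_u1|exact: integr_cst|].
  move=> p; have [pb|npb] := pselect (entries_le (fib C p) b).
    apply: le_trans (mdot_le (u1b p) (dfe p pb)) _.
    by rewrite /s mulr_suml; apply: ler_sum => j _; rewrite mulr_suml.
  rewrite u10 // (_ : mdot _ _ = 0) ?normr0 ?mulr_ge0 //.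
  by apply: big1 => j _; apply: big1 => l _; rewrite mxE mul0r.
have h2 := framed_le sf (fun p _ => fe p).
have h3 : `|\int[mu]_p f p| <= e.
  by rewrite -[leRHS](Rint_cst_mu e); apply: Rint_norm_le => //; exact: integr_cst.
rewrite /eta; apply: le_trans (ler_normB _ _) _.
rewrite !mulrDl; apply: lerD; last by rewrite normrM ger0_norm // ler_wpM2l.
by apply: le_trans (ler_normD _ _) _; apply: lerD => //; rewrite mulrC.
Qed.

Lemma eta_continuous (f : nat -> T -> R) : (forall k, test_fun (f k)) -> test_cvg0 f ->
  eta (f k) @[k --> \oo] --> (0 : R).
Proof.
move=> tf [[K0 cK0 f0] cf]; have [b' Hb'] := compact_fib g C cK0.
pose B := `|b'| + b.
have bB (p : T) : entries_le (fib C p) b -> entries_le (fib C p) B.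
  by move=> pb j l; apply: le_trans (pb j l) _; rewrite lerDr.
have b'B (p : T) : entries_le (fib C p) b' -> entries_le (fib C p) B.
  by move=> pb j l; apply: le_trans (pb j l) _; apply: le_trans (ler_norm _) _; rewrite lerDl.
have [c c0 Hc] := eta_small.
apply/cvgr0Pnorm_le => e e0; pose e1 := e / (c + 1).
have c1 : 0 < c + 1 by rewrite ltr_wpDl.
have e10 : 0 < e1 by rewrite divr_gt0.
have near0 (k : 'I_(csize C)) := cf (cidx k) _ (@fibre_box_compact _ _ _ _ C n k B)
  (@fibre_box_tcod _ _ _ _ C n k B).
have N0 : \forall q \near \oo, forall k z, fibre_box (C := C) k B z ->
    `|(f q \o @tpar _ _ _ A n (cidx k)) z| <= e1.
  by apply: filter_forall => k; exact: (near0 k [::] e1 e10).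
have N1 : \forall q \near \oo, forall k (jl : 'I_n * 'I_d) z, fibre_box (C := C) k B z ->
    `|'D_((0, delta_mx jl.1 jl.2) : 'rV[R]_d * 'M[R]_(n, d)) (f q \o @tpar _ _ _ A n (cidx k)) z| <= e1.
  apply: filter_forall => k; apply: filter_forall => jl.
  exact: (near0 k [:: ((0, delta_mx jl.1 jl.2) : 'rV[R]_d * 'M[R]_(n, d))] e1 e10).
near=> q.
have H0 : forall k z, fibre_box (C := C) k B z -> `|(f q \o @tpar _ _ _ A n (cidx k)) z| <= e1.
  by near: q.
have H1 : forall k (jl : 'I_n * 'I_d) z, fibre_box (C := C) k B z ->
    `|'D_((0, delta_mx jl.1 jl.2) : 'rV[R]_d * 'M[R]_(n, d)) (f q \o @tpar _ _ _ A n (cidx k)) z| <= e1.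
  by near: q.
have [sf _] := tf q.
apply: (@le_trans _ _ (c * e1)); last first.
  by rewrite /e1 mulrA ler_pdivrMr // mulrC ler_pM2l // lerDl.
apply: Hc => //; [exact: integr_test|exact: ltW| |].
- move=> p; have [Kp|nKp] := pselect (K0 p); last by rewrite f0 // normr0 ltW.
  by have := H0 _ _ (fibre_boxP (b'B p (Hb' p Kp))); rewrite /= -[tpar _ _]/(with_fib C p (fib C p)) with_fibK.
by move=> p pb j l; rewrite fdiff_chart; exact: (H1 _ (j, l) _ (fibre_boxP (bB p pb))).
Unshelve. all: by end_near.
Qed.

Lemma eta_distribution : distribution_on eta.
Proof.
split; last exact: eta_continuous.
move=> a f h tf th; have [sf _] := tf; have [sh _] := th.
by apply: eta_lin => //; exact: integr_test.
Qed.

(** Distant shells meet neither the support of [u1] nor the frames, so only the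
    normalizing term remains. *)
Lemma eta_shell (w : T -> R) : Omega A n w -> exists k0, forall k, (k0 <= k)%N ->
  `|eta (fun p => shell g k p * w p)| <= K * \int[mu]_p (shell g k p * `|w p|).
Proof.
move=> wO; have sw := form_smooth wO.
have [k0 Hk0] := shell_near0 g C n (b + 1); exists k0 => k k0k.
have near0 p c : 0 <= c <= b + 1 -> entries_le (fib C p) c -> \forall q \near p, shell g k q * w q = 0.
  move=> /andP[_ cb] pc; have : entries_le (fib C p) (b + 1).
    by move=> j l; apply: le_trans (pc j l) cb.
  by move=> /Hk0; apply: filterS => q /(_ k k0k) ->; rewrite mul0r.
have E1 : fdiff_mean (fun p => shell g k p * w p) = 0.
  rewrite -[RHS](Rint_cst_mu 0); apply: eq_Rintegral => p _.
  apply: big1 => j _; apply: big1 => l _.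
  have [pb|npb] := pselect (entries_le (fib C p) b); last by rewrite u10 // mxE mul0r.
  rewrite (@fdiff_near0 _ _ _ _ C n) ?mxE ?mulr0 //.
  by apply: (@near0 p b) => //; rewrite b0 lerDl ler01.
have E2 : framed (fun p => shell g k p * w p) = 0.
  apply: big1 => j _; apply: big1 => Is _; rewrite -[RHS](Rint_cst_mu 0).
  apply: eq_Rintegral => p _; set q := with_fib _ _ _.
  have /nbhs_singleton -> : \forall q' \near q, shell g k q' * w q' = 0.
    apply: (@near0 q 1); first by rewrite ler01 lerDr b0.
    by rewrite fib_with_fib; exact: oframe_le.
  by rewrite mulr0.
rewrite /eta E1 E2 addr0 sub0r normrN normrM ger0_norm ?K_ge0 //.
apply: ler_wpM2l; first exact: K_ge0.
have it : integr mu (fun p => shell g k p * w p) by apply: integr_test; exact: shell_test.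
have itn : integr mu (fun p => shell g k p * `|w p|).
  have := integr_norm it; rewrite (_ : (fun p => `|_|) = (fun p => shell g k p * `|w p|)) //.
  by apply/funext => p; rewrite normrM (ger0_norm (shell_ge0 _ _ _)).
by apply: Rint_norm_le => // p; rewrite normrM (ger0_norm (shell_ge0 _ _ _)).
Qed.

(** The sum of the shells being at most 1, the tail of the series is at most [K]
    times the integral of |w|, which is finite because [mu] is mild. *)
Lemma eta_mild : mild_distribution eta.
Proof.
split; first exact: eta_distribution.
exists (fun k (p : T) => shell g k p); first exact: (shell_partition g C).
move=> w wO; have [k0 Hk0] := eta_shell wO; have sw := form_smooth wO.
have iw := integr_norm (integr_form wO).
have isw k : integr mu (fun p => shell g k p * `|w p|).
  have it : integr mu (fun p => shell g k p * w p) by apply: integr_test; exact: (shell_test g C).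
  have := integr_norm it; rewrite (_ : (fun p => `|_|) = (fun p => shell g k p * `|w p|)) //.
  by apply/funext => p; rewrite normrM (ger0_norm (shell_ge0 _ _ _)).
rewrite -(is_cvg_series_restrict k0); apply: nondecreasing_is_cvgn.
  apply/nondecreasing_seqP => N.
  have [kN|Nk] := leqP k0 N; first by rewrite /= big_nat_recr //= lerDl.
  by rewrite /= !big_geq // ltnW.
exists (K * \int[mu]_p `|w p|) => _ [N _ <-].
apply: (@le_trans _ _ (\sum_(k0 <= k < N) K * \int[mu]_p (shell g k p * `|w p|))).
  by rewrite /= !big_nat; apply: ler_sum => k /andP[k0k _]; exact: Hk0.
rewrite -mulr_sumr; apply: ler_wpM2l; first exact: K_ge0.
rewrite -Rint_sum //; apply: Rint_le => //; first by apply: integr_sum.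
move=> p; rewrite -mulr_suml -[leRHS]mul1r; apply: ler_wpM2r => //.
have [kN|Nk] := leqP k0 N; last by rewrite big_geq // ltnW.
have E := sum_shell g N p; rewrite (big_cat_nat (leq0n k0) kN) //= in E.
have : 0 <= \sum_(0 <= k < k0) shell g k p by apply: sumr_ge0 => k _; exact: shell_ge0.
have : 0 <= cutoff g N p by exact: smooth_step_ge0.
by move: E; lra.
Qed.

(** Displacement changes [voln] only where [u1] does not vanish, and there the tuples
    stay in some fibre ball; the frames are bounded as well. *)
Lemma transport_mild t (nu : {measure set X -> \bar R}) : 0 <= t ->
  transports mu nu (weight t) (target t) -> mild g nu.
Proof.
move=> t0 tr; have [mild _ _] := mu_hol; rewrite /Defs.mild.
rewrite tr; [|exact: measurable_voln|by move=> p; exact: voln_ge0].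
have mt i : measurable_fun setT (fun p : X => voln g (target t i p : T)).
  have mv : measurable_fun setT (fun p : X => voln g (p : T)) := @measurable_voln _ _ _ _ g n.
  exact: (measurableT_comp mv (measurable_target t i)).
rewrite ge0_integral_sum //; first last.
- by move=> i p _; rewrite mule_ge0 ?lee_fin ?weight_ge0 // voln_ge0.
- by move=> i; apply: emeasurable_funM => //; apply/measurable_EFinP; exact: measurable_weight.
apply: lte_sum_pinfty => -[j|[j Is]] _ /=.
  have [c c0 Hc] := @voln_ball _ _ _ _ g C n (b + t * (n%:R * b)).
  have cst0 : 0 <= (1 + t * K)^-1 * n%:R^-1 by exact: (weight_ge0 (inl j) point t0).
  rewrite ge0_integralZl //; [|exact: (mt (inl j))|by move=> p _; exact: voln_ge0].
  apply: lte_mul_pinfty => //.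
  apply: (@le_lt_trans _ _ (\int[mu]_p (voln g p + c%:E))%E).
    apply: ge0_le_integral => //.
    - by move=> p _; exact: voln_ge0.
    - exact: (mt (inl j)).
    - by apply: emeasurable_funD => //; exact: measurable_voln.
    move=> p _; have [pb|npb] := pselect (entries_le (fib C p) b).
      by apply: le_trans (Hc _ (displace_fib j t0 pb)) _; rewrite leeDr // voln_ge0.
    by rewrite displace_still // leeDl // lee_fin.
  rewrite ge0_integralD //; [|by move=> p _; exact: voln_ge0|exact: measurable_voln].
  by rewrite lte_add_pinfty // (integr_EFin (integr_cst c)) ltry.
have [c c0 Hc] := @voln_ball _ _ _ _ g C n 1.
have iw : integr mu (fun p => c * ((1 + t * K)^-1 * t * minor C (u2 p) p j Is)).
  by apply: integrZ; apply: integrZ; exact: integr_minor.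
apply: (@le_lt_trans _ _ (\int[mu]_p (c * ((1 + t * K)^-1 * t * minor C (u2 p) p j Is))%:E)%E); last first.
  by rewrite integr_EFin // ltry.
apply: ge0_le_integral => //.
- by move=> p _; rewrite mule_ge0 ?voln_ge0 // lee_fin; exact: (weight_ge0 (inr (j, Is)) p t0).
- apply: emeasurable_funM; last exact: (mt (inr (j, Is))).
  by apply/measurable_EFinP; exact: (measurable_weight t (inr (j, Is))).
- by apply/measurable_EFinP; exact: integr_measurable iw.
move=> p _; rewrite [(c * _)%:E]EFinM muleC; apply: lee_pmul => //.
- exact: voln_ge0.
- by rewrite lee_fin; exact: (weight_ge0 (inr (j, Is)) p t0).
by apply: Hc; rewrite fib_with_fib; exact: oframe_le.
Qed.

Lemma transport_mass t (nu : {measure set X -> \bar R}) : 0 <= t ->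
  transports mu nu (weight t) (target t) -> nu setT = 1%E.
Proof.
move=> t0 tr; have s1 : smooth_fun (fun _ : T => 1 : R).
  move=> i q; have oc := @tcod_open _ _ _ A n i.
  exact: (Ck_eq oc (fun _ _ => erefl) (@Ck_cst _ _ _ q _ (1 : R))).
have [iN E] := transport_integral s1 (integr_cst 1) t0 tr.
have := integr_EFin iN; rewrite integral_cst //= mul1e => ->; rewrite E.
have -> : displaced (fun=> 1) t = 1.
  rewrite /displaced; under eq_bigr => j _ do rewrite Rint_cst_mu.
  by rewrite sumr_const card_ord mulVf // pnatr_eq0.
have -> : framed (fun=> 1) = K.
  rewrite K_sum; apply: eq_bigr => j _; apply: eq_bigr => Is _.
  by apply: eq_Rintegral => p _; rewrite mulr1.
by rewrite mulVf // gt_eqF // den_gt0.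
Qed.

(** Up to the normalizing factor, the integral is [t] times the sum in [balance]. *)
Lemma transport_closed t (nu : {measure set X -> \bar R}) (w : tangent A m -> R) : 0 <= t ->
  transports mu nu (weight t) (target t) -> Omega A m w ->
  (\int[nu]_p (extd (n := n) w p)%:E)%E = 0%E.
Proof.
move=> t0 tr wO; have dO := extd_Omega C wO; have sd := form_smooth dO.
have iw := integr_form dO; have [iN E] := transport_integral sd iw t0 tr.
rewrite (integr_EFin iN) E.
have wmu : \int[mu]_p extd (n := n) w p = 0.
  by have [_ _ /(_ w wO)] := mu_hol; rewrite /Rintegral => ->.
have avg (x : R) : n%:R^-1 * (x *+ n) = x.
  by rewrite -[x *+ n]mulr_natl mulKf // pnatr_eq0.
have E1 : displaced (extd (n := n) w) t = t * fdiff_mean (extd (n := n) w).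
  rewrite /displaced; set S := \sum_j _.
  have ip : integr mu (fun p => \sum_j extd (n := n) w (displace t j p)).
    by apply: integr_sum => j _; exact: integr_displace.
  have -> : S = \int[mu]_p (\sum_j extd (n := n) w (displace t j p)).
    by apply/esym; apply: Rint_sum => j _; exact: integr_displace.
  rewrite -(RintZ _ ip).
  have -> : \int[mu]_p (n%:R^-1 * \sum_j extd (n := n) w (displace t j p)) =
      \int[mu]_p (extd (n := n) w p + t * mdot (u1 p) (fdiff C (extd (n := n) w) p)).
    apply: eq_Rintegral => p _; under eq_bigr => j _ do rewrite /displace form_shift //.
    rewrite big_split /= sumr_const card_ord -mulr_sumr -mulr_sumr mulrDr.
    rewrite avg; congr (_ + _).
    by rewrite mulrCA; congr (_ * _); rewrite mulrA mulVf ?pnatr_eq0 // mul1r.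
  rewrite RintD //; last by apply: integrZ; exact: integr_fdiff_u1.
  by rewrite wmu add0r RintZ //; exact: integr_fdiff_u1.
have E2 : framed (extd (n := n) w) = \int[mu]_p mdot (u2 p) (fdiff C (extd (n := n) w) p).
  rewrite /framed; under [in RHS]eq_Rintegral => p _ do rewrite form_minor //.
  rewrite Rint_sum => [|j _]; last by apply: integr_sum => Is _; exact: integr_frame.
  by apply: eq_bigr => j _; rewrite Rint_sum // => Is _; exact: integr_frame.
by rewrite E1 E2 -mulrDr /fdiff_mean balance // !mulr0.
Qed.

Lemma transport_start (nu : {measure set X -> \bar R}) (B : set X) :
  transports mu nu (weight 0) (target 0) -> measurable B -> nu B = mu B.
Proof.
move=> tr mB; have mind : measurable_fun setT (fun p : X => (\1_B p : R)%:E).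
  by apply/measurable_EFinP; exact: measurable_indic.
have ind (mu' : {measure set X -> \bar R}) : (\int[mu']_p (\1_B p)%:E = mu' B)%E.
  by rewrite integral_indic // setIT.
rewrite -(ind nu) -(ind mu) (tr _ mind); last by move=> p; rewrite lee_fin.
apply: eq_integral => p _; rewrite big_sumType /= [X in (_ + X)%E]big1 ?adde0; last first.
  by move=> [j Is] _; rewrite mulr0 mul0r mul0e.
under eq_bigr => j _ do rewrite displace0 mul0r addr0 invr1 mul1r -EFinM.
rewrite sumEFin sumr_const card_ord -[X in X%:E]mulr_natl mulrA mulfV ?mul1r //.
Qed.

(** The derivative is needed for every integrable smooth function, not only for test
    functions, because it will be applied to [L]. *)
Theorem variation_exists : exists mu_ : R -> {measure set X -> \bar R}, Defs.variation g mu mu_ /\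
  forall f, smooth_fun f -> integr mu f ->
    (forall t, 0 <= t -> integr (mu_ t) f) /\
    right_derivative0 (fun t => \int[mu_ t]_p f p) (eta f).
Proof.
have ex (t : R) : exists nu : {measure set X -> \bar R}, 0 <= t -> transports mu nu (weight t) (target t).
  have [t0|t0] := leP 0 t; last by exists mu.
  have [nu tr] := transports_exists mu (measurable_weight t)
    (fun i p => weight_ge0 i p t0) (measurable_target t).
  by exists nu.
have [mu_ tr] := choice ex; exists mu_.
have der f (sf : smooth_fun f) (iF : integr mu f) := transport_derivative sf iF tr.
split; last first.
  move=> f sf iF; split; last exact: der.
  by move=> t t0; have [] := transport_integral sf iF t0 (tr t t0).
split.
- move=> t t0; split; [exact: transport_mild (tr t t0)|exact: transport_mass (tr t t0)|].
  by move=> w wO; exact: transport_closed (tr t t0) wO.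
- by move=> B mB; apply: transport_start => //; exact: tr.
exists eta; first exact: eta_mild.
by move=> f tf; apply: der; [case: tf|exact: integr_test].
Qed.

Lemma eta_ge0 (L : T -> R) : smooth_fun L -> critical g L mu -> 0 <= eta L.
Proof.
move=> sL [iL crit]; have [mu_ [var H]] := variation_exists; have [iLt der] := H L sL iL.
apply: (crit mu_ var) der.
near=> t; apply: iLt.
have : 0 < t by [].
exact: ltW.
Unshelve. all: by end_near.
Qed.

End Variations.

(** Moving along [u1] cannot decrease the action faster than the compensating mass
    increases it. The constant is a bound of [|L|] on the frames plus, for the
    normalization, the absolute value of the action of [mu]; that it does not depend on the fields is what makes the
    inequality useful for unbounded [u2]. *)
Theorem critical_inequality (R : realType) (d m : nat) (M : ptopologicalType)
    (A : smooth_atlas R d M) (g : riemannian A) (C : cubic_cover A)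
    (mu : {measure set (borel A m.+1) -> \bar R}) (L : tangent A m.+1 -> R) :
  hausdorff_space M -> holonomic g mu -> smooth_fun L -> critical g L mu ->
  exists2 B, 0 <= B & forall (u1 u2 : tangent A m.+1 -> 'M[R]_(m.+1, d)) b,
    (forall j l, measurable_fun setT (fun p : borel A m.+1 => u1 p j l)) ->
    (forall j l, measurable_fun setT (fun p : borel A m.+1 => u2 p j l)) ->
    (forall p, entries_le (u1 p) b) ->
    (forall p, ~ entries_le (fib C p) b -> u1 p = 0) ->
    0 <= b -> integr mu (cost C u2) ->
    (forall w, Omega A m w ->
      \int[mu]_p mdot (u1 p) (fdiff C (extd (n := m.+1) w) p) +
      \int[mu]_p mdot (u2 p) (fdiff C (extd (n := m.+1) w) p) = 0) ->
    - (\int[mu]_p mdot (u1 p) (fdiff C L p)) <= B * \int[mu]_p cost C u2 p.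
Proof.
move=> hM hol sL crit; have [B1 B10 HB1] := bounded_fib C 1 sL.
exists (B1 + `|\int[mu]_p L p|) => [|u1 u2 b m1 m2 u1b u10 b0 ic bal]; first by rewrite addr_ge0.
have e0 := eta_ge0 hM hol m1 m2 u1b u10 b0 ic bal sL crit.
have fr := framed_le hM m1 m2 ic sL HB1.
have K0 := K_ge0 C mu u2.
move: e0; rewrite /eta /fdiff_mean => e0.
have := ler_norm (framed C mu u2 L); have := ler_norm (- \int[mu]_p L p); rewrite normrN.
move: e0 fr K0; set K := \int[mu]_p cost C u2 p; set a := \int[mu]_p mdot _ _; set l := \int[mu]_p L p.
move: (framed _ _ _ _) => F e0 fr K0 h1 h2.
have : K * - l <= K * `|l| by apply: ler_wpM2l.
rewrite mulrDl; lra.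
Qed.

(** * The fibre derivative of a critical Lagrangian *)

Section Extd_linear.
Context {R : realType} {d : nat} {M : ptopologicalType} {A : smooth_atlas R d M}.

Lemma extd_lin m (w w' : tangent A m -> R) (a : R) (p : tangent A m.+1) :
  Omega A m w -> Omega A m w' ->
  extd (n := m.+1) (fun q : tangent A m => a * w q + w' q) p =
  a * extd (n := m.+1) w p + extd (n := m.+1) w' p.
Proof.
move=> [_ _ sw] [_ _ sw']; rewrite /extd mulr_sumr -big_split; apply: eq_bigr => j _ /=.
have pc : cod (chart_at A (base p)) (chart (chart_at A (base p)) (base p)).
  exact: cod_chart (dom_chart_at A (base p)).
have dv (w0 : tangent A m -> R) : (forall i W, smooth_on (cod i) (fun y => w0 (tpar i (y, W)))) ->
    derivable (fun y => w0 (tpar (chart_at A (base p)) (y, row' j (vec p))))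
      (chart (chart_at A (base p)) (base p)) (row j (vec p)).
  by move=> s0; apply: diff_derivable; apply: smooth_differentiable (s0 _ _) pc.
have [_ E] := is_deriveD (is_deriveZ a (derivableP (dv _ sw))) (derivableP (dv _ sw')).
have E' : 'D_(row j (vec p)) (fun y => a * w (tpar (chart_at A (base p)) (y, row' j (vec p))) +
    w' (tpar (chart_at A (base p)) (y, row' j (vec p)))) (chart (chart_at A (base p)) (base p)) =
  a * 'D_(row j (vec p)) (fun y => w (tpar (chart_at A (base p)) (y, row' j (vec p))))
     (chart (chart_at A (base p)) (base p)) +
  'D_(row j (vec p)) (fun y => w' (tpar (chart_at A (base p)) (y, row' j (vec p))))
     (chart (chart_at A (base p)) (base p)) := E.
by rewrite E' mulrDr mulrCA.
Qed.

End Extd_linear.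

Section Final.
Context {R : realType} {d : nat} {M : ptopologicalType} {A : smooth_atlas R d M}.
Variables (g : riemannian A) (C : cubic_cover A) (m : nat).
Hypothesis hM : hausdorff_space M.
Notation n := m.+1.
Notation T := (tangent A n).
Notation X := (borel A n).
Notation Ix := ('I_n * 'I_d)%type.
Notation O p := (of_chart (chosen_idx C (base p)) (base p)).
Variable mu : {measure set X -> \bar R}.
Implicit Types (p : T) (U W : T -> 'M[R]_(n, d)).

Definition field U : Ix -> X -> R := fun i p => U p i.1 i.2.
Definition unfield (u : Ix -> X -> R) : T -> 'M[R]_(n, d) := fun p => \matrix_(j, l) u (j, l) p.

Lemma unfieldK u : field (unfield u) = u.
Proof. by apply/funext => -[j l]; apply/funext => p; rewrite /field mxE. Qed.

Lemma dot_field U W p : dot (field U) (field W) p = mdot (U p) (W p).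
Proof. by rewrite /mdot pair_bigA. Qed.

Lemma dot_fieldE U W : dot (field U) (field W) = fun p : X => mdot (U p) (W p).
Proof. by apply/funext => p; exact: dot_field. Qed.

Definition mfield U := forall j l, measurable_fun setT (fun p : X => U p j l).

Lemma measurable_field U : mfield U -> forall i, measurable_fun setT (field U i).
Proof. by move=> mU [j l]; exact: mU. Qed.

Lemma mfield_fdiff (f : T -> R) : smooth_fun f -> mfield (fdiff C f).
Proof. by move=> sf j l; exact: measurable_fdiff. Qed.

(** ** Integrals over the support *)

Lemma integral_supp (f : X -> \bar R) : measurable_fun setT f -> (forall p, 0 <= f p)%E ->
  (\int[mu]_(p in supp mu) f p = \int[mu]_p f p)%E.
Proof.
move=> mf f0; have [ms n0] := supp_null C mu.
rewrite -(setUv (supp mu)) ge0_integral_setU //; first last.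
- by rewrite disj_set2E setICr.
- by rewrite setUv.
- exact: measurableC.
by rewrite [X in (_ + X)%E]null_set_integral ?adde0 //; [exact: measurableC|exact: measurable_funTS].
Qed.

Lemma measurable_gram a b : measurable_fun setT (fun p : X => gram_at g C (p : T) a b).
Proof.
apply: (@measurable_chartwise _ _ _ _ C hM n (fun i z => gram g i z.1 a b)) => i z iz.
apply: (@continuous_comp _ _ _ fst (fun y => gram g i y a b)); first exact: cvg_fst.
exact: (smooth_continuous (@gram_smooth _ _ _ _ g i a b) iz).
Qed.

Lemma measurable_invgram a b : measurable_fun setT (fun p : X => invmx (gram_at g C (p : T)) a b).
Proof.
apply: (@measurable_chartwise _ _ _ _ C hM n (fun i z => invmx (gram g i z.1) a b)) => i z iz.
apply: (@continuous_comp _ _ _ fst (fun y => invmx (gram g i y) a b)); first exact: cvg_fst.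
exact: (smooth_continuous (@invgram_smooth _ _ _ _ g i a b) iz).
Qed.

Definition raised W : T -> 'M[R]_(n, d) := fun p => W p *m invmx (gram_at g C p).

Lemma mfield_raised W : mfield W -> mfield (raised W).
Proof.
move=> mW j l; apply: (eq_measurable_fun (fun p : X => \sum_a W p j a * invmx (gram_at g C (p : T)) a l)).
  by move=> p _; rewrite [RHS]mxE.
by apply: measurable_sum => a; apply: measurable_funM => //; exact: measurable_invgram.
Qed.

Lemma measurable_gdot W : mfield W ->
  measurable_fun setT (fun p : X => gdot g (base p) (W p *m O p) (W p *m O p)).
Proof.
move=> mW; apply: (eq_measurable_fun (fun p : X =>
    \sum_j \sum_a \sum_b W p j a * W p j b * gram_at g C (p : T) a b)).
  move=> p _; apply: eq_bigr => j _; rewrite row_mul metric_gram_at.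
  by apply: eq_bigr => a _; apply: eq_bigr => b _; rewrite !mxE.
apply: measurable_sum => j; apply: measurable_sum => a; apply: measurable_sum => b.
by apply: measurable_funM; [exact: measurable_funM|exact: measurable_gram].
Qed.

Lemma gdot_ge0 p (V : 'M[R]_(n, d)) : 0 <= gdot g (base p) V V.
Proof. by apply: sumr_ge0 => j _; exact: metric_ge0. Qed.

Lemma vgrad_raised (f : T -> R) p : smooth_fun f ->
  vgrad g f p = raised (fdiff C f) p *m O p.
Proof. exact: vgradE. Qed.

Lemma with_fib_tangent p (V : 'M[R]_(n, d)) : with_fib C p V = Tangent A (base p) (V *m O p).
Proof. by rewrite /with_fib /tpar /= par_pos. Qed.

Lemma sq_in_H (f : T -> R) : smooth_fun f -> sq mu (field (fdiff C f)) -> in_H g mu (vgrad g f).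
Proof.
move=> sf [_ sqf]; have mF := mfield_fdiff sf; have [ms _] := supp_null C mu.
have [K K0 HK] := gdot_fdiff_le g C n; split.
  have E : (fun p : X => Tangent A (base p) (vgrad g f p) : X) =
      fun p : X => with_fib C p (raised (fdiff C f) p) : X.
    by apply/funext => p; rewrite with_fib_tangent vgrad_raised.
  rewrite E; apply: measurable_funTS; exact: (measurable_with_fib C hM (mfield_raised mF)).
have iK : integr mu (fun p => K * mdot (fdiff C f p) (fdiff C f p)).
  by rewrite dot_fieldE in sqf; exact: integrZ.
have mg : measurable_fun setT (fun p : X => (gdot g (base p) (vgrad g f p) (vgrad g f p))%:E).
  apply/measurable_EFinP; have := measurable_gdot (mfield_raised mF).
  by apply: eq_measurable_fun => p _; rewrite vgrad_raised.
rewrite integral_supp //; last by move=> p; rewrite lee_fin; exact: gdot_ge0.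
apply: (@le_lt_trans _ _ (\int[mu]_p (K * mdot (fdiff C f p) (fdiff C f p))%:E)%E); last first.
  by rewrite integr_EFin // ltry.
apply: ge0_le_integral => //.
- by move=> p _; rewrite lee_fin gdot_ge0.
- by apply/measurable_EFinP; exact: integr_measurable iK.
by move=> p _; rewrite lee_fin vgrad_raised //; exact: (HK p _).1.
Qed.

Lemma in_H_sq (f : T -> R) : smooth_fun f -> in_H g mu (vgrad g f) -> sq mu (field (fdiff C f)).
Proof.
move=> sf [_ fin]; have mF := mfield_fdiff sf.
have [K K0 HK] := gdot_fdiff_le g C n; split; first exact: measurable_field.
have md := measurable_dot (measurable_field mF) (measurable_field mF).
apply: integr_ge0 => //; first exact: dot_ge0.
have mg : measurable_fun setT (fun p : X => gdot g (base p) (vgrad g f p) (vgrad g f p)).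
  have := measurable_gdot (mfield_raised mF).
  by apply: eq_measurable_fun => p _; rewrite vgrad_raised.
rewrite integral_supp in fin; first last.
- by move=> p; rewrite lee_fin; exact: gdot_ge0.
- exact/measurable_EFinP.
have ig : integr mu (fun p => gdot g (base p) (vgrad g f p) (vgrad g f p)).
  by apply: integr_ge0 => // p; exact: gdot_ge0.
apply: (@le_lt_trans _ _ (\int[mu]_p (K * gdot g (base p) (vgrad g f p) (vgrad g f p))%:E)%E); last first.
  by rewrite integr_EFin ?ltry //; exact: integrZ.
apply: ge0_le_integral => //.
- by move=> p _; rewrite lee_fin dot_ge0.
- exact/measurable_EFinP.
- by apply/measurable_EFinP; apply: measurable_funM.
by move=> p _; rewrite lee_fin dot_field vgrad_raised //; exact: (HK p _).2.
Qed.

(** ** The cost of a field *)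

Hypothesis mu_hol : holonomic g mu.
Hypothesis grads : exact_gradients_in_H g mu.

Lemma exact_sq (w : tangent A m -> R) : Omega A m w -> sq mu (field (fdiff C (extd (n := n) w))).
Proof. by move=> wO; apply: in_H_sq; [exact: extd_smooth|exact: grads]. Qed.

Notation CI := ('I_(csize C) * {ffun 'I_n -> 'I_d})%type.
Notation frame_diff kI := (fdiff C (extd (n := n) (@coord_form R d M A C m kI.1 kI.2))).

(** The minors that define the cost of [U] are derivatives along [U] of the exact
    forms [extd (coord_form k I)]. *)
Lemma det_frame_diff p j (I : {ffun 'I_n -> 'I_d}) (v : 'rV[R]_d) :
  \det (colsub I (setrow (fib C p) j v)) =
  \sum_l v 0 l * frame_diff (chosen C (base p), I) p j l.
Proof.
have eO := extd_Omega C (coord_form_Omega hM (chosen C (base p)) I).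
rewrite (form_fdiff_row C _ _ _ eO) /= coord_form_extd //; last first.
  by rewrite base_with_fib; exact: chosen_cell.
rewrite -[X in colsub I X](fib_with_fib C p) /fib /tchart /= /chosen_idx.
by rewrite -[par _ _]/(base (with_fib C p (setrow (fib C p) j v))) base_with_fib.
Qed.

(** A minor is the product of an entry of [U] with an entry of the fibre derivative
    of an exact form ([det_frame_diff]). The latter is square integrable by
    hypothesis, and Young's inequality with parameter [e] separates the two. *)
Lemma cost_le : exists N Q, [/\ 0 <= N, integr mu Q & forall U (e : R) p, 0 < e ->
  cost C U p <= e * N * mdot (U p) (U p) + e^-1 * Q p].
Proof.
pose Q p : R := \sum_(kI : CI) mdot (frame_diff kI p) (frame_diff kI p).
pose N : R := \sum_(kI : CI) 1.
exists N, Q; split; first exact: sumr_ge0.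
  apply: integr_sum => kI _; have := (exact_sq (coord_form_Omega hM kI.1 kI.2)).2.
  by rewrite dot_fieldE.
move=> U e p e0; pose k := chosen C (base p).
apply: (@le_trans _ _ (\sum_j \sum_(I : {ffun 'I_n -> 'I_d}) \sum_l `|U p j l| * `|frame_diff (k, I) p j l|)).
  apply: ler_sum => j _.
  rewrite -(pair_bigA_idem _ (fun I s => minor C (U p) p j (I, s))) ?addr0 //=; last exact: addr0.
  apply: ler_sum => I _; rewrite big_bool /= addrC minor_sum det_frame_diff.
  apply: (@le_trans _ _ (1 * `|\sum_l row j (U p) 0 l * frame_diff (k, I) p j l|)).
    apply: ler_wpM2r => //; rewrite invf_le1 ?ltr0n ?fact_gt0 // ler1n fact_gt0 //.
  rewrite mul1r; apply: le_trans (ler_norm_sum _ _ _) _; apply: ler_sum => l _.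
  by rewrite normrM [row j (U p) 0 l]mxE.
apply: (@le_trans _ _ (\sum_(kI : CI) \sum_j \sum_l `|U p j l| * `|frame_diff kI p j l|)).
  rewrite exchange_big /= -(pair_bigA_idem _ (fun k I => \sum_j \sum_l `|U p j l| * `|frame_diff (k, I) p j l|)) ?addr0 //=; last exact: addr0.
  rewrite [leRHS](bigD1 k) //= lerDl; apply: sumr_ge0 => k' _.
  by do 3 (apply: sumr_ge0 => ? _); rewrite mulr_ge0.
have -> : e * N * mdot (U p) (U p) = \sum_(kI : CI) e * mdot (U p) (U p).
  by rewrite -mulrA [N * _]mulr_suml mulr_sumr; apply: eq_bigr => kI _; rewrite mul1r.
rewrite /Q [e^-1 * _]mulr_sumr -big_split; apply: ler_sum => kI _ /=.
rewrite /mdot !mulr_sumr -big_split; apply: ler_sum => j _.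
rewrite !mulr_sumr -big_split; apply: ler_sum => l _ /=.
set x := U p j l; set y := frame_diff kI p j l.
have -> : x * x = `|x| ^+ 2 by rewrite -normrX ger0_norm ?sqr_ge0.
have -> : y * y = `|y| ^+ 2 by rewrite -normrX ger0_norm ?sqr_ge0.
move: `|x| `|y| (normr_ge0 x) (normr_ge0 y) => {}x {}y x0 y0.
have h : 0 <= e^-1 * (e * x - y) ^+ 2 by rewrite mulr_ge0 ?sqr_ge0 // invr_ge0 ltW.
have E : e^-1 * (e * x - y) ^+ 2 = e * x ^+ 2 + e^-1 * y ^+ 2 - 2 * (x * y).
  by field; rewrite gt_eqF.
have : 0 <= x * y by rewrite mulr_ge0.
by rewrite E in h; move: h; lra.
Qed.

Lemma measurable_cost U : mfield U -> measurable_fun setT (cost C U : X -> R).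
Proof.
by move=> mU; apply: measurable_sum => j; apply: measurable_sum => Is; exact: measurable_minor.
Qed.

Lemma integr_cost U : mfield U -> sq mu (field U) -> integr mu (cost C U).
Proof.
move=> mU [_ sU]; have [N [Q [N0 iQ HQ]]] := cost_le.
apply: (@integr_le _ X R mu _ (fun p : X => N * dot (field U) (field U) p + Q p) (measurable_cost mU)).
  move=> p; rewrite ger0_norm ?cost_ge0 // dot_field.
  by have := HQ U 1 p ltr01; rewrite invr1 !mul1r.
by apply: integrD => //; exact: integrZ.
Qed.

(** ** Truncation *)

(** Both the tuple and the field are truncated, because displaced fields have to be
    bounded and to vanish off a fibre ball. *)
Definition trunc_set U (q : nat) : set X :=
  [set p : X | forall i : Ix, `|fib C (p : T) i.1 i.2| <= q%:R /\ `|U p i.1 i.2| <= q%:R].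
Definition trunc U q (p : X) : R := \1_(trunc_set U q) p.

Lemma measurable_trunc U q : mfield U -> measurable_fun setT (trunc U q).
Proof.
move=> mU; apply: measurable_indic; rewrite -[X in measurable X]setTI.
apply: measurable_forall_set => // i.
have mle (f : X -> R) : measurable_fun setT f -> measurable [set p | `|f p| <= q%:R].
  move=> mf; have mn : measurable_fun setT (fun p : X => `|f p|) by exact: measurableT_comp.
  have /(_ measurableT _ (measurable_itv `]-oo, (q%:R : R)])) := mn; rewrite setTI.
  by congr measurable; apply/seteqP; split=> p; rewrite /= in_itv.
rewrite setTI; apply: measurableI; apply: mle; [exact: measurable_fib|exact: mU].
Qed.

Lemma trunc01 U q p : trunc U q p = 0 \/ trunc U q p = 1.
Proof. by rewrite /trunc indicE; case: (_ \in _); [right|left]. Qed.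

Lemma trunc_ge0 U q p : 0 <= trunc U q p <= 1.
Proof. by case: (trunc01 U q p) => ->; rewrite ?lexx ?ler01. Qed.

Lemma trunc_eventually U p : \forall q \near \oo, trunc U q p = 1.
Proof.
pose s : R := \sum_(i : Ix) (`|fib C p i.1 i.2| + `|U p i.1 i.2|).
exists (Num.truncn s).+1 => // q /= sq_; rewrite /trunc indicE mem_set // => i.
have sq1 : s <= q%:R.
  by apply: le_trans (ltW (truncnS_gt s)) _; rewrite ler_nat.
have : `|fib C p i.1 i.2| + `|U p i.1 i.2| <= s.
  by rewrite /s (bigD1 i) //= lerDl; apply: sumr_ge0 => i' _; rewrite addr_ge0.
have := normr_ge0 (fib C p i.1 i.2); have := normr_ge0 (U p i.1 i.2).
by move=> h1 h2 h3; split; lra.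
Qed.

Lemma trunc_homo U q q' p : (q <= q')%N -> trunc U q p <= trunc U q' p.
Proof.
move=> qq'; have qq : q%:R <= q'%:R :> R by rewrite ler_nat.
have [Hp|Hp] := pselect (trunc_set U q p); last first.
  by rewrite {1}/trunc indicE memNset //; case/andP: (trunc_ge0 U q' p).
rewrite /trunc !indicE !mem_set // => i.
by have [h1 h2] := Hp i; split; [exact: le_trans h1 qq|exact: le_trans h2 qq].
Qed.

(** The sign is the one of a descent direction of the action. *)
Definition inner U q : T -> 'M[R]_(n, d) := fun p => - (trunc U q p *: U p).

Lemma inner_le U q p : entries_le (inner U q p) q%:R.
Proof.
move=> j l; rewrite !mxE normrN normrM /trunc indicE.
have [Hp|Hp] := pselect (trunc_set U q p).
  by rewrite mem_set // normr1 mul1r; case: (Hp (j, l)).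
by rewrite memNset // normr0 mul0r.
Qed.

Lemma inner0 U q p : ~ entries_le (fib C p) q%:R -> inner U q p = 0.
Proof.
move=> np; rewrite /inner /trunc indicE memNset ?scale0r ?oppr0 // => Hp.
by apply: np => j l; case: (Hp (j, l)).
Qed.

Lemma mfield_scale (s : X -> R) U : measurable_fun setT s -> mfield U -> mfield (fun p => s p *: U p).
Proof.
move=> ms mU j l; apply: (eq_measurable_fun (fun p : X => s p * U p j l)).
  by move=> p _; rewrite [RHS]mxE.
exact: measurable_funM.
Qed.

Lemma mfield_opp U : mfield U -> mfield (fun p => - U p).
Proof.
move=> mU j l; apply: (eq_measurable_fun (fun p : X => - U p j l)).
  by move=> p _; rewrite [RHS]mxE.
exact: measurableT_comp.
Qed.

Lemma mdotZ (a : R) (U W : 'M[R]_(n, d)) : mdot (a *: U) W = a * mdot U W.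
Proof.
rewrite /mdot mulr_sumr; apply: eq_bigr => j _; rewrite mulr_sumr.
by apply: eq_bigr => l _; rewrite mxE mulrA.
Qed.

Lemma mdotN (U W : 'M[R]_(n, d)) : mdot (- U) W = - mdot U W.
Proof. by rewrite -scaleN1r mdotZ mulN1r. Qed.

Lemma mdotC (U W : 'M[R]_(n, d)) : mdot U W = mdot W U.
Proof. by apply: eq_bigr => j _; apply: eq_bigr => l _; rewrite mulrC. Qed.

Lemma sq_bounded U (b : R) : mfield U -> (forall p, entries_le (U p) b) -> sq mu (field U).
Proof.
move=> mU Ub; have mF := measurable_field mU; split => //.
apply: (integr_bounded mu_hol (measurable_dot mF mF) (B := \sum_(j < n) \sum_(l < d) b * b)) => p.
by rewrite dot_field; exact: mdot_le.
Qed.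

(** ** Square integrability of the fibre derivative of L *)

Variable L : T -> R.
Hypothesis sL : smooth_fun L.
Hypothesis crit : critical g L mu.

Notation DL := (fdiff C L).

(** The critical inequality for a truncation of [- DL] and its opposite, which are
    trivially in balance. Its right-hand side is quadratic in [DL] as well, but with
    a coefficient that can be made small; the bound on the truncated integrals is
    uniform and passes to the limit. *)
Lemma derivative_sq : sq mu (field DL).
Proof.
have mD := mfield_fdiff sL; have mF := measurable_field mD.
have [B B0 HB] := critical_inequality C hM mu_hol sL crit.
have [N [Q [N0 iQ HQ]]] := cost_le.
(* Half of the left-hand side absorbs the term in [e * N]. *)
pose e := (2 * (B * N + 1))^-1.
have BN0 : 0 <= B * N by rewrite mulr_ge0.
have e0 : 0 < e by rewrite invr_gt0 mulr_gt0 // ltr_wpDl.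
pose c := 2 * (B * (e^-1 * \int[mu]_p Q p)).
pose s q : X -> R := trunc DL q.
have ms q : measurable_fun setT (s q) by exact: measurable_trunc.
have sqin q : sq mu (field (inner DL q)).
  apply: (sq_bounded (b := q%:R)); last by move=> p; exact: inner_le.
  by apply: mfield_opp; exact: mfield_scale.
have mneg q : mfield (fun p => - inner DL q p).
  by do 2 apply: mfield_opp; exact: mfield_scale.
have sqneg q : sq mu (field (fun p => - inner DL q p)).
  apply: (sq_bounded (b := q%:R)) => // p j l.
  by rewrite mxE normrN; exact: inner_le.
have negE q (p : T) : - inner DL q p = s q p *: DL p by rewrite /inner opprK.
pose h q (p : X) := s q p * mdot (DL p) (DL p).
have ih q : integr mu (h q).
  have := (sqneg q).2; rewrite dot_fieldE; congr (integr mu _); apply/funext => p.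
  rewrite negE mdotZ mdotC mdotZ mulrA /h; congr (_ * _).
  by rewrite /s; case: (trunc01 DL q p) => ->; rewrite ?mulr0 ?mulr1.
have bound q : \int[mu]_p h q p <= c.
  have := HB (inner DL q) (fun p => - inner DL q p) q%:R.
  have mi : mfield (inner DL q) by apply: mfield_opp; exact: mfield_scale.
  move=> /(_ mi (mneg q) (@inner_le DL q) (@inner0 DL q) (ler0n _ _)).
  move=> /(_ (integr_cost (mneg q) (sqneg q))).
  have bal w : Omega A m w -> \int[mu]_p mdot (inner DL q p) (fdiff C (extd (n := n) w) p) +
      \int[mu]_p mdot (- inner DL q p) (fdiff C (extd (n := n) w) p) = 0.
    move=> wO; have i1 := integr_dot (sqin q) (exact_sq wO); rewrite dot_fieldE in i1.
    have -> : \int[mu]_p mdot (- inner DL q p) (fdiff C (extd (n := n) w) p) =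
        \int[mu]_p ((-1) * mdot (inner DL q p) (fdiff C (extd (n := n) w) p)).
      by apply: eq_Rintegral => p _; rewrite mdotN mulN1r.
    by rewrite RintZ // mulN1r subrr.
  move=> /(_ bal) key.
  have E1 : - (\int[mu]_p mdot (inner DL q p) (DL p)) = \int[mu]_p h q p.
    rewrite -mulN1r -RintZ; last first.
      have -> : (fun p : X => mdot (inner DL q p) (DL p)) = fun p => (-1) * h q p.
        by apply/funext => p; rewrite /inner mdotN mdotZ mulN1r.
      exact: integrZ.
    by apply: eq_Rintegral => p _; rewrite /inner mdotN mdotZ mulN1r opprK.
  rewrite E1 in key.
  have le1 : \int[mu]_p cost C (fun p => - inner DL q p) p <= e * N * \int[mu]_p h q p + e^-1 * \int[mu]_p Q p.
    rewrite -!RintZ // -RintD; first last.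
    - exact: integrZ.
    - exact: integrZ.
    apply: Rint_le; first exact: integr_cost.
      by apply: integrD; exact: integrZ.
    move=> p; apply: le_trans (HQ _ e p e0) _; rewrite lerD2r; apply: ler_wpM2l.
      by rewrite mulr_ge0 // ltW.
    rewrite negE mdotZ mdotC mdotZ mulrA /h le_eqVlt; apply/orP; left; apply/eqP; congr (_ * _).
    by rewrite /s; case: (trunc01 DL q p) => ->; rewrite ?mulr0 ?mulr1.
  have i0 : 0 <= \int[mu]_p h q p.
    apply: Rint_ge0 => p; have /andP[t0 _] := trunc_ge0 DL q p.
    by apply: mulr_ge0 => //; rewrite -dot_field dot_ge0.
  have le2 := le_trans key (ler_wpM2l B0 le1); rewrite mulrDr in le2.
  have half : B * (e * N * \int[mu]_p h q p) <= 2^-1 * \int[mu]_p h q p.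
    rewrite !mulrA; apply: ler_wpM2r => //.
    have -> : B * e * N = (B * N) * e by ring.
    by rewrite /e ler_pdivrMr ?mulr_gt0 ?ltr_wpDl //; lra.
  by rewrite /c; move: le2 half; lra.
split => //; rewrite dot_fieldE.
have md : measurable_fun setT (fun p : X => mdot (DL p) (DL p)).
  by have := measurable_dot mF mF; rewrite dot_fieldE.
have d0 (p : X) : 0 <= mdot (DL p) (DL p) by rewrite -dot_field dot_ge0.
apply: integr_ge0 => //.
have h0 q p : (0 <= (h q p)%:E)%E.
  by rewrite lee_fin; apply: mulr_ge0 => //; have /andP[] := trunc_ge0 DL q p.
apply: (@le_lt_trans _ _ c%:E); last exact: ltry.
have mh q : measurable_fun setT (fun p : X => (h q p)%:E).
  by apply/measurable_EFinP; exact: integr_measurable (ih q).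
have cvh (p : X) : (h q p)%:E @[q --> \oo] --> (mdot (DL p) (DL p))%:E.
  apply: (@cvg_trans _ ((fun=> (mdot (DL p) (DL p))%:E) @ \oo)); last exact: cvg_cst.
  apply: near_eq_cvg; have := trunc_eventually DL p; apply: filterS => q E.
  by rewrite /h /s E mul1r.
have nd (p : X) : {homo (fun q => (h q p)%:E) : i j / (i <= j)%N >-> (i <= j)%E}.
  by move=> i j ij; rewrite lee_fin; apply: ler_wpM2r => //; exact: trunc_homo.
have cv := @cvg_monotone_convergence _ X R mu setT measurableT _ mh (fun q p _ => h0 q p) (fun p _ => nd p).
have -> : (\int[mu]_p (mdot (DL p) (DL p))%:E = \int[mu]_p limn (fun q => (h q p)%:E))%E.
  by apply: eq_integral => p _; rewrite (cvg_lim _ (cvh p)).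
rewrite -(cvg_lim _ cv) //; apply: lime_le; first by apply/cvg_ex; eexists; exact: cv.
by apply: nearW => q; rewrite integr_EFin // lee_fin; exact: bound.
Qed.

(** ** The residual of the projection vanishes *)

Definition exact_field : set (Ix -> X -> R) :=
  [set v | exists2 w, Omega A m w & v = field (fdiff C (extd (n := n) w))].

Lemma exact_field_sq v : exact_field v -> sq mu v.
Proof. by move=> [w wO ->]; exact: exact_sq. Qed.

Lemma exact_field_lin a f h : exact_field f -> exact_field h -> exact_field (lin a f h).
Proof.
move=> [w1 O1 ->] [w2 O2 ->]; exists (fun p : tangent A m => a * w1 p + w2 p).
  exact: (Omega_add (Omega_scale a O1) O2).
have -> : extd (n := n) (fun p : tangent A m => a * w1 p + w2 p) =
    fun p => a * extd (n := n) w1 p + extd (n := n) w2 p.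
  by apply/funext => p; exact: extd_lin.
apply/funext => i; apply/funext => p; rewrite /field fdiff_lin; [|exact: extd_smooth|exact: extd_smooth].
rewrite /lin; move: (fdiff C (extd (n := n) w1) p) (fdiff C (extd (n := n) w2) p) => V1 V2.
by rewrite [RHS]mxE [X in _ = X + _]mxE.
Qed.

Lemma cost0 U p : U p = 0 -> cost C U p = 0.
Proof.
move=> U0; apply: big1 => j _.
rewrite -(pair_bigA_idem _ (fun I s => minor C (U p) p j (I, s))) ?addr0 //=; last exact: addr0.
apply: big1 => I _; rewrite big_bool /= addrC minor_sum det_frame_diff big1 ?normr0 ?mulr0 //.
by move=> l _; rewrite U0 !mxE mul0r.
Qed.

(** What the truncation leaves out of [- U]. *)
Definition outer U q : T -> 'M[R]_(n, d) := fun p => (trunc U q p - 1) *: U p.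

(** [inner u q] and [outer u q] add up to [- u], which is orthogonal to the exact
    fields, hence they are in balance. As [q] grows, the cost of [outer u q] tends to
    0, being dominated by [cost_le] and eventually 0 at each point. *)
Lemma residual_le u : sq mu u -> (forall v, exact_field v -> ip mu u v = 0) ->
  ip mu u (field DL) <= 0.
Proof.
move=> su orth; pose U := unfield u; have uE : u = field U by rewrite unfieldK.
have mU : mfield U.
  move=> j l; have -> : (fun p : X => U p j l) = u (j, l) by apply/funext => p; rewrite /U mxE.
  exact: su.1.
rewrite uE in su orth *.
have [B B0 HB] := critical_inequality C hM mu_hol sL crit.
have [N [Q [N0 iQ HQ]]] := cost_le.
have ms q : measurable_fun setT (trunc U q) by exact: measurable_trunc.
have mo q : mfield (outer U q).
  by apply: mfield_scale => //; apply: measurable_funB.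
have mi q : mfield (inner U q) by apply: mfield_opp; exact: mfield_scale.
have si q : sq mu (field (inner U q)) by apply: sq_bounded => // p; exact: inner_le.
have sum_io q (p : T) : inner U q p + outer U q p = - U p.
  by rewrite /inner /outer -scaleNr -scalerDl addrA addNr sub0r scaleN1r.
have so q : sq mu (field (outer U q)).
  have -> : field (outer U q) = lin (-1) (field U) (lin (-1) (field (inner U q)) (fun _ _ => 0)).
    apply/funext => i; apply/funext => p; rewrite /lin /field.
    have := congr1 (fun V : 'M[R]_(n, d) => V i.1 i.2) (sum_io q p); rewrite !mxE => E.
    by rewrite addr0; move: E; lra.
  apply: sq_lin => //; apply: sq_lin => //; split => [i|]; first exact: measurable_cst.
  rewrite (_ : dot _ _ = fun=> 0); first exact: integr0.
  by apply/funext => p; rewrite /dot big1 // => i _; rewrite mul0r.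
have sD := derivative_sq.
have bal q w : Omega A m w -> \int[mu]_p mdot (inner U q p) (fdiff C (extd (n := n) w) p) +
    \int[mu]_p mdot (outer U q p) (fdiff C (extd (n := n) w) p) = 0.
  move=> wO; have sw := exact_sq wO.
  have i1 := integr_dot (si q) sw; have i2 := integr_dot (so q) sw.
  rewrite dot_fieldE in i1; rewrite dot_fieldE in i2; rewrite -RintD //.
  have := orth _ (ex_intro2 _ _ w wO erefl); rewrite /ip dot_fieldE => o0.
  have i3 := integr_dot su sw; rewrite dot_fieldE in i3.
  rewrite -[RHS](mulr0 (-1)) -o0 -RintZ //; apply: eq_Rintegral => p _.
  rewrite mulN1r -mdotN -(sum_io q p) /mdot -big_split; apply: eq_bigr => j _.
  by rewrite -big_split; apply: eq_bigr => l _; rewrite [in RHS]mxE mulrDl.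
have iUD := integr_dot su sD; rewrite dot_fieldE in iUD.
pose F q (p : X) := trunc U q p * mdot (U p) (DL p).
have key q : \int[mu]_p F q p <= B * \int[mu]_p cost C (outer U q) p.
  have := HB (inner U q) (outer U q) q%:R (mi q) (mo q) (@inner_le U q) (@inner0 U q) (ler0n _ _)
    (integr_cost (mo q) (so q)) (bal q).
  have i1 := integr_dot (si q) sD; rewrite dot_fieldE in i1.
  rewrite -mulN1r -RintZ //; congr (_ <= _); apply: eq_Rintegral => p _.
  by rewrite /inner mdotN mdotZ mulN1r opprK.
have mF q : measurable_fun setT (F q).
  by apply: measurable_funM => //; exact: integr_measurable iUD.
have [||||_ cF] := @Rint_cvg _ X R mu F (fun p : X => mdot (U p) (DL p)) (fun p : X => `|mdot (U p) (DL p)|).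
- exact: mF.
- move=> p; apply: (@cvg_trans _ ((fun=> mdot (U p) (DL p)) @ \oo)); last exact: cvg_cst.
  apply: near_eq_cvg; have := trunc_eventually U p; apply: filterS => q E.
  by rewrite /F E mul1r.
- exact: integr_norm.
- move=> q p; rewrite /F normrM; have /andP[t0 t1] := trunc_ge0 U q p.
  by rewrite (ger0_norm t0) ler_piMl.
have [||||_ cG] := @Rint_cvg _ X R mu (fun q => cost C (outer U q)) (fun=> 0)
  (fun p : X => N * mdot (U p) (U p) + Q p).
- by move=> q; exact: measurable_cost.
- move=> p; apply: (@cvg_trans _ ((fun=> 0 : R) @ \oo)); last exact: cvg_cst.
  apply: near_eq_cvg; have := trunc_eventually U p; apply: filterS => q E.
  by rewrite cost0 // /outer E subrr scale0r.
- by have := su.2; rewrite dot_fieldE => ?; apply: integrD => //; exact: integrZ.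
- move=> q p; rewrite ger0_norm ?cost_ge0 //.
  have := HQ (outer U q) 1 p ltr01; rewrite invr1 !mul1r => /le_trans; apply; rewrite lerD2r.
  apply: ler_wpM2l => //; rewrite /outer mdotZ mdotC mdotZ mulrA.
  have d0 : 0 <= mdot (U p) (U p) by rewrite -dot_field dot_ge0.
  by rewrite -[leRHS]mul1r; apply: ler_wpM2r => //; case: (trunc01 U q p) => ->; lra.
have c1 : B * \int[mu]_p cost C (outer U q) p @[q --> \oo] --> B * \int[mu]_p (0 : R) by exact: cvgMr.
have i0 : \int[mu]_p (0 : R) = 0 by rewrite (Rint_cst_mu mu_hol).
rewrite i0 mulr0 in c1.
by rewrite /ip dot_fieldE; apply: (ler_cvg_to cF c1); exact: nearW.
Qed.

(** The residual [u] of [DL] satisfies (u, u) = (u, DL), which is at most 0. *)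
Lemma approximation : exists (w_ : nat -> tangent A m -> R), (forall k, Omega A m (w_ k)) /\
  exists c, forall k, let e := lin (-1) (field (fdiff C (extd (n := n) (w_ k)))) (field DL) in
    ip mu e e <= c * 2^-1 ^+ k.
Proof.
have sD := derivative_sq.
have V0 : exact_field (field (fdiff C (extd (n := n) (fun _ : tangent A m => 0)))).
  by exists (fun=> 0) => //; exact: Omega_0.
have [u [v_ [su Vv orth [c Hc]]]] := sq_projection exact_field_sq exact_field_lin V0 sD.
have uD := residual_le su orth.
have Vsq k := exact_field_sq (Vv k).
have se k : sq mu (lin (-1) u (lin (-1) (v_ k) (field DL))).
  by apply: sq_lin => //; apply: sq_lin.
have uu : ip mu u u <= 0.
  apply: (@le_geometric R _ _ c) => k; rewrite add0r; apply: le_trans (Hc k).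
  have := ip_le su (se k); set e := lin _ _ _.
  have -> : ip mu u e = - ip mu u u + ip mu u (field DL).
    by rewrite /e !ip_linr ?(orth _ (Vv k)) //; [ring|apply: sq_lin].
  have := ler_norm (- (- ip mu u u + ip mu u (field DL))); rewrite normrN.
  by move: uD; lra.
have u0 : ip mu u u = 0 by apply/eqP; rewrite eq_le uu ip_ge0.
have wP k : exists w, Omega A m w /\ v_ k = field (fdiff C (extd (n := n) w)).
  by have [w wO E] := Vv k; exists w.
have [w_ Hw] := choice wP; exists w_; split; first by move=> k; case: (Hw k).
exists (2 * c) => k /=; rewrite -(Hw k).2.
have -> : lin (-1) (v_ k) (field DL) = lin 1 u (lin (-1) u (lin (-1) (v_ k) (field DL))).
  by apply/funext => i; apply/funext => p; rewrite /lin; ring.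
rewrite ip_lin2 // u0; have := Hc k; have := ip_le su (se k); rewrite u0.
move: (lin (-1) u _) => e h1 h2; have := ler_norm (ip mu u e).
by move: h1 h2; rewrite /=; lra.
Qed.

Lemma gradient_limit : exists w_ : nat -> tangent A m -> R, (forall k, Omega A m (w_ k)) /\
  H_cvg g mu (fun k => vgrad g (extd (n := n) (w_ k))) (vgrad g L).
Proof.
have [w_ [wO [c Hc]]] := approximation; exists w_; split => //.
have sD := derivative_sq; split; [exact: sq_in_H|by move=> k; exact: grads|].
have [K K0 HK] := gdot_fdiff_le g C n.
pose W k p := fdiff C (extd (n := n) (w_ k)) p - fdiff C L p.
have mW k : mfield (W k).
  move=> j l; apply: (eq_measurable_fun (fun p : X => fdiff C (extd (n := n) (w_ k)) p j l - DL p j l)).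
    by move=> p _; rewrite /W !mxE.
  by apply: measurable_funB; apply: measurable_fdiff => //; exact: extd_smooth.
have WE k : ip mu (lin (-1) (field (fdiff C (extd (n := n) (w_ k)))) (field DL))
    (lin (-1) (field (fdiff C (extd (n := n) (w_ k)))) (field DL)) = \int[mu]_p mdot (W k p) (W k p).
  apply: eq_Rintegral => p _; rewrite -dot_field; apply: eq_bigr => i _.
  by rewrite /lin /field /W !mxE; ring.
have sW k : integr mu (fun p : X => mdot (W k p) (W k p)).
  have := (sq_lin (-1) sD (exact_sq (wO k))).2.
  congr (integr mu _); apply/funext => p; rewrite -dot_field; apply: eq_bigr => i _.
  by rewrite /lin /field /W !mxE; ring.
have vE k (p : T) : vgrad g (extd (n := n) (w_ k)) p - vgrad g L p = raised (W k) p *m O p.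
  rewrite !vgrad_raised //; last exact: extd_smooth.
  by rewrite /raised /W !mulmxBl.
pose H k := Hdot g mu (fun p => vgrad g (extd (n := n) (w_ k)) p - vgrad g L p)
  (fun p => vgrad g (extd (n := n) (w_ k)) p - vgrad g L p).
have HE k : 0 <= H k <= K * c * 2^-1 ^+ k.
  have mg : measurable_fun setT (fun p : X => gdot g (base p) (raised (W k) p *m O p) (raised (W k) p *m O p)).
    exact: measurable_gdot (mfield_raised (mW k)).
  have HI : H k = \int[mu]_p gdot g (base p) (raised (W k) p *m O p) (raised (W k) p *m O p).
    rewrite /H /Hdot /Rintegral -integral_supp; first last.
    - by move=> p; rewrite lee_fin; exact: gdot_ge0.
    - exact/measurable_EFinP.
    by congr fine; apply: eq_integral => p _; rewrite vE.
  rewrite HI; apply/andP; split; first by apply: Rint_ge0 => p; exact: gdot_ge0.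
  have iK : integr mu (fun p : X => K * mdot (W k p) (W k p)) by exact: integrZ.
  apply: (@le_trans _ _ (\int[mu]_p (K * mdot (W k p) (W k p)))).
    apply: Rint_le => //; last by move=> p; exact: (HK p (W k p)).1.
    apply: (integr_le mg) iK => p.
    by rewrite ger0_norm ?gdot_ge0 //; exact: (HK p (W k p)).1.
  by rewrite RintZ // -mulrA; apply: ler_wpM2l; [exact: ltW|rewrite -WE; exact: Hc].
have cq : K * c * 2^-1 ^+ k @[k --> \oo] --> (0 : R).
  rewrite -[X in _ --> X](mulr0 (K * c)); apply: cvgMr; apply: cvg_expr.
  by rewrite ger0_norm ?invr_ge0 // invf_lt1 // ltr1n.
have cH : H k @[k --> \oo] --> (0 : R).
  by apply: (squeeze_cvgr _ (cvg_cst 0) cq); exact: nearW.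
rewrite -[X in _ --> X]sqrtr0; rewrite /Hnorm.
exact: (continuous_cvg _ (@sqrt_continuous R 0) cH).
Qed.

End Final.

Theorem proposition28 (R : realType) (d n : nat) (M : ptopologicalType)
    (A : smooth_atlas R d M) (g : riemannian A)
    (L : tangent A n -> R) (mu : {measure set (borel A n) -> \bar R}) :
  (1 <= n <= d)%N ->
  hausdorff_space M -> compact [set: M] -> oriented A ->
  exact_gradients_in_H g mu ->
  smooth_fun L ->
  holonomic g mu ->
  critical g L mu ->
  exists w : nat -> tangent A n.-1 -> R,
    (forall i, Omega A n.-1 (w i)) /\
    H_cvg g mu (fun i => vgrad g (extd (w i))) (vgrad g L).
Proof.
case: n L mu => [|m] L mu // _ hM cM _ grads sL hol crit.
have [C _] := exists_cover A cM.
exact: (gradient_limit C hM hol grads sL crit).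
Qed.
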